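(* Let $n\geq 2$ be an integer, let $K$ be an algebraic number field, let $d:=[K:\mathbb{Q}]$, and let $S$ be a finite subset of $M_K$ containing all infinite places. For $v\in S$ let $$L_i^{(v)}=\alpha_{i1}^{(v)}X_1+\cdots+\alpha_{in}^{(v)}X_n\quad (i=1,\ldots,n)$$ be linearly independent linear forms with coefficients $\alpha_{ij}^{(v)}\in\overline{K_v}$ that are algebraic over $K$. Let $C_v>0$ $(v\in S)$ and $c_{iv}$ $(v\in S,\ i=1,\ldots,n)$ be reals, and let $H,D,R,\delta$ be such that all of the following hold: (i) $H(\alpha_{ij}^{(v)})\leq H$ and $[K(\alpha_{ij}^{(v)}):K]\leq D$ for $v\in S$, $i,j=1,\ldots,n$; (ii) $\#\bigcup_{v\in S}\{L_1^{(v)},\ldots,L_n^{(v)}\}\leq R$; (iii) $0<\prod_{v\in S}C_v\leq\prod_{v\in S}|\det(L_1^{(v)},\ldots,L_n^{(v)})|_v^{1/n}$; (iv) $\sum_{v\in S}\sum_{i=1}^n c_{iv}\leq-\delta$ with $0<\delta\leq 1$; (v) $\max(c_{1v},\ldots,c_{nv})=s(v)$ for $v\in S$. Let $Q\geq 1$. Then the set of $\mathbf{x}\in O_S^n$ satisfying $$|L_i^{(v)}(\mathbf{x})|_v\leq C_vH(\mathbf{x})^{c_{iv}}\quad(v\in S,\ i=1,\ldots,n)$$ and $$Q\leq H(\mathbf{x})<2Q^{1+\delta/2n}$$ is contained in a union of at most $(90n)^{nd}$ proper linear subspaces of $K^n$. If $K=\mathbb{Q}$ this upper bound can be replaced by 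$200^n$.
   Context: All number fields are contained in a fixed algebraic closure $\overline{\mathbb{Q}}$ of $\mathbb{Q}$. $M_{\mathbb{Q}}=\{\infty\}\cup\{\text{primes}\}$; $|\cdot|_\infty$ is the ordinary absolute value on $\mathbb{Q}$, $|\cdot|_p$ is the $p$-adic absolute value with $|p|_p=p^{-1}$, $\mathbb{Q}_p$ is the completion of $\mathbb{Q}$ at $p$, and $\mathbb{Q}_\infty=\mathbb{R}$. $M_K$ is the set of places of $K$, and $K_v$ is the completion of $K$ at $v$. For $v\in M_K$ lying above $p\in M_{\mathbb{Q}}$, the absolute value $|\cdot|_v$ is normalized so that its restriction to $\mathbb{Q}$ is $|\cdot|_p^{[K_v:\mathbb{Q}_p]/[K:\mathbb{Q}]}$; it is extended uniquely to the algebraic closure $\overline{K_v}$. With this normalization $\prod_{v\in M_K}|x|_v=1$ for $x\in K^*$. A place $v$ is infinite if $v\mid\infty$, finite otherwise; real if $K_v=\mathbb{R}$, complex if $K_v=\mathbb{C}$. The height of $\mathbf{x}=(x_1,\ldots,x_n)\in K^n$ is $H(\mathbf{x}):=\prod_{v\in M_K}\max(1,|x_1|_v,\ldots,|x_n|_v)$. The absolute height of an algebraic number $\xi$ of degree $m$ with conjugates $\xi^{(1)},\ldots,\xi^{(m)}$ in $\mathbb{C}$ is $H(\xi)=\big(a\prod_{i=1}^m\max(1,|\xi^{(i)}|)\big)^{1/m}$, where $a$ is the positive integer such that $a\prod_{i=1}^m(X-\xi^{(i)})$ has rational integral coefficients with gcd $1$. The symbol $H$ without argument denotes the real number bounding the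 heights of the coefficients. $O_S=\{x\in K:|x|_v\leq 1\text{ for }v\in M_K\setminus S\}$ is the ring of $S$-integers. $\det(L_1^{(v)},\ldots,L_n^{(v)})=\det(\alpha_{ij}^{(v)})$ is the coefficient determinant. Put $s(v):=1/[K:\mathbb{Q}]$ if $v$ is real, $s(v):=2/[K:\mathbb{Q}]$ if $v$ is complex, and $s(v):=0$ if $v$ is finite. The exponent $1+\delta/2n$ means $1+\frac{\delta}{2n}$. *)

(* Defs.v *)
From HB Require Import structures.
From mathcomp Require Export all_boot all_order all_algebra all_field.
From mathcomp Require Export finmap.
From mathcomp Require Export complex.
From mathcomp Require Export boolp classical_sets cardinality fsbigop.
From mathcomp Require Export reals exp.

Set Implicit Arguments.
Unset Strict Implicit.
Unset Printing Implicit Defensive.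

Import Order.TTheory GRing.Theory Num.Theory.
Local Open Scope classical_set_scope.
Local Open Scope ring_scope.

(* Throughout, [R : realType] is the field of real numbers, [R[i]] is the field
   of complex numbers, [algC] is the fixed algebraic closure of Q, and a number
   field is a [K : fieldExtType rat], of degree [\dim {:K}] over Q. *)

(** Degrees of field extensions inside an ambient field *)

(* [l : k] = m, for subfields k and l of L *)
Definition ext_degree (L : fieldType) (k l : set L) (m : nat) : Prop :=
  exists b : 'I_m -> L, (forall i, l (b i)) /\
    forall x, l x ->
      exists! c : {ffun 'I_m -> L}, (forall i, k (c i)) /\ x = \sum_i c i * b i.

(* the subfield K(a) of L, where K is embedded in L by f *)
Definition adjoin1 (K L : fieldType) (f : K -> L) (a : L) : set L :=
  [set x | exists p q : {poly K}, (map_poly f q).[a] != 0 /\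
                                  x = (map_poly f p).[a] / (map_poly f q).[a]].

(** Absolute values, completions, algebraic closures *)

Definition is_absval (R : realType) (F : fieldType) (f : F -> R) : Prop :=
  [/\ forall x, 0 <= f x,
      forall x, (f x == 0) = (x == 0),
      forall x y, f (x * y) = f x * f y &
      forall x y, f (x + y) <= f x + f y].

Inductive ratplace : Type := PInf | PFin (p : nat) of prime p.

Definition rat_abs (R : realType) (P : ratplace) (x : rat) : R :=
  match P with
  | PInf => ratr `|x|
  | PFin p _ =>
      if x == 0 then 0
      else p%:R ^ ((logn p `|denq x|%N)%:Z - (logn p `|numq x|%N)%:Z)
  end.

(* A completion of (F, f); it is unique up to a unique isomorphism. *)
Record completion (R : realType) (F : fieldType) (f : F -> R) := Completion {
  cfield :> fieldType;
  cabs : cfield -> R;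
  cemb : {rmorphism F -> cfield};
  cabs_absval : is_absval cabs;
  cabs_ext : forall x, cabs (cemb x) = f x;
  cemb_dense : forall x (e : R), 0 < e -> exists y, cabs (x - cemb y) < e;
  cabs_complete : forall u : nat -> cfield,
    (forall e : R, 0 < e -> exists N, forall i j,
       (N <= i)%N -> (N <= j)%N -> cabs (u i - u j) < e) ->
    exists l, forall e : R, 0 < e -> exists N, forall i,
       (N <= i)%N -> cabs (u i - l) < e }.

(* An algebraic closure of a completion, with the extended absolute value. *)
Record alg_closure (R : realType) (F : fieldType) (f : F -> R)
    (C : completion f) := AlgClosure {
  afield :> closedFieldType;
  aabs : afield -> R;
  aemb : {rmorphism cfield C -> afield};
  aemb_alg : forall x, algebraicOver aemb x;
  aabs_absval : is_absval aabs;
  aabs_ext : forall x, aabs (aemb x) = cabs x }.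

Definition base_emb (R : realType) (F : fieldType) (f : F -> R)
    (C : completion f) (A : alg_closure C) : F -> A := fun x => aemb A (cemb C x).

(** Places of a number field, represented by their normalized absolute value *)

(* the closure of Q in the completion: this is Q_p for the place p below *)
Definition rat_closure (R : realType) (K : fieldExtType rat) (f : K -> R)
    (C : completion f) : set C :=
  [set x | forall e : R, 0 < e -> exists q : rat, cabs (x - cemb C q%:A) < e].

(* f lies above P, and f restricts to |.|_P ^ ([K_v : Q_P] / [K : Q]) on Q *)
Definition normalized_above (R : realType) (K : fieldExtType rat) (f : K -> R)
    (P : ratplace) : Prop :=
  exists (C : completion f) (m : nat),
    ext_degree (@rat_closure R K f C) setT m /\
    forall x : rat, f x%:A = rat_abs R P x `^ (m%:R / (\dim {:K})%:R).

Record place (R : realType) (K : fieldExtType rat) := Place {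
  absv :> K -> R;
  absv_absval : is_absval absv;
  absv_normalized : exists P, normalized_above absv P }.

HB.instance Definition _ (R : realType) (K : fieldExtType rat) :=
  gen_eqMixin (place R K).
HB.instance Definition _ (R : realType) (K : fieldExtType rat) :=
  gen_choiceMixin (place R K).

Definition infinite_place (R : realType) (K : fieldExtType rat)
  (v : place R K) : Prop := normalized_above v PInf.

(* For an infinite place K_v is isomorphic to exactly one of R and C. *)
Definition real_place (R : realType) (K : fieldExtType rat) (v : place R K)
    (Kv : completion v) : Prop :=
  infinite_place v /\ exists phi : {rmorphism cfield Kv -> R}, bijective phi.

Definition complex_place (R : realType) (K : fieldExtType rat) (v : place R K)
    (Kv : completion v) : Prop :=
  infinite_place v /\ exists phi : {rmorphism cfield Kv -> R[i]}, bijective phi.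

Definition splace (R : realType) (K : fieldExtType rat) (v : place R K)
    (Kv : completion v) : R :=
  if `[< real_place Kv >] then 1 / (\dim {:K})%:R
  else if `[< complex_place Kv >] then 2 / (\dim {:K})%:R
  else 0.

(** S-integers and heights *)

Definition S_integers (R : realType) (K : fieldExtType rat)
    (S : {fset place R K}) : set K :=
  [set x | forall v : place R K, v \notin S -> v x <= 1].

(* All but finitely many of the factors are equal to 1. *)
Definition height (R : realType) (K : fieldExtType rat) (n : nat)
    (x : 'cV[K]_n) : R :=
  \big[*%R/1]_(v \in [set: place R K]) \big[Num.max/1]_(i < n) v (x i 0).

(* The primitive integral multiple a * \prod_i ('X - x^(i)) of the minimal
   polynomial over Q; [zcontents p = 1] also says that a > 0. *)
Definition min_int_poly (F : fieldType) (x : F) : {poly int} :=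
  xget 0 [set p : {poly int} |
    [/\ zcontents p = 1,
        irreducible_poly (map_poly intr p : {poly rat}) &
        root (map_poly intr p : {poly F}) x]].

Definition conjugates (R : realType) (F : fieldType) (x : F) : seq R[i] :=
  sval (closed_field_poly_normal (map_poly intr (min_int_poly x) : {poly R[i]})).

Definition abs_height (R : realType) (F : fieldType) (x : F) : R :=
  ((lead_coef (min_int_poly x))%:~R *
    \prod_(z <- conjugates R x) Num.max 1 (complex.Re `|z|))
  `^ ((size (conjugates R x))%:R^-1).

(* Main.v *)
(* Let [Lambda] be the set of [x] in [K^n] that are integral outside [S] and
   satisfy the inequalities at the finite places of [S], and let [X] be an
   [n x n] matrix whose rows are solutions. If [det X = c det Z] with [c] an
   integer and the rows of [Z] in [Lambda], then expanding the determinants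
   place by place and comparing with the product formula
   [1 <= \prod_(v in S) |det Z|_v] gives [|c| <= 2 n! 2^n] unless [det Z = 0].

   For general [K] take [m = 90 n]. There are at most [m^(n d)] classes of
   solutions modulo [m Lambda], and for solutions in one class the rows
   [x_1, (x_2 - x_1) / m, ..., (x_n - x_1) / m] of [Z] give [c = m^(n-1)],
   which is too large; so each class spans a proper subspace.

   For [K = Q] and [n >= 3] the lattice [Lambda] has a basis, in which the
   solutions are integer vectors all of whose [n x n] determinants are at most
   [2 n! 2^n] in absolute value. A pigeonhole argument in the dual lattice
   produces at most [200^n] integer linear forms such that every solution is
   a zero of one of them.

   The product formula comes from the description of the places of [K] as
   the absolute values induced by its [d] embeddings into an algebraically
   closed field with an absolute value. *)

From HB Require Import structures.
Require Import Defs.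
From mathcomp Require Import all_boot all_order all_algebra all_field.
From mathcomp Require Import fingroup perm finmap complex.
From mathcomp Require Import boolp classical_sets functions cardinality fsbigop.
From mathcomp Require Import reals exp.
From mathcomp Require Import generic_quotient ring_quotient ring lra zify.

Set Implicit Arguments.
Unset Strict Implicit.
Unset Printing Implicit Defensive.

Import Order.TTheory GRing.Theory Num.Theory.
Local Open Scope classical_set_scope.
Local Open Scope ring_scope.

(** * Absolute values and completions *)

(** A place is given by some completion and a local degree, so nothing is known in advance about
    which places lie above a rational place P, while the product formula needs all of them. They are
    caught by counting. Weak approximation bounds the sum of the local degrees of distinct places
    above P by d. Conversely, the d embeddings are linearly independent, so at most m of them induce
    a given place of local degree m. The two bounds meet, hence no place above P is missed.

    The constant 2 n! 2^n must not depend on the number of places, whereas the plain triangle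
    inequality would cost n! at every infinite place. Instead |x + y|_v <= 2^w max(|x|_v, |y|_v)
    with w = [weight v], which is 0 at finite places; expanding a determinant then costs (2 n!)^w,
    and the weights sum to 1. The factor 2^n has a similar origin: replacing H(x) by Q costs 2^w for
    each of the n forms, because c_iv <= s(v) <= w. The window for H(x) is such that the remaining
    powers of Q have total exponent at most -delta + delta/2. *)

Section AbsoluteValue.
Variables (R : realType) (F : fieldType) (f : F -> R) (hf : is_absval f).

Lemma av_ge0 x : 0 <= f x. Proof. by case: hf. Qed.
Lemma av_eq0 x : (f x == 0) = (x == 0). Proof. by case: hf. Qed.
Lemma avM : {morph f : x y / x * y}. Proof. by case: hf. Qed.
Lemma av_le_add x y : f (x + y) <= f x + f y. Proof. by case: hf. Qed.

Lemma av0 : f 0 = 0. Proof. by apply/eqP; rewrite av_eq0. Qed.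

Lemma av_gt0 x : (0 < f x) = (x != 0).
Proof. by rewrite lt0r av_ge0 andbT av_eq0. Qed.

Lemma av1 : f 1 = 1.
Proof.
have f1 : f 1 != 0 by rewrite av_eq0 oner_neq0.
by apply: (mulfI f1); rewrite -avM !mulr1.
Qed.

Lemma avX x n : f (x ^+ n) = f x ^+ n.
Proof. by elim: n => [|n IH]; rewrite ?expr0 ?av1 // !exprS avM IH. Qed.

Lemma avN x : f (- x) = f x.
Proof.
apply/eqP; rewrite -(@eqrXn2 _ 2) ?av_ge0 //.
by rewrite -!avX sqrrN.
Qed.

Lemma avV x : f x^-1 = (f x)^-1.
Proof.
have [->|x0] := eqVneq x 0; first by rewrite invr0 av0 invr0.
have fx : f x != 0 by rewrite av_eq0.
by apply: (mulfI fx); rewrite -avM !mulfV ?av1.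
Qed.

Lemma av_prod (I : Type) (r : seq I) (P : pred I) (g : I -> F) :
  f (\prod_(i <- r | P i) g i) = \prod_(i <- r | P i) f (g i).
Proof. exact: (big_morph f avM av1). Qed.

Lemma av_distC x y : f (x - y) = f (y - x).
Proof. by rewrite -opprB avN. Qed.

Lemma av_le_sub x y : f (x - y) <= f x + f y.
Proof. by rewrite -(avN y) av_le_add. Qed.

Lemma av_tri x y z : f (x - z) <= f (x - y) + f (y - z).
Proof. by rewrite -[x - z](subrKA y) av_le_add. Qed.

Lemma av_ge_sub x y : f x - f y <= f (x - y).
Proof. by rewrite lerBlDr; apply: le_trans (av_le_add _ _); rewrite subrK. Qed.

Lemma av_ler_dist x y : `|f x - f y| <= f (x - y).
Proof. by rewrite ler_norml lerNl opprB av_ge_sub av_distC av_ge_sub. Qed.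

Lemma av_le_sum (I : Type) (r : seq I) (P : pred I) (g : I -> F) :
  f (\sum_(i <- r | P i) g i) <= \sum_(i <- r | P i) f (g i).
Proof.
elim/big_rec2: _ => [|i y x _ le_xy]; first by rewrite av0.
by apply: le_trans (av_le_add _ _) _; rewrite lerD2l.
Qed.

(** Normalizing a place raises an absolute value to the power local degree over global degree, an
    exponent in ]0, 1]. The triangle inequality survives because t <= t^s on [0, 1]. *)
Lemma absval_powR s : 0 < s <= 1 -> is_absval (fun x => f x `^ s).
Proof.
move=> /andP[s0 s1]; split=> [x|x|x y|x y]; first exact: powR_ge0.
- by rewrite powR_eq0 av_eq0 gt_eqF ?andbT.
- by rewrite avM powRM ?av_ge0.
have [xy0|xy0] := eqVneq (f x + f y) 0.
  rewrite (le_trans (y := 0)) ?addr_ge0 ?powR_ge0 //.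
  have : f (x + y) <= 0 by rewrite -xy0 av_le_add.
  rewrite le_eqVlt ltNge av_ge0 orbF => /eqP ->.
  by rewrite powR0 ?gt_eqF.
have p0 : 0 < f x + f y by rewrite lt0r xy0 addr_ge0 ?av_ge0.
(* with [a + b = 1], [a <= a ^ s] and [b <= b ^ s] *)
have key z : f z <= f x + f y -> f z / (f x + f y) <= (f z / (f x + f y)) `^ s.
  move=> zle; have [->|z0] := eqVneq (f z) 0; first by rewrite mul0r powR_ge0.
  apply: ger1_powR => //; rewrite ler_pdivrMr // mul1r zle andbT.
  by rewrite divr_gt0 // lt0r z0 av_ge0.
have le_add : 1 <= (f x / (f x + f y)) `^ s + (f y / (f x + f y)) `^ s.
  rewrite -[leLHS](divff xy0) mulrDl; apply: lerD; apply: key.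
    by rewrite lerDl av_ge0.
  by rewrite lerDr av_ge0.
have : f (x + y) `^ s <= (f x + f y) `^ s.
  by rewrite ge0_ler_powR ?nnegrE ?av_ge0 ?av_le_add // ltW.
move=> /le_trans; apply.
rewrite -[leLHS]mulr1; apply: le_trans (ler_wpM2l (powR_ge0 _ _) le_add) _.
have cancel z : (f x + f y) * (z / (f x + f y)) = z by rewrite mulrC divfK.
by rewrite mulrDr -!powRM ?divr_ge0 ?av_ge0 ?(ltW p0) // !cancel.
Qed.

End AbsoluteValue.

(** * Limits of real sequences *)

Section RealLimits.
Variable R : realType.
Implicit Types (a b : nat -> R) (l m : R).

Definition tends a l :=
  forall e, 0 < e -> exists N, forall i, (N <= i)%N -> `|a i - l| < e.

Lemma tends_cst l : tends (fun=> l) l.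
Proof. by move=> e e0; exists 0%N => i _; rewrite subrr normr0. Qed.

Lemma tends_eventually a b l N :
  (forall i, (N <= i)%N -> a i = b i) -> tends a l -> tends b l.
Proof.
move=> ab al e /al[M hM]; exists (maxn N M) => i; rewrite geq_max.
by move=> /andP[Ni Mi]; rewrite -ab ?hM.
Qed.

Lemma tendsD a b l m : tends a l -> tends b m -> tends (fun i => a i + b i) (l + m).
Proof.
move=> al bm e e0; have e20 : 0 < e / 2 by rewrite divr_gt0.
have [[N hN] [M hM]] := (al _ e20, bm _ e20).
exists (maxn N M) => i; rewrite geq_max => /andP[Ni Mi].
rewrite opprD addrACA [e]splitr (le_lt_trans (ler_normD _ _)) //.
by rewrite ltrD ?hN ?hM.
Qed.

Lemma tendsM a b l m : tends a l -> tends b m -> tends (fun i => a i * b i) (l * m).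
Proof.
move=> al bm e e0.
have L0 : 0 < `|l| + 1 by rewrite ltr_wpDl.
have M0 : 0 < `|m| + 1 by rewrite ltr_wpDl.
pose d := e / 2 / (`|l| + 1); have d0 : 0 < d by rewrite !divr_gt0.
pose c := e / 2 / (`|m| + 1); have c0 : 0 < c by rewrite !divr_gt0.
have [[N1 h1] [N2 h2] [N3 h3]] := And3 (al _ ltr01) (al _ c0) (bm _ d0).
exists (maxn N1 (maxn N2 N3)) => i; rewrite !geq_max => /and3P[i1 i2 i3].
have -> : a i * b i - l * m = a i * (b i - m) + (a i - l) * m by ring.
have le_a : `|a i| <= `|l| + 1.
  rewrite -(subrK l (a i)) addrC (le_trans (ler_normD _ _)) // lerD2l.
  by rewrite ltW ?h1.
rewrite (le_lt_trans (ler_normD _ _)) // !normrM [e]splitr ltr_leD //.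
  rewrite (le_lt_trans (ler_wpM2r (normr_ge0 _) le_a)) // mulrC.
  by rewrite -ltr_pdivlMr ?h3.
rewrite (le_trans (y := c * `|m|)) ?ler_wpM2r ?(ltW (h2 _ _)) //.
by rewrite (le_trans (ler_wpM2l (ltW c0) (_ : _ <= `|m| + 1))) ?lerDl // divfK // gt_eqF.
Qed.

Lemma tends_le a b l m :
  (forall i, a i <= b i) -> tends a l -> tends b m -> l <= m.
Proof.
move=> ab al bm; apply/ler_addgt0Pr => e e0.
have e20 : 0 < e / 2 by rewrite divr_gt0.
have [[N hN] [M hM]] := (al _ e20, bm _ e20).
have := hN _ (leq_maxl N M); have := hM _ (leq_maxr N M).
rewrite !ltr_distl => /andP[_ h1] /andP[h2 _].
have := ab (maxn N M); lra.
Qed.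

Lemma tends_unique a l m : tends a l -> tends a m -> l = m.
Proof.
by move=> al am; apply/eqP; rewrite eq_le !(tends_le _ al am, tends_le _ am al).
Qed.

(** The limit is the supremum of the eventual lower bounds of the sequence. *)
Lemma real_cauchy_tends a :
  (forall e, 0 < e -> exists N, forall i j,
     (N <= i)%N -> (N <= j)%N -> `|a i - a j| < e) -> exists l, tends a l.
Proof.
move=> cu.
pose E := [set x | exists N, forall i, (N <= i)%N -> x <= a i].
have E_ub y : (exists N, forall i, (N <= i)%N -> a i <= y) -> ubound E y.
  move=> [N hN] x [M hM]; apply: le_trans (hM (maxn M N) (leq_maxl _ _)) _.
  by apply: hN; exact: leq_maxr.
have bounds e : 0 < e -> exists N, [/\ E (a N - e), ubound E (a N + e) &
    forall i, (N <= i)%N -> `|a i - a N| < e].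
  move=> e0; have [N hN] := cu e e0; exists N.
  have hi i : (N <= i)%N -> `|a i - a N| < e by move=> Ni; apply: hN.
  split=> //.
    by exists N => i /hi; rewrite ltr_distl => /andP[/ltW].
  by apply: E_ub; exists N => i /hi; rewrite ltr_distl => /andP[_ /ltW].
have [N0 [EN0 ubN0 _]] := bounds 1 ltr01.
exists (sup E) => e e0; have e20 : 0 < e / 2 by rewrite divr_gt0.
have [N [EN ubN hN]] := bounds _ e20; exists N => i /hN.
have s1 : a N - e / 2 <= sup E by apply: ub_le_sup => //; exists (a N0 + 1).
have s2 : sup E <= a N + e / 2 by apply: ge_sup => //; exists (a N0 - 1).
rewrite !ltr_distl => /andP[h1 h2]; apply/andP; split; lra.
Qed.

End RealLimits.

(** * The completion by Cauchy sequences modulo null sequences *)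

Section Completion.
Variables (R : realType) (F : fieldType) (f : F -> R) (hf : is_absval f).
Implicit Types u v : nat -> F.

Definition cauchyb u : bool := `[< forall e, 0 < e -> exists N, forall i j,
  (N <= i)%N -> (N <= j)%N -> f (u i - u j) < e >].

Lemma cauchy_bounded u : cauchyb u -> exists2 B, 0 < B & forall i, f (u i) <= B.
Proof.
move=> /asboolP/(_ 1 ltr01)[N hN].
exists (1 + f (u N) + \sum_(j < N) f (u j)) => [|i].
  rewrite -addrA ltr_wpDr // addr_ge0 ?av_ge0 ?sumr_ge0 // => j _.
  exact: av_ge0.
have [iN|Ni] := ltnP i N.
  rewrite (bigD1 (Ordinal iN)) //= addrCA lerDl !addr_ge0 ?av_ge0 // sumr_ge0 //.
  by move=> j _; exact: av_ge0.
apply: (@le_trans _ _ (1 + f (u N))); last first.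
  by rewrite lerDl sumr_ge0 // => j _; exact: av_ge0.
by rewrite -lerBlDr (le_trans (av_ge_sub hf _ _)) // ltW // hN.
Qed.

Lemma cauchyb_subring : GRing.subring_closed cauchyb.
Proof.
split.
- by apply/asboolP => e e0; exists 0%N => i j _ _; rewrite /= subrr (av0 hf).
- move=> u v /asboolP cu /asboolP cv; apply/asboolP => e e0.
  have e20 : 0 < e / 2 by rewrite divr_gt0.
  have [[N hN] [M hM]] := (cu _ e20, cv _ e20).
  exists (maxn N M) => i j; rewrite !geq_max => /andP[Ni Mi] /andP[Nj Mj].
  have -> : (u - v) i - (u - v) j = (u i - u j) - (v i - v j).
    by rewrite !fctE; ring.
  apply: le_lt_trans (av_le_sub hf _ _) _.
  by rewrite [e]splitr ltrD ?hN ?hM.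
- move=> u v cu cv; apply/asboolP => e e0.
  have [[A A0 hA] [B B0 hB]] := (cauchy_bounded cu, cauchy_bounded cv).
  have dA : 0 < e / 2 / A by rewrite !divr_gt0.
  have dB : 0 < e / 2 / B by rewrite !divr_gt0.
  have [[N hN] [M hM]] := (asboolP _ cu _ dB, asboolP _ cv _ dA).
  exists (maxn N M) => i j; rewrite !geq_max => /andP[Ni Mi] /andP[Nj Mj].
  have -> : (u * v) i - (u * v) j = u i * (v i - v j) + (u i - u j) * v j.
    by rewrite !fctE; ring.
  apply: le_lt_trans (av_le_add hf _ _) _; rewrite !(avM hf) [e]splitr.
  have s1 : f (u i) * f (v i - v j) < e / 2.
    have := hM i j Mi Mj; rewrite ltr_pdivlMr // mulrC => /(le_lt_trans _); apply.
    by rewrite ler_wpM2r ?av_ge0.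
  have s2 : f (u i - u j) * f (v j) < e / 2.
    have := hN i j Ni Nj; rewrite ltr_pdivlMr // => /(le_lt_trans _); apply.
    by rewrite ler_wpM2l ?av_ge0.
  exact: ltrD.
Qed.

HB.instance Definition _ :=
  GRing.isSubringClosed.Build (nat -> F) cauchyb cauchyb_subring.

Record cseq := CSeq { cseq_val :> nat -> F; _ : cauchyb cseq_val }.
HB.instance Definition _ := [isSub for cseq_val].
HB.instance Definition _ := [Choice of cseq by <:].
HB.instance Definition _ := [SubChoice_isSubComNzRing of cseq by <:].

Definition nullb (u : cseq) : bool :=
  `[< forall e, 0 < e -> exists N, forall i, (N <= i)%N -> f (u i) < e >].

Lemma cseqD (u v : cseq) i : (u + v) i = u i + v i. Proof. by []. Qed.
Lemma cseqN (u : cseq) i : (- u) i = - u i. Proof. by []. Qed.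
Lemma cseqM (u v : cseq) i : (u * v) i = u i * v i. Proof. by []. Qed.
Lemma cseq0 i : (0 : cseq) i = 0. Proof. by []. Qed.
Lemma cseq1 i : (1 : cseq) i = 1. Proof. by []. Qed.

Lemma nullb_idealr : idealr_closed nullb.
Proof.
split.
- by apply/asboolP => e e0; exists 0%N => i _; rewrite cseq0 (av0 hf).
- apply/negP => /asboolP /(_ 1 ltr01)[N /(_ N (leqnn N))].
  by rewrite cseq1 (av1 hf) ltxx.
- move=> a u v /asboolP nu /asboolP nv; apply/asboolP => e e0.
  have [A A0 hA] := cauchy_bounded (valP a).
  have [||[N hN] [M hM]] := (nu (e / 2 / A) _, nv (e / 2) _).
    by rewrite !divr_gt0.
  by rewrite divr_gt0.
  exists (maxn N M) => i; rewrite geq_max => /andP[Ni Mi].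
  rewrite cseqD cseqM; apply: le_lt_trans (av_le_add hf _ _) _.
  rewrite (avM hf) [e]splitr ltrD ?hM //.
  have := hN i Ni; rewrite ltr_pdivlMr // mulrC => /(le_lt_trans _); apply.
  by rewrite ler_wpM2r ?av_ge0 ?hA.
Qed.

HB.instance Definition _ := isIdealr.Build cseq nullb nullb_idealr.

Definition null_ideal : idealr cseq := nullb.

Definition compl := {ideal_quot null_ideal}.

HB.instance Definition _ := GRing.ComNzRing.on compl.

Local Notation pi := (\pi_compl%qT).

Lemma pi_eq0 (u : cseq) : (pi u == 0) = nullb u.
Proof. by rewrite -[X in _ == X](rmorph0 \pi_compl%qT) -Quotient.idealrBE subr0. Qed.

Lemma cseq_tends (u : cseq) : exists l, tends (f \o u) l.
Proof.
apply: real_cauchy_tends => e e0; have [N hN] := asboolP _ (valP u) _ e0.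
exists N => i j Ni Nj; apply: le_lt_trans (hN i j Ni Nj).
exact: av_ler_dist.
Qed.

Lemma cseq_nullP (u : cseq) : reflect (tends (f \o u) 0) (nullb u).
Proof.
apply: (iffP idP) => [/asboolP nu|tu]; last apply/asboolP.
  by move=> e /nu[N hN]; exists N => i /hN /=; rewrite subr0 ger0_norm ?av_ge0.
by move=> e /tu[N hN]; exists N => i /hN /=; rewrite subr0 ger0_norm ?av_ge0.
Qed.

Lemma pi_surj (q : compl) : exists u : cseq, q = pi u.
Proof. by exists (repr q); rewrite reprK. Qed.

(** The limit of [f] along the chosen representative. It always exists, so the default 0 does not
    occur, and every other representative has the same limit ([compl_abs_tends]). *)
Definition compl_abs (q : compl) : R := xget 0 [set l | tends (f \o repr q) l].

Lemma compl_abs_tends (u : cseq) : tends (f \o u) (compl_abs (pi u)).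
Proof.
set v : cseq := repr (pi u).
have tv : tends (f \o v) (compl_abs (pi u)).
  rewrite /compl_abs; case: xgetP => [l -> //|no].
  by have [l /no] := cseq_tends v.
have : nullb (u - v).
  by rewrite -pi_eq0 rmorphB /= /v reprK subrr.
move=> /cseq_nullP nuv e e0; have e20 : 0 < e / 2 by rewrite divr_gt0.
have [[N hN] [M hM]] := (nuv _ e20, tv _ e20).
exists (maxn N M) => i; rewrite geq_max => /andP[/hN + /hM] /=.
rewrite subr0 ger0_norm ?av_ge0 // => lt1 lt2.
apply: le_lt_trans (ler_distD (f (v i)) _ _) _; rewrite [e]splitr ltrD //.
exact: le_lt_trans (av_ler_dist hf _ _) lt1.
Qed.

Lemma compl_abs_absval0 q : (compl_abs q == 0) = (q == 0).
Proof.
have [u ->] := pi_surj q; rewrite pi_eq0; apply/eqP/idP => [u0|/cseq_nullP nu].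
  by apply/cseq_nullP; rewrite -u0; exact: compl_abs_tends.
exact: tends_unique (compl_abs_tends u) nu.
Qed.

Lemma compl_absM : {morph compl_abs : q r / q * r}.
Proof.
move=> q r; have [[u ->] [v ->]] := (pi_surj q, pi_surj r).
rewrite -rmorphM; apply: tends_unique (compl_abs_tends _) _.
apply: (@tends_eventually _ (fun i => f (u i) * f (v i)) _ _ 0) => [i _|].
  by rewrite -(avM hf).
by apply: tendsM; exact: compl_abs_tends.
Qed.

Lemma compl_abs_le_add q r : compl_abs (q + r) <= compl_abs q + compl_abs r.
Proof.
have [[u ->] [v ->]] := (pi_surj q, pi_surj r).
rewrite -rmorphD; apply: tends_le (compl_abs_tends _) _; last first.
  by apply: tendsD; exact: compl_abs_tends.
by move=> i; exact: av_le_add hf (u i) (v i).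
Qed.

Lemma compl_abs_ge0 q : 0 <= compl_abs q.
Proof.
have [u ->] := pi_surj q; apply: tends_le (tends_cst 0) (compl_abs_tends u).
by move=> i; exact: av_ge0.
Qed.

(** A Cauchy sequence that is not null is eventually bounded away from 0, so its termwise inverse is
    Cauchy; the finitely many earlier terms, where it may vanish, do not change the class. *)
Lemma compl_inv_ex (q : compl) : q != 0 -> exists r, r * q = 1.
Proof.
move=> q0; have [u qu] := pi_surj q; pose l := compl_abs q.
have l0 : 0 < l by rewrite lt0r compl_abs_ge0 compl_abs_absval0 q0.
have l20 : 0 < l / 2 by rewrite divr_gt0.
have [N hN] : exists N, forall i, (N <= i)%N -> l / 2 <= f (u i).
  have [N hN] := compl_abs_tends u l20; exists N => i /hN /=.
  rewrite -qu -/l ltr_distl => /andP[h _]; apply: ltW; lra.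
have u0 i : (N <= i)%N -> u i != 0.
  by move=> /hN; apply: contraTneq => ->; rewrite (av0 hf) -ltNge.
pose w i := (u i)^-1.
have cw : cauchyb w.
  apply/asboolP => e e0.
  (* The inverses differ by |u_j - u_i| / (|u_i| |u_j|), and from [N] on the denominator is at least
     (l / 2)^2. *)
  have d0 : 0 < e * (l / 2) ^+ 2 by rewrite mulr_gt0 ?exprn_gt0.
  have [M hM] := asboolP _ (valP u) _ d0.
  exists (maxn N M) => i j; rewrite !geq_max => /andP[Ni Mi] /andP[Nj Mj].
  have -> : w i - w j = (u j - u i) / (u i * u j).
    by rewrite /w; field; rewrite !u0.
  rewrite (avM hf) (avV hf) (avM hf) ltr_pdivrMr; last first.
    by rewrite mulr_gt0 // (av_gt0 hf) u0.
  apply: lt_le_trans (hM _ _ Mj Mi) _; rewrite ler_pM2l // expr2.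
  by rewrite ler_pM ?hN // ltW.
exists (pi (CSeq cw)); rewrite qu -rmorphM /=; apply/eqP.
rewrite -subr_eq0 -(rmorph1 \pi_compl%qT) -rmorphB /= pi_eq0; apply/asboolP => e e0.
by exists N => i Ni; rewrite cseqD cseqN cseqM cseq1 /= mulVf ?u0 // subrr (av0 hf).
Qed.

Definition compl_inv (q : compl) : compl := xget 0 [set r | r * q = 1].

Lemma compl_mulVf (q : compl) : q != 0 -> compl_inv q * q = 1.
Proof.
move=> /compl_inv_ex[r rq]; rewrite /compl_inv; case: xgetP => [y -> //|no].
by have := no r rq.
Qed.

Lemma compl_inv0 : compl_inv 0 = 0.
Proof.
rewrite /compl_inv; case: xgetP => [y _ /=|//].
by rewrite mulr0 => /eqP; rewrite eq_sym oner_eq0.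
Qed.

HB.instance Definition _ :=
  GRing.ComNzRing_isField.Build compl compl_mulVf compl_inv0.

Lemma compl_absval : is_absval compl_abs.
Proof.
split; [exact: compl_abs_ge0|exact: compl_abs_absval0|exact: compl_absM|].
exact: compl_abs_le_add.
Qed.

Lemma cauchyb_cst (x : F) : cauchyb (fun=> x).
Proof. by apply/asboolP => e e0; exists 0%N => i j _ _; rewrite subrr (av0 hf). Qed.

Definition compl_emb (x : F) : compl := pi (CSeq (cauchyb_cst x)).

Lemma compl_emb_zmod : zmod_morphism compl_emb.
Proof.
move=> x y; rewrite /compl_emb -rmorphB; congr (pi _).
by apply: val_inj; apply: funext.
Qed.

Lemma compl_emb_monoid : monoid_morphism compl_emb.
Proof.
split=> [|x y]; rewrite /compl_emb -?rmorphM -?(rmorph1 \pi_compl%qT); congr (pi _);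
  by apply: val_inj; apply: funext.
Qed.

HB.instance Definition _ := GRing.isZmodMorphism.Build F compl compl_emb compl_emb_zmod.
HB.instance Definition _ :=
  GRing.isMonoidMorphism.Build F compl compl_emb compl_emb_monoid.

Lemma compl_abs_emb x : compl_abs (compl_emb x) = f x.
Proof.
exact: tends_unique (compl_abs_tends (CSeq (cauchyb_cst x))) (tends_cst (f x)).
Qed.

Lemma compl_approx (u : cseq) e : 0 < e ->
  exists N, forall i, (N <= i)%N -> compl_abs (pi u - compl_emb (u i)) < e.
Proof.
move=> e0; have e20 : 0 < e / 2 by rewrite divr_gt0.
have [N hN] := asboolP _ (valP u) _ e20; exists N => i Ni.
rewrite -rmorphB; set v := (u - _).
apply: le_lt_trans (_ : e / 2 < e); last by rewrite [ltRHS]splitr ltrDl.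
have tv := compl_abs_tends v.
pose v' := (fun j => f (v (j + N)%N)).
have tv' : tends v' (compl_abs (pi v)).
  move=> d /tv[M hM]; exists M => j Mj; apply: hM; exact: leq_trans (leq_addr _ _).
apply: tends_le tv' (tends_cst _) => j; rewrite /v' /v cseqD cseqN /=.
by rewrite ltW // hN // leq_addl.
Qed.

Lemma compl_dense (q : compl) e : 0 < e -> exists x, compl_abs (q - compl_emb x) < e.
Proof.
move=> e0; have [u ->] := pi_surj q; have [N hN] := compl_approx u e0.
by exists (u N); exact: hN.
Qed.

(** The limit is the class of a sequence of elements of [F] whose i-th term is within 1 / (i + 1) of
    [w i]. *)
Lemma compl_complete (w : nat -> compl) :
  (forall e, 0 < e -> exists N, forall i j,
    (N <= i)%N -> (N <= j)%N -> compl_abs (w i - w j) < e) ->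
  exists l, forall e, 0 < e -> exists N, forall i, (N <= i)%N -> compl_abs (w i - l) < e.
Proof.
move=> cw; have ca := compl_absval.
have h0 i : 0 < i.+1%:R^-1 :> R by rewrite invr_gt0 ltr0n.
have [x hx] := choice (fun i => compl_dense (w i) (h0 i)).
have small (e : R) : 0 < e -> exists N, forall i, (N <= i)%N -> i.+1%:R^-1 < e.
  move=> e0; exists (Num.truncn e^-1) => i Ni.
  rewrite invf_plt ?posrE ?ltr0n //.
  by apply: lt_le_trans (truncnS_gt _) _; rewrite ler_nat ltnS.
have cx : cauchyb x.
  apply/asboolP => e e0; have e30 : 0 < e / 3 by rewrite divr_gt0.
  have [[N hN] [M hM]] := (cw _ e30, small _ e30).
  exists (maxn N M) => i j; rewrite !geq_max => /andP[Ni Mi] /andP[Nj Mj].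
  rewrite -compl_abs_emb rmorphB /=.
  have := av_tri ca (compl_emb (x i)) (w i) (compl_emb (x j)).
  rewrite (av_distC ca _ (w i)).
  have := av_tri ca (w i) (w j) (compl_emb (x j)).
  have := lt_trans (hx i) (hM i Mi); have := lt_trans (hx j) (hM j Mj).
  have := hN i j Ni Nj; lra.
exists (pi (CSeq cx)) => e e0; have e20 : 0 < e / 2 by rewrite divr_gt0.
have [[N hN] [M hM]] := (compl_approx (CSeq cx) e20, small _ e20).
exists (maxn N M) => i; rewrite !geq_max => /andP[Ni Mi].
apply: le_lt_trans (av_tri ca _ (compl_emb (x i)) _) _.
rewrite [e]splitr ltrD ?(lt_trans (hx i) (hM i Mi)) //.
by rewrite (av_distC ca) hN.
Qed.

(** Being a place includes having a completion in which the local degree is measured. The places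
    induced by embeddings obtain theirs from here. *)
Lemma completion_exists : inhabited (completion f).
Proof.
by constructor; exact: (@Completion R F f compl compl_abs compl_emb compl_absval
  compl_abs_emb compl_dense compl_complete).
Qed.

End Completion.

(** * Local degrees *)

Section CompleteSubfield.
Variables (R : realType) (F : fieldType) (g : F -> R) (hg : is_absval g).
Hypothesis g_complete : forall u : nat -> F,
  (forall e : R, 0 < e -> exists N, forall i j,
     (N <= i)%N -> (N <= j)%N -> g (u i - u j) < e) ->
  exists l, forall e : R, 0 < e -> exists N, forall i, (N <= i)%N -> g (u i - l) < e.

Definition closed_subfield (k : set F) := [/\ k 1,
  forall x y, k x -> k y -> k (x - y),
  forall x y, k x -> k y -> k (x * y),
  forall x, k x -> k x^-1 &
  forall x, (forall e, 0 < e -> exists2 y, k y & g (x - y) < e) -> k x].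

Variables (k : set F) (hk : closed_subfield k).

Definition kspan m (b : 'I_m -> F) : set F :=
  [set x | exists2 c : 'I_m -> F, (forall i, k (c i)) & x = \sum_i c i * b i].

Definition kfree m (b : 'I_m -> F) := forall c : 'I_m -> F,
  (forall i, k (c i)) -> \sum_i c i * b i = 0 -> forall i, c i = 0.

(** The nontrivial half of the equivalence of norms; the other half is the triangle inequality. *)
Definition norm_equiv m (b : 'I_m -> F) := exists2 C : R, 0 < C &
  forall c : 'I_m -> F, (forall i, k (c i)) ->
    forall i, C * g (c i) <= g (\sum_i c i * b i).

Lemma k1 : k 1. Proof. by case: hk. Qed.
Lemma kB x y : k x -> k y -> k (x - y). Proof. by case: hk => _ + _ _ _; apply. Qed.
Lemma k0 : k 0. Proof. by rewrite -(subrr 1); apply: kB; exact: k1. Qed.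
Lemma kN x : k x -> k (- x). Proof. by rewrite -sub0r; apply: kB; exact: k0. Qed.
Lemma kD x y : k x -> k y -> k (x + y).
Proof. by move=> kx ky; rewrite -[y]opprK; apply: kB => //; exact: kN. Qed.
Lemma kM x y : k x -> k y -> k (x * y). Proof. by case: hk => _ _ + _ _; apply. Qed.
Lemma kV x : k x -> k x^-1. Proof. by case: hk => _ _ _ + _; apply. Qed.
Lemma k_closed x : (forall e, 0 < e -> exists2 y, k y & g (x - y) < e) -> k x.
Proof. by case: hk => _ _ _ _; apply. Qed.

Lemma inv_succ_lt (e : R) : 0 < e ->
  exists N, forall i, (N <= i)%N -> i.+1%:R^-1 < e.
Proof.
move=> e0; exists (Num.truncn e^-1) => i Ni.
rewrite invf_plt ?posrE ?ltr0n //.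
by apply: lt_le_trans (truncnS_gt _) _; rewrite ler_nat ltnS.
Qed.

Lemma av_small_eq0 x : (forall e, 0 < e -> g x < e) -> x = 0.
Proof.
move=> small; apply/eqP; rewrite -(av_eq0 hg) eq_le av_ge0 // andbT.
by apply/ler_addgt0Pr => e /small/ltW; rewrite add0r.
Qed.

(** By equivalence of norms the coordinates of approximations to [x] form Cauchy sequences. Their
    limits lie in the closed set [k] and are coordinates of [x]. *)
Lemma kspan_closed m (b : 'I_m -> F) x : norm_equiv b ->
  (forall e, 0 < e -> exists2 y, kspan b y & g (x - y) < e) -> kspan b x.
Proof.
move=> [C C0 hC] apx.
have /choice[c hc] : forall n, exists c : 'I_m -> F, (forall i, k (c i)) /\
    g (x - \sum_i c i * b i) < n.+1%:R^-1.
  move=> n; have [|y [c kc ->] hy] := apx n.+1%:R^-1; last by exists c.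
  by rewrite invr_gt0 ltr0n.
have lim i : exists l, forall e : R, 0 < e -> exists N, forall n, (N <= n)%N -> g (c n i - l) < e.
  apply: g_complete => e e0.
  have d0 : 0 < C * e / 2 by rewrite divr_gt0 ?mulr_gt0.
  have [N hN] := inv_succ_lt d0; exists N => n p Nn Np.
  rewrite -(ltr_pM2l C0).
  apply: le_lt_trans (hC (fun i => c n i - c p i) _ i) _.
    by move=> j; apply: kB; [case: (hc n)|case: (hc p)].
  have -> : \sum_i (c n i - c p i) * b i =
     (x - \sum_i c p i * b i) - (x - \sum_i c n i * b i).
    by rewrite (eq_bigr _ (fun j _ => mulrBl _ _ _)) sumrB; ring.
  apply: le_lt_trans (av_le_sub hg _ _) _.
  rewrite [ltRHS]splitr ltrD ?(lt_trans (hc _).2) ?hN //.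
have [l hl] := choice lim.
exists l => [i|].
  apply: k_closed => e e0; have [N /(_ N (leqnn N)) hN] := hl i e e0.
  by exists (c N i); [case: (hc N)|rewrite av_distC].
apply/eqP; rewrite -subr_eq0; apply/eqP/av_small_eq0 => e e0.
pose B := \sum_i g (b i) + 1.
have B0 : 0 < B by rewrite ltr_wpDl // sumr_ge0 // => i _; exact: av_ge0.
have e20 : 0 < e / 2 by rewrite divr_gt0.
have d0 : 0 < e / 2 / B by rewrite divr_gt0.
have [N [hN hN']] : exists N, (forall i, g (c N i - l i) < e / 2 / B) /\
    N.+1%:R^-1 < e / 2.
  have [M hM] := choice (fun i => hl i _ d0); have [N hN] := inv_succ_lt e20.
  exists (maxn N (\max_i M i)); split; last by apply: hN; exact: leq_maxl.
  by move=> i; apply: hM; rewrite leq_max; apply/orP; right; exact: leq_bigmax.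
apply: le_lt_trans (av_tri hg _ (\sum_i c N i * b i) _) _.
rewrite [e]splitr ltr_leD ?(lt_trans (hc _).2) //.
rewrite -sumrB; apply: le_trans (av_le_sum hg _ _ _) _.
apply: (@le_trans _ _ (\sum_i (e / 2 / B) * g (b i))).
  apply: ler_sum => i _; rewrite -mulrBl (avM hg) ler_wpM2r ?av_ge0 //.
  exact: ltW.
rewrite -mulr_sumr -[leRHS](divfK (lt0r_neq0 B0)) ler_wpM2l ?(ltW d0) //.
by rewrite lerDl.
Qed.

(** Induction on [m]. The span of the first vectors is closed by the induction hypothesis, so the
    last vector z has a positive distance d from it. This bounds the last coordinate, and the
    induction hypothesis applied to y - c z bounds the others. *)
Lemma kfree_norm_equiv m (b : 'I_m -> F) : kfree b -> norm_equiv b.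
Proof.
elim: m => [|m IH] in b *; first by move=> _; exists 1 => // c _ [].
move=> fb; set b' := fun i => b (widen_ord (leqnSn m) i); set z := b ord_max.
pose ext (c : 'I_m -> F) (t : F) i := if unlift ord_max i is Some j then c j else t.
have extE c t : \sum_i ext c t i * b i = \sum_i c i * b' i + t * z.
  rewrite big_ord_recr /=; congr (_ + _ * _); last by rewrite /ext unlift_none.
  apply: eq_bigr => i _; congr (_ * _); rewrite /ext.
  have -> : widen_ord (leqnSn m) i = lift ord_max i.
    by apply: ord_inj; rewrite lift_max.
  by rewrite liftK.
have kext c t : (forall i, k (c i)) -> k t -> forall i, k (ext c t i).
  by move=> kc kt i; rewrite /ext; case: unlift.
have fb' : kfree b'.
  move=> c kc c0 i; have := fb (ext c 0) (kext _ _ kc k0).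
  rewrite extE c0 mul0r addr0 => /(_ erefl (lift ord_max i)).
  by rewrite /ext liftK.
have eb' := IH _ fb'; have [C C0 hC] := eb'.
have [d d0 hd] : exists2 d, 0 < d & forall y, kspan b' y -> d <= g (z - y).
  apply/not_exists2P => far.
  suff [c kc zc] : kspan b' z.
    have := fb (ext (fun i => - c i) 1) (kext _ _ (fun i => kN (kc i)) k1).
    rewrite extE mul1r zc -big_split /= big1 => [|i _]; last by rewrite mulNr addNr.
    move=> /(_ erefl ord_max); rewrite /ext unlift_none => /eqP.
    by rewrite oner_eq0.
  apply: kspan_closed eb' _ => e e0; have [//|] := far e.
  move=> /existsNP[y /not_implyP[sy /negP]]; rewrite -ltNge => hy.
  by exists y.
have z0 : 0 <= g z := av_ge0 hg z.
(* The first entry serves the last coordinate c, since d |c| <= |y|. The second serves the others,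
   since |y - c z| <= |y| (1 + |z| / d). *)
exists (Num.min d (C / (1 + g z / d))).
  by rewrite lt_min d0 divr_gt0 // ltr_wpDr // divr_ge0 // ltW.
move=> c kc; pose y := \sum_i c i * b i.
have yE : y = \sum_i c (lift ord_max i) * b' i + c ord_max * z.
  rewrite -extE; apply: eq_bigr => i _; congr (_ * _); rewrite /ext.
  by case: unliftP => [j|] ->.
have last_le : d * g (c ord_max) <= g y.
  have [c0|c0] := eqVneq (c ord_max) 0; first by rewrite c0 (av0 hg) mulr0 av_ge0.
  have -> : y = c ord_max * (z - \sum_i - (c (lift ord_max i) / c ord_max) * b' i).
    rewrite yE mulrBr addrC; congr (_ + _); rewrite mulr_sumr -sumrN.
    by apply: eq_bigr => i _; field.
  rewrite (avM hg) mulrC ler_wpM2l ?av_ge0 //; apply: hd.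
  eexists; last reflexivity; move=> i; apply: kN; apply: kM => //.
  exact: kV.
move=> i; rewrite -/y; case: (unliftP ord_max i) => [j ->|->]; last first.
  by apply: le_trans last_le; rewrite ler_wpM2r ?av_ge0 // ge_min lexx.
have := hC (fun i => c (lift ord_max i)) (fun i => kc _) j.
move=> lej; apply: (@le_trans _ _ (C / (1 + g z / d) * g (c (lift ord_max j)))).
  by rewrite ler_wpM2r ?av_ge0 // ge_min lexx orbT.
have D0 : 0 < 1 + g z / d by rewrite ltr_wpDr // divr_ge0 // ltW.
rewrite mulrAC ler_pdivrMr // (le_trans lej) //.
have -> : \sum_i c (lift ord_max i) * b' i = y - c ord_max * z by rewrite yE addrK.
apply: le_trans (av_le_sub hg _ _) _; rewrite mulrDr mulr1 lerD2l (avM hg).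
rewrite mulrCA mulrC ler_wpM2l // ler_pdivlMr // mulrC //.
Qed.

Definition extend_by m (b : 'I_m -> F) (z : F) (i : 'I_m.+1) :=
  if unlift ord_max i is Some j then b j else z.

Lemma big_extend_by m (b : 'I_m -> F) z (c : 'I_m.+1 -> F) :
  \sum_i c i * extend_by b z i =
  \sum_i c (lift ord_max i) * b i + c ord_max * z.
Proof.
rewrite big_ord_recr /= /extend_by unlift_none; congr (_ + _).
apply: eq_bigr => i _; have -> : widen_ord (leqnSn m) i = lift ord_max i.
  by apply: ord_inj; rewrite lift_max.
by rewrite liftK.
Qed.

Lemma kspan_basis d (b : 'I_d -> F) :
  exists m (e : 'I_m -> F), [/\ (m <= d)%N, kfree e & forall i, kspan e (b i)].
Proof.
elim: d b => [|d IH] b; first by exists 0%N, b; split=> // [c _ _|] [].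
have [m [e [md fe se]]] := IH (fun i => b (lift ord_max i)).
have [sz|nsz] := pselect (kspan e (b ord_max)).
  exists m, e; split=> // [|i]; first exact: leqW.
  by case: (unliftP ord_max i) => [j ->|->].
exists m.+1, (extend_by e (b ord_max)); split=> // [c kc|i].
  rewrite big_extend_by => c0.
  have cm : c ord_max = 0.
    apply/eqP/contraT => c_neq0; case: nsz.
    exists (fun i => - (c (lift ord_max i) / c ord_max)) => [i|].
      by apply: kN; apply: kM => //; exact: kV.
    apply: (mulfI c_neq0); rewrite mulr_sumr.
    have /eqP -> : c ord_max * b ord_max == - \sum_i c (lift ord_max i) * e i.
      by rewrite -addr_eq0 addrC c0.
    rewrite -sumrN.
    by apply: eq_bigr => i _; field.
  move=> i; case: (unliftP ord_max i) => [j ->|->] //.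
  apply: (fe (fun j => c (lift ord_max j))) => //.
  by rewrite -[RHS]c0 cm mul0r addr0.
case: (unliftP ord_max i) => [j ->|->].
  have [c kc ->] := se j.
  exists (extend_by c 0) => [l|]; last first.
    rewrite big_extend_by /extend_by unlift_none mul0r addr0.
    by apply: eq_bigr => l _; rewrite liftK.
  by rewrite /extend_by; case: unlift => // *; exact: k0.
exists (extend_by (fun=> 0) 1) => [l|].
  by rewrite /extend_by; case: unlift => // *; [exact: k0|exact: k1].
rewrite big_extend_by /extend_by unlift_none mul1r big1 ?add0r // => l _.
by rewrite liftK mul0r.
Qed.

End CompleteSubfield.

Section LocalDegree.
Variables (R : realType) (K : fieldExtType rat) (f : K -> R) (hf : is_absval f).

(** The statement [K_v : Q_p] = m brought down from the completion to [K]: a family uniformly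
    independent over the rationals for [f], with dense rational span. The comparisons of local
    degrees below all use such families. *)
Definition local_basis m (e : 'I_m -> K) :=
  (exists2 c : R, 0 < c & forall q : 'I_m -> rat, forall i,
     c * f (q i)%:A <= f (\sum_i q i *: e i)) /\
  (forall x d, 0 < d -> exists q : 'I_m -> rat, f (x - \sum_i q i *: e i) < d).

Variable C : completion f.
Local Notation k := (@rat_closure R K f C).
Let hC := cabs_absval C.

Lemma rat_closure_rat q : k (cemb C q%:A).
Proof. by move=> e e0; exists q; rewrite subrr (av0 hC). Qed.

Lemma rat_closure_subfield : closed_subfield (@cabs _ _ _ C) k.
Proof.
split.
- by move: (rat_closure_rat 1); rewrite scale1r rmorph1.
- move=> x y kx ky e e0; have e20 : 0 < e / 2 by rewrite divr_gt0.
  have [[q hq] [r hr]] := (kx _ e20, ky _ e20); exists (q - r).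
  rewrite scalerBl rmorphB /=; set q' := cemb C _; set r' := cemb C _.
  have -> : x - y - (q' - r') = (x - q') - (y - r') by ring.
  by rewrite [e]splitr (le_lt_trans (av_le_sub hC _ _)) // ltrD.
- move=> x y kx ky e e0.
  have A0 : 0 < cabs x + 1 by rewrite ltr_wpDl ?av_ge0.
  have B0 : 0 < cabs y + 1 by rewrite ltr_wpDl ?av_ge0.
  pose d := Num.min 1 (e / 2 / (cabs x + 1)).
  have d0 : 0 < d by rewrite lt_min ltr01 !divr_gt0.
  have [r hr] := ky _ d0.
  have [q hq] := kx _ (divr_gt0 (divr_gt0 e0 (ltr0Sn R 1)) B0).
  exists (q * r); rewrite -scalerA -[r%:A]mul1r scalerAl rmorphM /=.
  set q' := cemb C q%:A in hq *; set r' := cemb C r%:A in hr *.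
  have -> : x * y - q' * r' = x * (y - r') + (x - q') * r' by ring.
  apply: le_lt_trans (av_le_add hC _ _) _; rewrite !(avM hC) [e]splitr ltr_leD //.
    apply: (@le_lt_trans _ _ ((cabs x) * (e / 2 / (cabs x + 1)))).
      rewrite ler_wpM2l ?av_ge0 // ltW // (lt_le_trans hr) // ge_min lexx orbT //.
    rewrite mulrCA gtr_pMr ?divr_gt0 // ltr_pdivrMr // mul1r ltrDl //.
  have r'le : cabs r' <= cabs y + 1.
    have := av_ge_sub hC r' y; rewrite (av_distC hC) lerBlDl => /le_trans; apply.
    by rewrite lerD2l ltW // (lt_le_trans hr) // ge_min lexx.
  apply: le_trans (ler_wpM2l (av_ge0 hC _) r'le) _.
  by rewrite -ler_pdivlMr // ltW.
- move=> x kx; have [->|x0] := eqVneq x 0.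
    by rewrite invr0; move: (rat_closure_rat 0); rewrite scale0r rmorph0.
  move=> e e0; pose a := cabs x; have a0 : 0 < a by rewrite (av_gt0 hC).
  pose d := Num.min (a / 2) (e * (a * (a / 2))).
  have a20 : 0 < a / 2 by exact: divr_gt0.
  have d0 : 0 < d by rewrite /d lt_min a20 mulr_gt0 // mulr_gt0.
  have [q hq] := kx _ d0; exists q^-1.
  set q' := cemb C q%:A in hq *.
  have q'ge : a / 2 <= cabs q'.
    have := av_ge_sub hC x q'; have : cabs (x - q') < a / 2.
      by apply: lt_le_trans hq _; rewrite ge_min lexx.
    rewrite -/a; lra.
  have q'0 : q' != 0.
    by rewrite -(av_gt0 hC) (lt_le_trans _ q'ge) // divr_gt0.
  have -> : cemb C q^-1%:A = q'^-1.
    rewrite -[q^-1%:A]/(in_alg K q^-1) fmorphV /= fmorphV //.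
  have -> : x^-1 - q'^-1 = (q' - x) / (x * q') by field; rewrite q'0.
  rewrite (avM hC) (avV hC) (avM hC) ltr_pdivrMr ?mulr_gt0 ?(av_gt0 hC) //.
  rewrite (av_distC hC); apply: lt_le_trans hq _.
  rewrite ge_min; apply/orP; right; rewrite ler_pM2l // ler_pM2l //.
- move=> x kx e e0; have e20 : 0 < e / 2 by rewrite divr_gt0.
  have [y ky hy] := kx _ e20; have [q hq] := ky _ e20; exists q.
  by apply: le_lt_trans (av_tri hC _ y _) _; rewrite [e]splitr ltrD.
Qed.

Let hk := rat_closure_subfield.

(** A basis of [K] over the rationals spans, over the closure of the rationals, a subspace that is
    closed and contains the dense image of [K], hence the whole completion. *)
Lemma ext_degree_exists : exists m, [/\ (0 < m)%N, (m <= \dim {:K})%N &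
  ext_degree k setT m].
Proof.
pose b (i : 'I_(\dim {:K})) := cemb C (vbasis {:K})`_i.
have [m [e [md fe se]]] := kspan_basis hk b.
have spanZ q x : kspan k e x -> kspan k e (cemb C q%:A * x).
  move=> [c kc ->]; exists (fun i => cemb C q%:A * c i) => [i|].
    by apply: (kM hk) => //; exact: rat_closure_rat.
  by rewrite mulr_sumr; apply: eq_bigr => i _; rewrite mulrA.
have spanD x y : kspan k e x -> kspan k e y -> kspan k e (x + y).
  move=> [c kc ->] [c' kc' ->]; exists (fun i => c i + c' i) => [i|].
    exact: (kD hk).
  by rewrite -big_split; apply: eq_bigr => i _; rewrite mulrDl.
have span0 : kspan k e 0.
  by exists (fun=> 0) => [i|]; [exact: (k0 hk)|rewrite big1 // => i _; rewrite mul0r].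
have spanK x : kspan k e (cemb C x).
  rewrite (coord_vbasis (memvf x)) rmorph_sum /=.
  elim/big_ind: _ => [|y z|i _]; [exact: span0|exact: spanD|].
  by rewrite -mulr_algl rmorphM; exact: spanZ (se i).
have spanT x : kspan k e x.
  apply: (kspan_closed hC (@cabs_complete _ _ _ C) hk).
    exact: (kfree_norm_equiv hC (@cabs_complete _ _ _ C) hk).
  move=> d d0; have [y hy] := cemb_dense x d0; exists (cemb C y) => //.
exists m; split=> //.
  have [c _ c1] := spanT 1; rewrite lt0n; apply/negP => /eqP m0.
  have : (1 : C) == 0 
    by rewrite c1 big1 // => i _; have : (i < 0)%N by rewrite -m0.
  by rewrite oner_eq0.
exists e; split=> // x _; have [c kc ->] := spanT x.
exists [ffun i => c i]; split.
  by split=> [i|]; [rewrite ffunE|apply: eq_bigr => i _; rewrite ffunE].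
move=> c' [kc' cc']; apply/ffunP => i; rewrite ffunE; apply/eqP.
rewrite -subr_eq0; apply/eqP; move: i.
apply: (fe (fun i => c i - c' i)) => [i|]; first exact: (kB hk).
by rewrite (eq_bigr _ (fun j _ => mulrBl _ _ _)) sumrB cc' subrr.
Qed.

(** A basis [b] of the completion is replaced by a family [e] in [K] so close to it that
    independence persists. Density is obtained by successive approximation. *)
Lemma ext_degree_local_basis m :
  ext_degree k setT m -> exists e : 'I_m -> K, local_basis e.
Proof.
move=> [b [_ hb]].
have fb : kfree k b.
  move=> c kc c0; have [c1 [_ uc1]] := hb 0 I.
  have e1 : c1 = [ffun i => c i].
    apply: uc1; split=> [i|]; first by rewrite ffunE.
    by rewrite -[LHS]c0; apply: eq_bigr => i _; rewrite ffunE.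
  have e2 : c1 = [ffun i => 0].
    apply: uc1; split=> [i|]; first by rewrite ffunE; exact: (k0 hk).
    by rewrite big1 // => i _; rewrite ffunE mul0r.
  by move=> i; have /ffunP/(_ i) := etrans (esym e1) e2; rewrite !ffunE.
have [A A0 hA] := kfree_norm_equiv hC (@cabs_complete _ _ _ C) hk fb.
(* A perturbation of total size m d <= A / 4 keeps the constant [A] of norm equivalence positive; a
   quarter also leaves room for the contraction by 1/2 in [half]. *)
pose d := A / 4 / m.+1%:R; have d0 : 0 < d by rewrite !divr_gt0 ?ltr0n.
have [e he] := choice (fun i => cemb_dense (b i) d0).
have md : m%:R * d <= A / 4.
  rewrite /d mulrCA ger_pMr ?divr_gt0 // ler_pdivrMr ?ltr0n // mul1r ler_nat //.
have comb_emb (q : 'I_m -> rat) :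
    cemb C (\sum_i q i *: e i) = \sum_i cemb C (q i)%:A * cemb C (e i).
  rewrite rmorph_sum; apply: eq_bigr => i _ /=.
  by rewrite -[q i *: e i]mulr_algl rmorphM.
have comb_dist (q : 'I_m -> rat) :
    cabs (\sum_i cemb C (q i)%:A * (b i - cemb C (e i))) <= d * \sum_i f (q i)%:A.
  apply: le_trans (av_le_sum hC _ _ _) _; rewrite mulr_sumr; apply: ler_sum => i _.
  by rewrite (avM hC) cabs_ext mulrC ler_wpM2r ?av_ge0 // ltW.
exists e; split.
  exists (A / 2 / m.+1%:R) => [|q i]; first by rewrite !divr_gt0 ?ltr0n.
  set y := \sum_i _; pose T := \sum_i f (q i)%:A.
  have T_ge : f (q i)%:A <= T.
    by rewrite /T (bigD1 i) //= lerDl sumr_ge0 // => j _; exact: av_ge0.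
  have le_i j : A * f (q j)%:A <= f y + d * T.
    have := hA (fun i => cemb C (q i)%:A) (fun i => rat_closure_rat _) j.
    rewrite /= cabs_ext => /le_trans; apply.
    have -> : \sum_i cemb C (q i)%:A * b i =
        cemb C y + \sum_i cemb C (q i)%:A * (b i - cemb C (e i)).
      rewrite comb_emb -big_split; apply: eq_bigr => l _ /=.
      by rewrite mulrBr subrKC.
    apply: le_trans (av_le_add hC _ _) _.
    by rewrite cabs_ext lerD2l; exact: comb_dist.
  have : A * T <= m%:R * (f y + d * T).
    rewrite /T mulr_sumr; apply: le_trans (ler_sum _ (fun j _ => le_i j)) _.
    by rewrite sumr_const card_ord -/T mulr_natl.
  rewrite mulrDr mulrA => leT.
  have T0 : 0 <= T by apply: sumr_ge0 => j _; exact: av_ge0.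
  have leT2 : m%:R * d * T <= A / 4 * T by rewrite ler_wpM2r.
  rewrite mulrAC ler_pdivrMr ?ltr0n // (le_trans (ler_wpM2l _ T_ge)) //.
    by rewrite divr_ge0 // ltW.
  have : m%:R * f y <= f y * m.+1%:R.
    by rewrite mulrC ler_wpM2l ?av_ge0 // ler_nat.
  have := mulr_ge0 (ltW A0) T0; lra.
(* The exact coordinates of [x] in [b] are approximated by rationals within [t], and then [b] is
   replaced by [e]. Each of the two errors is about a quarter of |x|, with [B] chosen to absorb the
   terms in [t]. Iterating on the remainder gives density. *)
have half x : exists q : 'I_m -> rat, f (x - \sum_i q i *: e i) <= f x / 2.
  have [->|x0] := eqVneq x 0.
    exists (fun=> 0); rewrite big1 ?subr0 ?av0 ?mul0r // => i _.
    by rewrite scale0r.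
  have fx0 : 0 < f x by rewrite av_gt0.
  have [c [[kc xc] _]] := hb (cemb C x) I.
  pose B := \sum_i cabs (b i) + m%:R * d + 1.
  have B0 : 0 < B.
    rewrite ltr_wpDl // addr_ge0 ?sumr_ge0 // => [i _|]; first exact: av_ge0.
    by rewrite mulr_ge0 // ltW.
  pose t := f x / 4 / B; have t0 : 0 < t by rewrite !divr_gt0.
  have [q hq] := choice (fun i => kc i t t0).
  exists q; rewrite -(cabs_ext C) rmorphB /= comb_emb xc.
  have -> : \sum_i c i * b i - \sum_i cemb C (q i)%:A * cemb C (e i) =
     \sum_i (c i - cemb C (q i)%:A) * b i
       + \sum_i cemb C (q i)%:A * (b i - cemb C (e i)).
    rewrite -sumrB -big_split; apply: eq_bigr => i _ /=; ring.
  apply: le_trans (av_le_add hC _ _) _.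
  have le1 : cabs (\sum_i (c i - cemb C (q i)%:A) * b i) <= t * \sum_i cabs (b i).
    apply: le_trans (av_le_sum hC _ _ _) _; rewrite mulr_sumr; apply: ler_sum => i _.
    by rewrite (avM hC) ler_wpM2r ?av_ge0 // ltW.
  have le2 : \sum_i f (q i)%:A <= m%:R * (f x / A + t).
    rewrite -[m in m%:R]card_ord mulr_natl -sumr_const; apply: ler_sum => i _.
    have ci : cabs (c i) <= f x / A.
      by rewrite ler_pdivlMr // mulrC (le_trans (hA _ kc i)) // -xc cabs_ext.
    have := av_ge_sub hC (cemb C (q i)%:A) (c i); rewrite (av_distC hC) cabs_ext.
    have := hq i; lra.
  have le3 : d * \sum_i f (q i)%:A <= f x / 4 + m%:R * d * t.
    apply: le_trans (ler_wpM2l (ltW d0) le2) _.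
    rewrite mulrA (mulrC d) mulrDr lerD2r (le_trans (ler_wpM2r _ md)) //.
      by rewrite divr_ge0 // ltW.
    by rewrite [leLHS](_ : _ = f x / 4) //; field; rewrite gt_eqF.
  have : t * B = f x / 4 by rewrite divfK // gt_eqF.
  rewrite /B !mulrDr mulr1; have := comb_dist q; lra.
move=> x r r0.
have iter n : exists q : 'I_m -> rat, f (x - \sum_i q i *: e i) <= f x / 2 ^+ n.
  elim: n => [|n [q hq]].
    exists (fun=> 0); rewrite big1 ?subr0 ?divr1 // => i _.
    by rewrite scale0r.
  have [q' hq'] := half (x - \sum_i q i *: e i).
  exists (fun i => q i + q' i).
  rewrite (eq_bigr _ (fun i _ => scalerDl _ _ _)) big_split /= opprD addrA.
  by apply: le_trans hq' _; rewrite exprSr invfM mulrA ler_pM2r ?invr_gt0.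
have [q hq] := iter (Num.truncn (f x / r)).+1; exists q; apply: le_lt_trans hq _.
rewrite ltr_pdivrMr ?exprn_gt0 // mulrC -ltr_pdivrMr //.
apply: lt_trans (truncnS_gt _) _; rewrite -natrX ltr_nat; exact: ltn_expl.
Qed.

End LocalDegree.

(** * Weak approximation *)

Lemma lin_dep (F : fieldType) (I : finType) n (M : I -> 'I_n -> F) :
  (n < #|I|)%N -> exists q : I -> F,
    (exists i, q i != 0) /\ forall j, \sum_i q i * M i j = 0.
Proof.
move=> nI; pose A := \matrix_(a < #|I|, j < n) M (enum_val a) j.
have kA : kermx A != 0.
  rewrite kermx_eq0 -row_leq_rank -ltnNge.
  exact: leq_ltn_trans (rank_leq_col A) nI.
have /rowV0Pn[u /sub_kermxP uA /rV0Pn[b ub]] := kA.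
exists (fun i => u 0 (enum_rank i)); split.
  by exists (enum_val b); rewrite enum_valK.
move=> j; have /matrixP/(_ 0 j) := uA; rewrite !mxE => uAj.
rewrite -[RHS]uAj (reindex (fun j : 'I_#|I| => enum_val j)) /=; last by exists enum_rank => i _; rewrite ?enum_valK ?enum_rankK.
by apply: eq_bigr => c _; rewrite enum_valK mxE.
Qed.

Section Eventually.
Variable R : realType.

Definition ev (P : nat -> Prop) := exists N, forall k, (N <= k)%N -> P k.

Lemma ev_imp (P Q : nat -> Prop) : (forall k, P k -> Q k) -> ev P -> ev Q.
Proof. by move=> PQ [N hN]; exists N => k /hN/PQ. Qed.

Lemma ev_and (P Q : nat -> Prop) : ev P -> ev Q -> ev (fun k => P k /\ Q k).
Proof.
move=> [N hN] [M hM]; exists (maxn N M) => k; rewrite geq_max => /andP[Nk Mk].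
by split; [exact: hN|exact: hM].
Qed.

Lemma ev_all (T : eqType) (s : seq T) (P : T -> nat -> Prop) :
  (forall x, x \in s -> ev (P x)) -> ev (fun k => forall x, x \in s -> P x k).
Proof.
elim: s => [|x s IH] h; first by exists 0%N.
have h1 := h x (mem_head _ _).
have h2 : ev (fun k => forall y, y \in s -> P y k).
  by apply: IH => y ys; apply: h; rewrite in_cons ys orbT.
apply: ev_imp (ev_and h1 h2) => k [Px Ps] y; rewrite in_cons => /orP[/eqP ->|] //.
exact: Ps.
Qed.

Lemma ev_witness (P : nat -> Prop) : ev P -> exists k, P k.
Proof. by move=> [N hN]; exists N; exact: hN. Qed.

Lemma bernoulli (x : R) n : 0 <= x -> 1 + n%:R * x <= (1 + x) ^+ n.
Proof.
move=> x0; elim: n => [|n IH]; first by rewrite mul0r addr0.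
have h : 0 <= n%:R * x * x by rewrite !mulr_ge0.
rewrite exprS; apply: le_trans (ler_wpM2l _ IH); last by rewrite addr_ge0.
rewrite -natr1; lra.
Qed.

Lemma ev_expr_gt (a B : R) : 1 < a -> ev (fun k => B < a ^+ k).
Proof.
move=> a1; have d0 : 0 < a - 1 by rewrite subr_gt0.
exists (Num.truncn (`|B| / (a - 1))).+1 => k hk.
have := @bernoulli (a - 1) k (ltW d0); rewrite subrKC => /(lt_le_trans _); apply.
have : `|B| / (a - 1) < k%:R by apply: lt_le_trans (truncnS_gt _) _; rewrite ler_nat.
rewrite ltr_pdivrMr // => /(le_lt_trans (ler_norm B)) h.
by apply: lt_trans h _; rewrite ltrDr.
Qed.

Lemma ev_expr_lt (a e : R) : 0 <= a < 1 -> 0 < e -> ev (fun k => a ^+ k < e).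
Proof.
move=> /andP[a0 a1] e0; have [->|an0] := eqVneq a 0.
  by exists 1%N => -[|k] // _; rewrite expr0n.
have ap : 0 < a by rewrite lt0r an0.
apply: ev_imp (ev_expr_gt e^-1 (_ : 1 < a^-1)) => [k|].
  by rewrite exprVn ltf_pV2 // posrE exprn_gt0.
by rewrite invf_gt1.
Qed.

End Eventually.

Section Bump.
Variables (R : realType) (F : fieldType) (f : F -> R) (hf : is_absval f).
Variable z : F.

(* [bump k] tends to [1] where [z] is large and to [0] where [z] is small. *)
Definition bump k := z ^+ k / (1 + z ^+ k).

Lemma bump_large y e : 1 < f z -> 0 < e -> ev (fun k => f (bump k * y - y) < e).
Proof.
move=> fz e0.
apply: ev_imp (ev_expr_gt (f y / e + 1) fz) => k hk.
have le1 : f z ^+ k - 1 <= f (1 + z ^+ k).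
  have := av_ge_sub hf (z ^+ k) (- 1); rewrite (avN hf) (av1 hf) (avX hf) opprK.
  by rewrite (addrC 1).
have yk : f y / e < f (1 + z ^+ k) by apply: lt_le_trans le1; lra.
have pos : 0 < f (1 + z ^+ k).
  by apply: le_lt_trans yk; rewrite divr_ge0 ?av_ge0 // ltW.
have nz : 1 + z ^+ k != 0 by rewrite -(av_gt0 hf).
have -> : bump k * y - y = - (y / (1 + z ^+ k)) by rewrite /bump; field.
by rewrite (avN hf) (avM hf) (avV hf) ltr_pdivrMr // mulrC -ltr_pdivrMr.
Qed.

Lemma bump_small y e : f z < 1 -> 0 < e -> ev (fun k => f (bump k * y) < e).
Proof.
move=> fz e0.
have e1 : 0 < Num.min 2^-1 (e / 2 / (f y + 1)).
  by rewrite lt_min invr_gt0 // !divr_gt0 // ltr_wpDl ?av_ge0.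
have fz01 : 0 <= f z < 1 by rewrite av_ge0.
apply: ev_imp (ev_expr_lt fz01 e1) => k; rewrite lt_min => /andP[h1 h2].
have le1 : 2^-1 <= f (1 + z ^+ k).
  have := av_ge_sub hf 1 (- z ^+ k); rewrite opprK (avN hf) (av1 hf) (avX hf).
  lra.
have pos : 0 < f (1 + z ^+ k) by apply: lt_le_trans le1; rewrite invr_gt0.
rewrite !(avM hf) (avV hf) (avX hf) mulrAC ltr_pdivrMr //.
apply: (@lt_le_trans _ _ (e * 2^-1)); last by rewrite ler_pM2l.
apply: (@le_lt_trans _ _ (f z ^+ k * (f y + 1))).
  by rewrite ler_wpM2l ?lerDl // exprn_ge0 ?av_ge0.
by rewrite -ltr_pdivlMr // ltr_wpDl ?av_ge0.
Qed.

End Bump.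

(** * The absolute values of the rational numbers *)

Section RatAbs.
Variable R : realType.

Lemma powR_gt1 (x r : R) : 0 < r -> 1 < x -> 1 < x `^ r.
Proof.
move=> r0 x1; have := gt0_ltr_powR r0 _ _ x1.
by rewrite !nnegrE powR1 => -> //; rewrite ltW // (lt_trans ltr01).
Qed.

Lemma rat_abs_frac p (pp : prime p) (a b : int) : a != 0 -> b != 0 ->
  rat_abs R (PFin pp) (a%:~R / b%:~R) =
    p%:R ^ ((logn p `|b|%N)%:Z - (logn p `|a|%N)%:Z).
Proof.
move=> a0 b0; set q := _ / _.
have q0 : q != 0 by rewrite mulf_neq0 ?invr_eq0 ?intr_eq0.
have e : numq q * b = a * denq q.
  apply: (@intr_inj rat); rewrite !rmorphM /= [(numq q)%:~R]numqE.
  by rewrite /q mulrAC divfK ?intr_eq0.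
have := congr1 (fun z => logn p `|z|%N) e; rewrite !abszM !lognM ?absz_gt0 ?numq_eq0 ?denq_neq0 //.
rewrite /= (negbTE q0) => h; congr (_ ^ _); lia.
Qed.

Lemma rat_absM P : {morph rat_abs R P : x y / x * y}.
Proof.
case: P => [|p pp] x y; first by rewrite /= normrM rmorphM.
have [->|x0] := eqVneq x 0; first by rewrite mul0r /= ?eqxx mul0r.
have [->|y0] := eqVneq y 0; first by rewrite mulr0 /= ?eqxx mulr0.
rewrite -[in LHS](divq_num_den x) -[in LHS](divq_num_den y) mulf_div -!intrM.
rewrite -/(rat_abs R (PFin pp) _) rat_abs_frac ?mulf_neq0 ?numq_eq0 ?denq_neq0 //.
rewrite /= (negbTE x0) (negbTE y0) -expfzDr; last first.
  by rewrite pnatr_eq0 -lt0n prime_gt0.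
by rewrite !abszM !lognM ?absz_gt0 ?numq_eq0 ?denq_neq0 //; congr (_ ^ _); lia.
Qed.

Lemma rat_abs_nat p (pp : prime p) n : (0 < n)%N ->
  rat_abs R (PFin pp) n%:R = p%:R ^- logn p n.
Proof.
move=> n0; have := @rat_abs_frac p pp n 1; rewrite divr1 => -> //.
  by rewrite absz1 logn1 sub0r -exprnN.
by rewrite eqz_nat -lt0n.
Qed.

Lemma rat_abs_nat_le1 p (pp : prime p) n : rat_abs R (PFin pp) n%:R <= 1.
Proof.
have [->|n0] := posnP n; first by rewrite /= ?eqxx ler01.
rewrite rat_abs_nat // invf_le1 ?exprn_gt0 ?ltr0n ?prime_gt0 //.
by rewrite exprn_ege1 // ler1n prime_gt0.
Qed.

Lemma rat_abs_ge0 P q : 0 <= rat_abs R P q.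
Proof.
case: P => [|p pp] /=; first by rewrite ler0q.
by case: eqP => // _; rewrite exprz_ge0.
Qed.

Lemma rat_abs_eq0 P q : (rat_abs R P q == 0) = (q == 0).
Proof.
case: P => [|p pp] /=; first by rewrite fmorph_eq0 normr_eq0.
have [_|q0] := eqVneq q 0; rewrite ?eqxx //.
apply/negbTE; rewrite expfz_neq0 //.
by rewrite pnatr_eq0 -lt0n prime_gt0.
Qed.

Definition big_rat (P : ratplace) : rat :=
  match P with PInf => 2 | PFin p _ => p%:R^-1 end.

Lemma rat_abs_big P : 1 < rat_abs R P (big_rat P).
Proof.
case: P => [|p pp] /=; first by rewrite ger0_norm // ratr_nat ltr1n.
have p0 : p%:Z != 0 by rewrite eqz_nat -lt0n prime_gt0.
rewrite -/(rat_abs R (PFin pp) _) -[p%:R^-1]mul1r (@rat_abs_frac p pp 1 p) //.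
by rewrite absz1 logn1 subr0 logn_prime // eqxx ltr1n prime_gt1.
Qed.

Lemma rat_absV P q : rat_abs R P q^-1 = (rat_abs R P q)^-1.
Proof.
have [->|q0] := eqVneq q 0.
  by rewrite invr0; have /eqP -> := rat_abs_eq0 P 0; rewrite ?invr0.
have a0 : rat_abs R P q != 0 by rewrite rat_abs_eq0.
have a1 : rat_abs R P 1 = 1.
  have h : rat_abs R P 1 != 0 by rewrite rat_abs_eq0 oner_neq0.
  by apply: (mulfI h); rewrite -rat_absM !mulr1.
by apply: (mulfI a0); rewrite -rat_absM !mulfV.
Qed.

(** The number 2 separates the infinite place from the finite ones, and 1/p separates p from every
    other prime. *)
Lemma ratplace_eq (P P' : ratplace) (a b : R) : 0 < a -> 0 < b ->
  (forall q, rat_abs R P q `^ a = rat_abs R P' q `^ b) -> P = P'.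
Proof.
have le_pow (x r : R) : 0 < r -> 0 <= x -> x <= 1 -> x `^ r <= 1.
  move=> r0 x0 x1; have := ge0_ler_powR (ltW r0) _ _ x1.
  by rewrite !nnegrE powR1 => ->.
have inf_fin p (pp : prime p) (x y : R) : 0 < x -> 0 < y ->
    (forall q, rat_abs R PInf q `^ x = rat_abs R (PFin pp) q `^ y) -> False.
  move=> x0 y0 /(_ 2) h; have := powR_gt1 x0 (rat_abs_big PInf).
  rewrite h ltNge le_pow ?rat_abs_ge0 //; exact: rat_abs_nat_le1.
case: P P' => [|p pp] [|p' pp'] a0 b0 h //.
- by case: (inf_fin _ _ _ _ a0 b0 h).
- by case: (inf_fin _ _ _ _ b0 a0 (fun q => esym (h q))).
have [pp'e|pp'_neq] := eqVneq p p'.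
  by case: _ / pp'e in pp' h *; congr PFin; exact: bool_irrelevance.
have := powR_gt1 a0 (rat_abs_big (PFin pp)).
rewrite h /big_rat rat_absV rat_abs_nat ?prime_gt0 // logn_prime //.
by rewrite (negbTE (_ : p' != p)) 1?eq_sym // expr0 !invr1 powR1 ltxx.
Qed.


End RatAbs.

(** * Places of a number field above a given rational place *)

Section Places.
Variables (R : realType) (K : fieldExtType rat).
Local Notation d := (\dim {:K}).
Implicit Types v w : place R K.

(** [normalized_above] with the local degree made explicit and the completion replaced by a local
    basis. *)
Definition lies_over v (P : ratplace) (m : nat) :=
  (forall x : rat, v x%:A = rat_abs R P x `^ (m%:R / d%:R)) /\
  exists e : 'I_m -> K, local_basis v e.

Lemma over_exists v : exists P m, lies_over v P m.
Proof.
have [P [C [m [dm hv]]]] := absv_normalized v.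
exists P, m; split=> //.
exact: (ext_degree_local_basis (absv_absval v) dm).
Qed.

Lemma over_gt0 v P m : lies_over v P m -> (0 < m)%N.
Proof.
move=> [_ [e [_ /(_ 1 1 ltr01)[q]]]]; rewrite lt0n; apply: contraTneq => m0.
rewrite big1 ?subr0 ?(av1 (absv_absval v)) ?ltxx // => i _.
by have : (i < 0)%N by rewrite -m0.
Qed.

Lemma dim_gt0 : (0 < d)%N. Proof. exact: adim_gt0. Qed.

Lemma over_exp_gt0 v P m : lies_over v P m -> 0 < m%:R / d%:R :> R.
Proof. by move=> /over_gt0 m0; rewrite divr_gt0 // ltr0n // dim_gt0. Qed.

Lemma over_le v P m p q : lies_over v P m ->
  rat_abs R P p <= rat_abs R P q -> v p%:A <= v q%:A.
Proof.
move=> ov le_pq; case: (ov) => h _; rewrite !h.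
by apply: ge0_ler_powR; rewrite ?nnegrE ?rat_abs_ge0 // ltW // (over_exp_gt0 ov).
Qed.

Lemma av_scale (f : K -> R) (hf : is_absval f) (q : rat) x :
  f (q *: x) = f q%:A * f x.
Proof. by rewrite -(avM hf) mulr_algl. Qed.

(** If m > n, approximate each [e i] by a rational combination of the n vectors [e']; these m
    combinations satisfy a rational relation. The same relation applied to [e] is small compared
    with its largest coefficient, against uniform independence. *)
Lemma local_dim_le (f g : K -> R) (hf : is_absval f) (hg : is_absval g) r m n
    (e : 'I_m -> K) (e' : 'I_n -> K) :
  0 < r -> (forall x, f x = g x `^ r) -> local_basis f e -> local_basis g e' ->
  (m <= n)%N.
Proof.
move=> r0 fg [[c c0 ind] _] [_ dense]; rewrite leqNgt; apply/negP => nm.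
have m0 : (0 < m)%N := leq_ltn_trans (leq0n n) nm.
pose t := c / 2 / m%:R; have t0 : 0 < t by rewrite !divr_gt0 ?ltr0n.
have apx i : exists q : 'I_n -> rat, f (e i - \sum_j q j *: e' j) <= t.
  have [q hq] := dense (e i) (t `^ r^-1) (powR_gt0 _ t0); exists q.
  have -> : t = (t `^ r^-1) `^ r.
    by rewrite -powRrM mulVf ?powRr1 ?(ltW t0) // gt_eqF.
  by rewrite fg; apply: (ge0_ler_powR (ltW r0)); rewrite ?nnegrE ?(av_ge0 hg) ?powR_ge0 // ltW.
have [q hq] := choice apx.
have [|a [[i0 ai0] ha]] := @lin_dep _ 'I_m n q; first by rewrite card_ord.
have comb : \sum_i a i *: e i = \sum_i a i *: (e i - \sum_j q i j *: e' j).
  rewrite -[LHS]subr0 (eq_bigr _ (fun i _ => scalerBr _ _ _)) sumrB.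
  congr (_ - _); apply/esym; under eq_bigr do rewrite scaler_sumr.
  rewrite exchange_big big1 // => j _.
  under eq_bigr do rewrite scalerA.
  by rewrite -scaler_suml ha scale0r.
have [i1 _ i1max] := @arg_maxP _ _ _ i0 xpredT (fun i => f (a i)%:A) isT.
have ai1 : 0 < f (a i1)%:A.
  apply: lt_le_trans (i1max i0 isT).
  by rewrite av_gt0 // scaler_eq0 oner_eq0 orbF.
have := ind a i1; rewrite comb leNgt => /negP; apply.
apply: (@le_lt_trans _ _ (\sum_(i < m) f (a i1)%:A * t)).
  apply: le_trans (av_le_sum hf _ _ _) _; apply: ler_sum => i _.
  by rewrite (av_scale hf) ler_pM ?(av_ge0 hf) //; exact: i1max.
rewrite sumr_const card_ord -mulr_natr -mulrA /t divfK ?pnatr_eq0 -?lt0n //.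
rewrite mulrC ltr_pM2r // ltr_pdivrMr //; lra.
Qed.

Lemma place_eq v w : (forall x, v x = w x) -> v = w.
Proof.
case: v w => [f hf nf] [g hg ng] /= /funext fg; case: _ / fg in hg ng *.
by congr Place; exact: Prop_irrelevance.
Qed.

Lemma over_inj v P m P' m' : lies_over v P m -> lies_over v P' m' -> P = P' /\ m = m'.
Proof.
move=> ov ov'; have [h _] := ov; have [h' _] := ov'.
have PP' : P = P'.
  apply: (ratplace_eq (over_exp_gt0 ov) (over_exp_gt0 ov')) => q.
  by rewrite -h h'.
split=> //; case: _ / PP' in ov' h'.
have := congr1 (@ln R) (etrans (esym (h (big_rat P))) (h' (big_rat P))).
rewrite !ln_powR => /mulIf; rewrite gt_eqF ?ln_gt0 ?rat_abs_big // => /(_ isT).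
move=> /mulIf; rewrite invr_eq0 pnatr_eq0 -lt0n dim_gt0 => /(_ isT) /eqP.
by rewrite eqr_nat => /eqP.
Qed.

Lemma over_big v P m : lies_over v P m -> 1 < v (big_rat P)%:A.
Proof.
move=> ov; case: (ov) => -> _.
exact: powR_gt1 (over_exp_gt0 ov) (rat_abs_big R P).
Qed.

Lemma avXz (f : K -> R) (hf : is_absval f) x (l : int) : f (x ^ l) = f x ^ l.
Proof.
by case: l => l; [exact: avX|rewrite NegzE -!exprnN (avV hf) (avX hf)].
Qed.

(** The functions ln(v x) / s and ln(w x) / r agree on the rationals. If they agreed on all of [K],
    then v and w would be powers of each other, their local degrees would be equal by
    [local_dim_le], and v = w. An [x] where they differ is corrected by a power of the rational
    number [t]. *)
Lemma places_separated v w P m n : lies_over v P m -> lies_over w P n -> v != w ->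
  exists z, v z < 1 < w z.
Proof.
move=> ov ow vw; have [hv hw] := (absv_absval v, absv_absval w).
pose s := m%:R / d%:R : R; pose r := n%:R / d%:R : R.
have s0 : 0 < s := over_exp_gt0 ov; have r0 : 0 < r := over_exp_gt0 ow.
have [x [x0 hx]] : exists x, x != 0 /\ ln (v x) / s != ln (w x) / r.
  apply: contra_notP (elimN eqP vw) => /forallNP same; apply: place_eq.
  have same' x : x != 0 -> ln (v x) / s = ln (w x) / r.
    by move=> x0; apply/eqP/contraT => h; case: (same x).
  have vwr : forall x, v x = w x `^ (s / r).
    move=> x; have [->|x0] := eqVneq x 0.
      by rewrite !av0 // powR0 // mulf_neq0 ?invr_eq0 ?gt_eqF.
    apply: ln_inj; rewrite ?posrE ?powR_gt0 ?av_gt0 //.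
    by rewrite ln_powR -mulrAC -mulrA -same' // mulrC divfK ?gt_eqF.
  have wvr : forall x, w x = v x `^ (r / s).
    move=> x; rewrite vwr -powRrM.
    have -> : s / r * (r / s) = 1 by field; rewrite !gt_eqF.
    by rewrite powRr1 ?av_ge0.
  have mn : m = n.
    case: (ov) => _ [e he]; case: (ow) => _ [e' he'].
    apply/eqP; rewrite eqn_leq (local_dim_le hv hw (divr_gt0 s0 r0) vwr he he') /=.
    by rewrite (local_dim_le hw hv (divr_gt0 r0 s0) wvr he' he).
  have sr : s = r by rewrite /s mn.
  by move=> x; rewrite vwr sr divff ?powRr1 ?av_ge0 // gt_eqF.
wlog lt_x : x x0 hx / ln (v x) / s < ln (w x) / r => [hwlog|].
  have [lt|lt|e] := ltgtP (ln (v x) / s) (ln (w x) / r).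
  - exact: hwlog lt.
  - have lnVx (u : place R K) : ln (u x^-1) = - ln (u x).
      have hu := absv_absval u.
      by rewrite (avV hu) lnV ?posrE ?(av_gt0 hu).
    apply: (hwlog x^-1); rewrite ?invr_eq0 // !lnVx !mulNr ?eqr_opp //.
    by rewrite ltrN2.
  - by rewrite e eqxx in hx.
set a := ln (v x) / s in lt_x; set b := ln (w x) / r in lt_x.
pose t := (big_rat P)%:A : K; pose T := ln (rat_abs R P (big_rat P)).
have T0 : 0 < T by rewrite ln_gt0 // rat_abs_big.
have vt : ln (v t) = s * T by case: ov => -> _; rewrite ln_powR.
have wt : ln (w t) = r * T by case: ow => -> _; rewrite ln_powR.
(* The interval from k a to k b is longer than [T], so a multiple - l T lies strictly inside it;
   then z = x^k t^l is small at v and large at w. *)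
pose k := (Num.truncn (T / (b - a))).+1.
have hk : T < k%:R * (b - a).
  by rewrite -ltr_pdivrMr ?subr_gt0 // truncnS_gt.
pose l := Num.ceil (- (k%:R * a) / T) - 1.
have l1 : k%:R * a + l%:~R * T < 0.
  have := gt_pred_ceil (- (k%:R * a) / T); rewrite -/l ltr_pdivlMr //; lra.
have l2 : 0 < k%:R * b + l%:~R * T.
  have := ceil_ge (- (k%:R * a) / T); rewrite ler_pdivrMr // /l rmorphB /= mulrBl.
  lra.
have t0 : t != 0 by rewrite -(av_gt0 hv) (lt_trans ltr01 (over_big ov)).
pose z := x ^+ k * t ^ l.
have z0 : z != 0 by rewrite mulf_neq0 ?expf_neq0 ?expfz_neq0.
have lnz (u : place R K) (c q : R) : ln (u x) = q * c -> ln (u t) = q * T -> 0 < q ->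
    ln (u z) = q * (k%:R * c + l%:~R * T).
  move=> ux ut q0; have hu := absv_absval u.
  have uxp : 0 < u x by rewrite av_gt0.
  have utp : 0 < u t by rewrite av_gt0.
  rewrite (avM hu) (avX hu) (avXz hu) lnM ?posrE ?exprn_gt0 ?exprz_gt0 //.
  rewrite lnXn // -powR_intmul ?ltW // ln_powR ux ut -mulr_natl; ring.
exists z; rewrite -(ltr_ln) ?posrE ?av_gt0 // ln1 -[1 < w z](ltr_ln) ?posrE ?av_gt0 // ln1.
rewrite (lnz v a s) ?(lnz w b r) ?vt ?wt //; last 2 first.
- by rewrite /b mulrC divfK // gt_eqF.
- by rewrite /a mulrC divfK // gt_eqF.
by rewrite pmulr_rlt0 // pmulr_rgt0 // l1.
Qed.

(** Induction on [s], starting from a rational number large at [P]. Let z be suitable for [s], and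
    let y be large at v and small at the new place w. According as |z|_w is less than, greater than
    or equal to 1, the elements z, [bump z k * y] and z^k y are suitable for large k. *)
Lemma place_large v (s : seq (place R K)) P m : lies_over v P m ->
  (forall w, w \in s -> w != v /\ exists n, lies_over w P n) ->
  exists z, 1 < v z /\ forall w, w \in s -> w z < 1.
Proof.
move=> ov; have hv := absv_absval v; elim: s => [|w s IH] hs.
  by exists (big_rat P)%:A; split=> //; exact: over_big ov.
have [z [vz sz]] : exists z, 1 < v z /\ forall u, u \in s -> u z < 1.
  by apply: IH => u us; apply: hs; rewrite in_cons us orbT.
have [wv [n ow]] := hs w (mem_head _ _); have hw := absv_absval w.
have [y /andP[wy vy]] := places_separated ow ov wv.
have [wz|wz|wz] := ltgtP (w z) 1.
- exists z; split=> // u; rewrite in_cons => /orP[/eqP -> //|]; exact: sz.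
- have e1 := bump_large hv y vz (_ : 0 < v y - 1).
  have e2 := bump_large hw y wz (_ : 0 < 1 - w y).
  have e3 := @ev_all _ s (fun u k => u (bump z k * y) < 1)
    (fun u us => bump_small (absv_absval u) y (sz u us) ltr01).
  have [||k [h1 [h2 h3]]] := ev_witness (ev_and (e1 _) (ev_and (e2 _) e3)).
    by rewrite subr_gt0.
  by rewrite subr_gt0.
  exists (bump z k * y); split.
    have := av_ge_sub hv y (bump z k * y); rewrite (av_distC hv); lra.
  move=> u; rewrite in_cons => /orP[/eqP -> |]; last exact: h3.
  by have := av_ge_sub hw (bump z k * y) y; lra.
have e3 : ev (fun k => forall u, u \in s -> u (z ^+ k * y) < 1).
  apply: ev_all => u us; have hu := absv_absval u.
  have d0 : 0 < (u y + 1)^-1 by rewrite invr_gt0 ltr_wpDl ?av_ge0.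
  have uz : 0 <= u z < 1 by rewrite av_ge0 // sz.
  apply: ev_imp (ev_expr_lt uz d0) => k.
  rewrite (avM hu) (avX hu) -(ltr_pM2r (_ : 0 < u y + 1)) ?ltr_wpDl ?av_ge0 //.
  rewrite mulVf ?gt_eqF ?ltr_wpDl ?av_ge0 //; apply: le_lt_trans.
  by rewrite ler_wpM2l ?lerDl // exprn_ge0 ?av_ge0.
have [k h3] := ev_witness e3.
exists (z ^+ k * y); split.
  rewrite (avM hv) (avX hv); apply: lt_le_trans vy _.
  by rewrite ler_peMl ?av_ge0 // exprn_ege1 // ltW.
move=> u; rewrite in_cons => /orP[/eqP -> |]; last exact: h3.
by rewrite (avM hw) (avX hw) wz expr1n mul1r.
Qed.

Lemma weak_approx v (s : seq (place R K)) P m x e : 0 < e -> lies_over v P m ->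
  (forall w, w \in s -> w != v /\ exists n, lies_over w P n) ->
  exists y, v (y - x) < e /\ forall w, w \in s -> w y < e.
Proof.
move=> e0 ov hs; have [z [vz sz]] := place_large ov hs.
have e1 := bump_large (absv_absval v) x vz e0.
have e2 := @ev_all _ s (fun u k => u (bump z k * x) < e)
    (fun u us => bump_small (absv_absval u) x (sz u us) e0).
have [k [h1 h2]] := ev_witness (ev_and e1 e2).
by exists (bump z k * x).
Qed.

(** Weak approximation moves each member of each local basis to an element of [K] close to it at its
    own place and close to 0 at the others. With more than d such elements there is a rational
    relation. At the place to which its largest coefficient belongs, the relation makes a
    combination of the local basis too small. *)
Lemma sum_local_degrees_le r (v : 'I_r -> place R K) (m : 'I_r -> nat) P :
  injective v -> (forall i, lies_over (v i) P (m i)) -> (\sum_i m i <= d)%N.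
Proof.
move=> v_inj ov; rewrite leqNgt; apply/negP => lt_d.
have hv i := absv_absval (v i).
have [e he] : {e : forall i, 'I_(m i) -> K & forall i, local_basis (v i) (e i)}.
  pose ex i := cid (ov i).2.
  by exists (fun i => projT1 (ex i)) => i; exact: projT2 (ex i).
have /choice[c hc] : forall i, exists c : R, 0 < c /\
    forall (q : 'I_(m i) -> rat) j, c * v i (q j)%:A <= v i (\sum_j q j *: e i j).
  by move=> i; have [[c c0 h] _] := he i; exists c.
pose t := \big[Num.min/1]_i (c i / (d.+1 * (\sum_i m i).+1)%:R).
have t0 : 0 < t.
  apply: (big_ind (fun x => 0 < x)) => // [x y x0 y0|i _]; first by rewrite lt_min x0.
  by rewrite divr_gt0 ?(hc i).1 // ltr0n.
pose I := {i : 'I_r & 'I_(m i)}.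
have cardI : #|{: I}| = (\sum_i m i)%N.
  by rewrite card_tagged sumnE big_map enumT; apply: eq_bigr => i _; rewrite card_ord.
have apx (a : I) : exists y, v (tag a) (y - e _ (tagged a)) < t /\
    forall j, j != tag a -> v j y < t.
  pose s := [seq v j | j <- enum 'I_r & j != tag a].
  have [w|y [y1 y2]] := weak_approx (e (tag a) (tagged a)) t0 (ov (tag a)) (s := s).
    move=> /mapP[j]; rewrite mem_filter => /andP[ja _] ->.
    by rewrite (inj_eq v_inj) ja; split=> //; exists (m j).
  exists y; split=> // j ja; apply: y2.
  by apply/mapP; exists j => //; rewrite mem_filter ja mem_enum.
have [y hy] := choice apx.
have [|q [[a0 qa0] hq]] :=
    @lin_dep _ {: I} d (fun a b => coord (vbasis {:K}) b (y a)).
  by rewrite cardI.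
have dep : \sum_a q a *: y a = 0.
  rewrite (eq_bigr _ (fun a _ => congr1 (fun z => q a *: z) (coord_vbasis (memvf (y a))))).
  under eq_bigr do rewrite scaler_sumr.
  rewrite exchange_big big1 // => b _; under eq_bigr do rewrite scalerA.
  by rewrite -scaler_suml hq scale0r.
(* Coefficients are compared at [P], so the order is the same at every place considered, in
   particular at the place of [a1]. *)
have [a1 _ a1max] := @arg_maxP _ _ _ a0 xpredT (fun a => rat_abs R P (q a)) isT.
set i := tag a1 in a1max.
have qa1 : 0 < v i (q a1)%:A.
  rewrite (av_gt0 (hv i)) scaler_eq0 oner_eq0 orbF -(rat_abs_eq0 R P) gt_eqF //.
  apply: lt_le_trans (a1max a0 isT).
  by rewrite lt0r rat_abs_ge0 rat_abs_eq0 qa0.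
have le_q a : v i (q a)%:A <= v i (q a1)%:A.
  by apply: over_le (ov i) _; exact: a1max.
have := (hc i).2 (fun j => q (Tagged _ j)) (tagged a1).
have Ta1 : Tagged (fun i => 'I_(m i)) (tagged a1) = a1 by case: (a1).
rewrite /= Ta1.
rewrite leNgt => /negP; apply.
pose z (a : I) := q a *: (y a - if tag a == i then e _ (tagged a) else 0).
have -> : \sum_j q (Tagged (fun i => 'I_(m i)) j) *: e i j = - \sum_a z a.
  rewrite /z (eq_bigr _ (fun a _ => scalerBr _ _ _)) sumrB dep sub0r opprK.
  rewrite (eq_bigr (fun a : I => if tag a == i then q a *: e _ (tagged a) else 0)); last first.
    by move=> a _; case: ifP => // _; rewrite scaler0.
  rewrite -big_mkcond /=.
  rewrite (reindex_onto (fun j : 'I_(m i) => Tagged (fun i => 'I_(m i)) j)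
     (fun a => tagged_as (Tagged (fun i => 'I_(m i)) (tagged a1)) a)) /=; last first.
    by move=> [a b] /= /eqP ai; case: _ / (esym ai) in b *; rewrite tagged_asE.
  apply: eq_bigl => j; rewrite eqxx /=; apply/esym/eqP.
  by rewrite tagged_asE.
rewrite (avN (hv i)).
apply: (@le_lt_trans _ _ (\sum_(a : I) v i (q a1)%:A * t)).
  apply: le_trans (av_le_sum (hv i) _ _ _) _; apply: ler_sum => a _.
  rewrite /z (av_scale (hv i)) ler_pM ?(av_ge0 (hv i)) //.
  case: eqP => [<-|/eqP ai]; first by case: (hy a) => /ltW.
  by rewrite subr0; apply/ltW/(hy a).2; rewrite eq_sym.
rewrite sumr_const cardI -mulr_natr -mulrA mulrC ltr_pM2r //.
have ti : t <= c i / (d.+1 * (\sum_i m i).+1)%:R.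
  by rewrite /t (bigD1 i) //= ge_min lexx.
have ci := (hc i).1.
apply: (@le_lt_trans _ _ (c i / (d.+1 * (\sum_i m i).+1)%:R * (\sum_i m i)%:R)).
  by rewrite ler_wpM2r.
rewrite mulrAC ltr_pdivrMr ?ltr0n // ltr_pM2l // ltr_nat.
by rewrite mulSn ltnS leq_addr.
Qed.

End Places.

(** * Extension of the p-adic absolute value *)

Section ChevalleyExtension.
Variables (R : realType) (p : nat) (pp : prime p).
Local Notation L := algC.
Local Notation P := (p%:R : L).

Let P0 : P != 0. Proof. by rewrite pnatr_eq0 -lt0n prime_gt0. Qed.

(** A subring maximal with this property turns out to be a valuation ring with p in its maximal
    ideal, and it defines the extended absolute value. *)
Definition subring_avoiding (B : set L) := [/\ B 1,
  forall x y, B x -> B y -> B (x - y),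
  forall x y, B x -> B y -> B (x * y) &
  ~ B P^-1].

Lemma subring_avoiding_maximal : exists B : set L, subring_avoiding B /\
  forall B', subring_avoiding B' -> B `<=` B' -> B' `<=` B.
Proof.
(* The guard [B !=set0] admits the empty set, which is the union of the empty chain. The maximal set
   is nonempty all the same, because the integers form an admissible set. *)
have [F Fch totF|B [hB maxB]] := @Zorn_bigcup L (fun B => B !=set0 -> subring_avoiding B).
  move=> [x0 [X0 FX0 X0x0]].
  have sub X x : F X -> X x -> subring_avoiding X by move=> FX Xx; apply: Fch => //; exists x.
  have two x y : (\bigcup_(X in F) X) x -> (\bigcup_(X in F) X) y ->
      exists X, [/\ F X, X x & X y].
    move=> [X FX Xx] [Y FY Yy]; have [XY|YX] := totF _ _ FX FY.
      by exists Y; split=> //; exact: XY.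
    by exists X; split=> //; exact: YX.
  split.
  - by exists X0 => //; case: (sub _ _ FX0 X0x0).
  - move=> x y ux /(two _ _ ux)[X [FX Xx Xy]]; exists X => //.
    by case: (sub _ _ FX Xx) => _ h _ _; exact: h.
  - move=> x y ux /(two _ _ ux)[X [FX Xx Xy]]; exists X => //.
    by case: (sub _ _ FX Xx) => _ _ h _; exact: h.
  - by move=> [X FX XP]; case: (sub _ _ FX XP).
pose Z : set L := [set x | exists n : int, x = n%:~R].
have goodZ : subring_avoiding Z.
  split.
  - by exists 1.
  - by move=> _ _ [m ->] [n ->]; exists (m - n); rewrite rmorphB.
  - by move=> _ _ [m ->] [n ->]; exists (m * n); rewrite rmorphM.
  move=> [n en]; have : (n * p)%:~R == 1%:~R :> L by rewrite rmorphM /= -en mulVf.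
  rewrite eqr_int => /eqP np1; have : (p %| 1)%N.
    by have <- : (`|n| * p)%N = 1%N by [have := congr1 absz np1; rewrite abszM]; exact: dvdn_mull.
  by rewrite dvdn1 => /eqP p1; move: pp; rewrite p1.
have B0 : B !=set0.
  apply/set0P/negP => /eqP B0.
  apply: (maxB Z) => [|_]; last exact: goodZ.
  rewrite B0; split=> // /(_ 1); apply; exists 1 => //.
exists B; split=> [|B' hB' BB']; first exact: hB.
apply: contrapT => nB'B; apply: (maxB B') => //; by split.
Qed.

Section MaximalSubring.
Variables (B : set L) (hB : subring_avoiding B).
Hypothesis B_max : forall B', subring_avoiding B' -> B `<=` B' -> B' `<=` B.

Let B1 : B 1. Proof. by case: hB. Qed.
Let BB x y : B x -> B y -> B (x - y). Proof. by case: hB => _ h _ _; exact: h. Qed.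
Let BM x y : B x -> B y -> B (x * y). Proof. by case: hB => _ _ h _; exact: h. Qed.
Let BP : ~ B P^-1. Proof. by case: hB. Qed.
Let B0 : B 0. Proof. by rewrite -(subrr 1); exact: BB. Qed.
Let BN x : B x -> B (- x). Proof. by rewrite -sub0r; exact: BB. Qed.
Let BD x y : B x -> B y -> B (x + y).
Proof. by move=> Bx /BN By; rewrite -[y]opprK; exact: BB. Qed.
Let BX x n : B x -> B (x ^+ n).
Proof. by move=> Bx; elim: n => [|n IH]; rewrite ?expr0 // exprS; exact: BM. Qed.
Let Bsum (I : Type) (r : seq I) (F : I -> L) :
  (forall i, B (F i)) -> B (\sum_(i <- r) F i).
Proof. by move=> h; elim/big_ind: _ => // x y; exact: BD. Qed.
Let Bnat n : B n%:R.
Proof. by elim: n => [|n IH]; rewrite -?natr1 //; exact: BD. Qed.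

Definition over_subring (q : {poly L}) := forall i, B q`_i.

Lemma adjoin_meets x : ~ B x -> exists q : {poly L}, over_subring q /\ q.[x] = P^-1.
Proof.
move=> nBx; apply: contrapT => none; apply: nBx.
pose B' : set L := [set y | exists q : {poly L}, over_subring q /\ q.[x] = y].
have BB' : B `<=` B'.
  move=> b Bb; exists b%:P; split; last by rewrite hornerC.
  by move=> i; rewrite coefC; case: ifP.
apply: (B_max _ BB'); last first.
  exists 'X; rewrite hornerX; split=> // i; rewrite coefX; exact: Bnat.
split.
- exact: BB'.
- move=> _ _ [q [hq <-]] [r [hr <-]]; exists (q - r).
  by rewrite hornerD hornerN; split=> // i; rewrite coefB; exact: BB.
- move=> _ _ [q [hq <-]] [r [hr <-]]; exists (q * r).
  by rewrite hornerM; split=> // i; rewrite coefM; apply: Bsum => j; exact: BM.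
- by move=> [q hq]; apply: none; exists q.
Qed.

(* [p] lies in the Jacobson radical of [B] *)
Lemma one_sub_pV b : B b -> B (1 - P * b)^-1.
Proof.
move=> Bb; set u := 1 - _; apply: contrapT => /adjoin_meets[q [hq quP]].
have Bu : B u by apply: BB => //; apply: BM => //; exact: Bnat.
have [u0|u0] := eqVneq u 0.
  by apply: BP; rewrite -quP u0 invr0 horner_coef0.
have ub' n : exists2 b', B b' & u ^+ n = 1 - P * b'.
  elim: n => [|n [b' Bb' IH]]; first by exists 0; rewrite // mulr0 subr0.
  exists (b' + b - P * (b * b')); last by rewrite exprS IH /u; ring.
  by apply: BB; [exact: BD|apply: BM; [exact: Bnat|exact: BM]].
apply: BP; have [b'' Bb'' ub''] := ub' (size q).
(* The powers of u are 1 modulo p B, which makes b'' an element of [B]; and u^n clears the powers of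
   u^-1 in the expression q(u^-1) of 1/p. *)
have -> : P^-1 = u ^+ size q / P + b''.
  by rewrite ub''; field.
apply: BD => //; rewrite -quP horner_coef mulr_sumr; apply: Bsum => i.
have -> : u ^+ size q * (q`_i * u^-1 ^+ i) = q`_i * u ^+ (size q - i).
  have -> : u ^+ size q = u ^+ (size q - i) * u ^+ i by rewrite -exprD subnK // ltnW.
  by rewrite exprVn; field; rewrite expf_neq0.
by apply: BM => //; exact: BX.
Qed.

(** The relation in x^-1, multiplied by x^n, expresses x^n through lower powers of x because 1 - p
    r_0 is a unit of [B]. Substituting this for the leading power shortens [q]. *)
Lemma adjoin_reduce x (q r : {poly L}) : x != 0 ->
  over_subring q -> q.[x] = P^-1 -> over_subring r -> r.[x^-1] = P^-1 ->
  (size r <= size q)%N ->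
  exists q', [/\ over_subring q', q'.[x] = P^-1 & (size q' < size q)%N].
Proof.
move=> x0 hq qx hr rx rq.
have q_gt0 : (0 < size q)%N.
  rewrite lt0n size_poly_eq0; apply: contra_eq_neq qx => ->.
  by rewrite horner0 eq_sym invr_eq0.
pose n := (size q).-1; have qn : size q = n.+1 by rewrite prednK.
pose w := (1 - P * r`_0)^-1; have Bw : B w by exact: one_sub_pV.
have w0 : 1 - P * r`_0 != 0.
  apply: contra_notN BP => /eqP w0; have <- : r`_0 = P^-1; last exact: hr.
  apply: (mulfI P0); rewrite mulfV //; apply/eqP.
  by rewrite eq_sym -subr_eq0 w0.
(* With these coefficients, 1 is the sum of b_j x^-j over j >= 1. *)
pose b j := w * P * r`_j.
have Bb j : B (b j) by rewrite /b; do 2![apply: BM => //]; exact: Bnat.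
exists (\poly_(i < n) (q`_i + q`_n * b (n - i)%N)); split.
- by move=> i; rewrite coef_poly; case: ifP => // _; apply: BD => //; exact: BM.
- rewrite horner_poly (eq_bigr _ (fun i _ => mulrDl _ _ _)) big_split /=.
  rewrite -qx horner_coef qn big_ord_recr /=; congr (_ + _).
  under eq_bigr do rewrite -mulrA.
  rewrite -mulr_sumr; congr (_ * _).
  rewrite (reindex_inj rev_ord_inj) /=.
  have -> : \sum_(i < n) b (n - (n - i.+1))%N * x ^+ (n - i.+1) =
     x ^+ n * (w * P * \sum_(i < n) r`_i.+1 * x^-1 ^+ i.+1).
    rewrite !mulr_sumr; apply: eq_bigr => i _.
    have -> : x ^+ n = x ^+ (n - i.+1) * x ^+ i.+1 by rewrite -exprD subnK.
    by rewrite subKn // /b exprVn; field; rewrite expf_neq0.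
  have <- : P^-1 - r`_0 = \sum_(i < n) r`_i.+1 * x^-1 ^+ i.+1.
    rewrite -rx (horner_coef_wide _ rq) qn big_ord_recl expr0 mulr1 addrC addKr.
    by [].
  by rewrite /w; field; rewrite w0 P0.
- by rewrite qn ltnS size_poly.
Qed.

(** Otherwise 1/p is a polynomial over [B] both in x and in x^-1. Of the two polynomials of minimal
    size, [adjoin_reduce] shortens the one that is not smaller. *)
Lemma maximal_valuation x : x != 0 -> B x \/ B x^-1.
Proof.
move=> x0; have [Bx|nBx] := pselect (B x); first by left.
have [Bx'|nBx'] := pselect (B x^-1); [by right|exfalso].
have minimal y : ~ B y -> exists q : {poly L}, [/\ over_subring q, q.[y] = P^-1 &
    forall q', over_subring q' -> q'.[y] = P^-1 -> (size q <= size q')%N].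
  move=> /adjoin_meets[q [hq qy]].
  have ex : exists n, `[< exists q : {poly L}, [/\ over_subring q, q.[y] = P^-1 & size q = n] >].
    by exists (size q); apply/asboolP; exists q.
  case: (ex_minnP ex) => m /asboolP[q1 [hq1 q1y q1m]] minm.
  exists q1; split=> // q' hq' q'y; rewrite q1m; apply: minm.
  by apply/asboolP; exists q'.
have [[q [hq qx minq]] [r [hr rx minr]]] := (minimal _ nBx, minimal _ nBx').
have [rq|/ltnW qr] := leqP (size r) (size q).
  have [q' [hq' q'x]] := adjoin_reduce x0 hq qx hr rx rq.
  by rewrite ltnNge minq.
have := @adjoin_reduce x^-1 r q.
rewrite invr_eq0 invrK => /(_ x0 hr rx hq qx qr)[r' [hr' r'x]].
by rewrite ltnNge minr.
Qed.

Definition vunit x := [/\ x != 0, B x & B x^-1].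

Lemma vunitM x y : vunit x -> vunit y -> vunit (x * y).
Proof.
move=> [x0 Bx Bx'] [y0 By By']; split; first by rewrite mulf_neq0.
  exact: BM.
by rewrite invfM; exact: BM.
Qed.

Lemma vunitV x : vunit x -> vunit x^-1.
Proof. by move=> [x0 Bx Bx']; split; rewrite ?invr_eq0 ?invrK. Qed.

Lemma vunit1 : vunit 1.
Proof. by split; rewrite ?invr1 ?oner_neq0. Qed.

Lemma vunitXn x n : vunit x -> vunit (x ^+ n).
Proof.
by move=> ux; elim: n => [|n IH]; [rewrite expr0; exact: vunit1|rewrite exprS; exact: vunitM].
Qed.

Lemma vunit_pX (e : int) : vunit (P ^ e) -> e = 0.
Proof.
have key n : ~ B (P ^+ n.+1)^-1.
  move=> h; apply: BP; have -> : P^-1 = P ^+ n * (P ^+ n.+1)^-1.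
    by rewrite exprS; field; rewrite P0 expf_neq0.
  by apply: BM => //; apply: BX; exact: Bnat.
by case: e => [[|n]|n] [_ h1 h2] //; case: (key n).
Qed.

Lemma vunitN x : vunit x -> vunit (- x).
Proof.
by move=> [x0 Bx Bx']; split; rewrite ?oppr_eq0 ?invrN //; exact: BN.
Qed.

Lemma vunit_rat (a : rat) : a != 0 -> exists2 e : int, vunit (ratr a / P ^ e) &
  rat_abs R (PFin pp) a = p%:R ^ (- e).
Proof.
move=> a0.
have unit_nat n : (0 < n)%N -> vunit (n%:R / P ^+ logn p n).
  move=> n0; have [m m_p en] := pfactor_coprime pp n0.
  set k := logn p n in en *.
  have m0 : (0 < m)%N by move: n0; rewrite en muln_gt0 => /andP[].
  have -> : n%:R / P ^+ k = m%:R :> L.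
    by rewrite en natrM natrX mulfK // expf_neq0.
  split; [by rewrite pnatr_eq0 -lt0n|exact: Bnat|].
  (* Bezout: u m = 1 + p v inverts an integer prime to p inside [B], as 1 + p v is a unit there. *)
  have [[u v] uv] : exists uv : nat * nat, (uv.1 * m = uv.2 * p + 1)%N.
    by have [u v e _] := egcdnP p m0; exists (u, v); rewrite /= e (eqP (_ : coprime _ _)) // coprime_sym.
  have -> : m%:R^-1 = u%:R * (1 - P * - v%:R)^-1 :> L.
    have e : (u%:R * m%:R : L) = 1 - P * - v%:R.
      by rewrite -natrM uv natrD natrM; ring.
    have m0' : m%:R != 0 :> L by rewrite pnatr_eq0 -lt0n.
    have u0 : u%:R != 0 :> L.
      rewrite pnatr_eq0; apply: contra_eq_neq uv => ->.
      by rewrite mul0n addn1.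
    by rewrite -e; field; rewrite m0' u0.
  apply: BM; first exact: Bnat.
  by apply: one_sub_pV; apply: BN; exact: Bnat.
have unit_int (z : int) : z != 0 -> vunit (z%:~R / P ^+ logn p `|z|).
  move=> z0; have h := unit_nat `|z|%N (_ : (0 < `|z|)%N).
  have {h}[|n1 n2 n3] := h _; first by rewrite absz_gt0.
  have u : vunit (`|z|%:R / P ^+ logn p `|z|) by [].
  have [zE|zE] : z = `|z|%N \/ z = - (`|z|%N : int) by lia.
    by have -> : z%:~R = `|z|%:R :> L by rewrite [in LHS]zE.
  have -> : z%:~R = - `|z|%:R :> L by rewrite [in LHS]zE rmorphN.
  by rewrite mulNr; exact: vunitN.
exists ((logn p `|numq a|)%:Z - (logn p `|denq a|)%:Z).
  have := vunitM (unit_int (numq a) _) (vunitV (unit_int (denq a) _)).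
  rewrite numq_eq0 a0 denq_neq0 => /(_ isT isT).
  rewrite -[in ratr a](divq_num_den a) rmorphM fmorphV /= !ratr_int.
  rewrite expfzDr // -exprnN -!exprnP.
  suff -> : forall x y z t : L, x / z / (y / t) = x / y / (z / t) by [].
  by move=> x y z t; rewrite !invfM !invrK; ring.
by rewrite /= (negbTE a0) opprB.
Qed.

Lemma maximal_le (x y : L) : x != 0 -> y != 0 -> B (x / y) \/ B (y / x).
Proof.
move=> x0 y0; have [|h|h] := maximal_valuation (_ : x / y != 0).
- by rewrite mulf_neq0 ?invr_eq0.
- by left.
- by right; rewrite -invf_div.
Qed.

Lemma dominating_exists (s : seq L) : (exists2 y, y \in s & y != 0) ->
  exists z, [/\ z \in s, z != 0 & forall y, y \in s -> B (y / z)].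
Proof.
elim: s => [[y]|t s IH ex]; first by rewrite in_nil.
have [/IH[z [zs z0 hz]]|nex] := pselect (exists2 y, y \in s & y != 0); last first.
  have s0 y : y \in s -> y = 0.
    by move=> ys; apply/eqP/contraT => y0; case: nex; exists y.
  have t0 : t != 0.
    case: ex => y; rewrite in_cons => /orP[/eqP -> //|/s0 ->].
    by rewrite eqxx.
  exists t; split=> //; first exact: mem_head.
  move=> y; rewrite in_cons => /orP[/eqP ->|/s0 ->]; first by rewrite divff.
  by rewrite mul0r.
have [t0|t0] := eqVneq t 0.
  exists z; split=> //; first by rewrite in_cons zs orbT.
  by move=> y; rewrite in_cons => /orP[/eqP ->|/hz //]; rewrite t0 mul0r.
have [h|h] := maximal_le t0 z0.
  exists z; split=> //; first by rewrite in_cons zs orbT.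
  by move=> y; rewrite in_cons => /orP[/eqP ->|/hz //].
exists t; split=> //; first exact: mem_head.
move=> y; rewrite in_cons => /orP[/eqP ->|/hz yz]; first by rewrite divff.
have -> : y / t = (y / z) * (z / t) by field; rewrite ?t0 ?z0.
exact: BM.
Qed.

Lemma nonunitD a b : B a /\ ~ vunit a -> B b /\ ~ vunit b -> B (a + b) /\ ~ vunit (a + b).
Proof.
move=> [Ba na] [Bb nb]; split=> [|uab]; first exact: BD.
have [a0|a0] := eqVneq a 0; first by apply: nb; rewrite a0 add0r in uab.
have [b0|b0] := eqVneq b 0; first by apply: na; rewrite b0 addr0 in uab.
have key (c d : L) : d != 0 -> B d -> B (c / d) -> vunit (c + d) -> vunit d.
  move=> d0 Bd Bcd [cd0 _ Bcd']; split=> //.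
  have -> : d^-1 = (c / d + 1) * (c + d)^-1 by field; rewrite ?d0 ?cd0.
  by apply: BM => //; exact: BD.
have [h|h] := maximal_le a0 b0; first by apply: nb; apply: key h uab.
by apply: na; apply: key h _ => //; rewrite addrC.
Qed.

(** Some power of x is a power of p times a unit, so the valuation has rank one. Indeed, in the
    equation of x over the rationals two terms of largest size must agree up to a unit, and the
    quotient of their coefficients is a power of p times a unit. *)
Lemma vunit_power (x : L) : x != 0 -> exists kl : nat * int,
  (0 < kl.1)%N /\ vunit (x ^+ kl.1 / P ^ kl.2).
Proof.
move=> x0; have [q [qx q_monic _]] := minCpolyP x.
have := root_minCpoly x; rewrite qx rootE horner_coef size_map_poly => /eqP qx0.
pose T (i : 'I_(size q)) : L := (map_poly ratr q)`_i * x ^+ i.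
have q0 : q != 0 by rewrite monic_neq0.
have sq : ((size q).-1 < size q)%N by rewrite prednK // lt0n size_poly_eq0.
have T_eq0 i : (T i == 0) = (q`_i == 0).
  by rewrite mulf_eq0 expf_eq0 (negbTE x0) andbF orbF coef_map fmorph_eq0.
have [|z [/mapP[i0 _ zE] z0 hz]] := dominating_exists (s := [seq T i | i <- enum 'I_(size q)]).
  exists (T (Ordinal sq)); first by rewrite map_f ?mem_enum.
  by rewrite T_eq0 /= -lead_coefE (monicP q_monic) oner_eq0.
have BT i : B (T i / T i0) by rewrite -zE; apply: hz; rewrite map_f ?mem_enum.
(* If all other terms were strictly smaller than the dominating one, their quotients by it would be
   nonunits with sum -1, but nonunits are stable under addition. *)
rewrite zE in z0; have [j [ji0 uj]] : exists j, j != i0 /\ vunit (T j / T i0).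
  apply: contrapT => none.
  have : (\sum_(i | i != i0) T i / T i0) = -1.
    apply/eqP; rewrite -addr_eq0 -[X in _ + X](divff z0) addrC.
    have <- : (\sum_i T i) / T i0 = T i0 / T i0 + \sum_(i | i != i0) T i / T i0.
      by rewrite mulr_suml (bigD1 i0).
    by rewrite [\sum_i _]qx0 mul0r.
  move=> e; have : B (-1) /\ ~ vunit (-1).
    rewrite -e; apply: (big_ind (fun y => B y /\ ~ vunit y)) => [|a b|i ii0]; last 1 first.
    - by split=> // uj; apply: none; exists i.
    - by split=> // -[]; rewrite eqxx.
    exact: nonunitD.
  by case=> _; apply; split; rewrite ?invrN ?invr1 ?oppr_eq0 ?oner_eq0 //; exact: BN.
have qi0 : q`_i0 != 0 by rewrite -T_eq0.
have qj : q`_j != 0 by rewrite -T_eq0; apply: contraNneq (_ : T j / T i0 != 0) => [->|]; [rewrite mul0r|case: uj].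
have [[e ue _] [e' ue' _]] := (vunit_rat qi0, vunit_rat qj).
have Pe (t : int) : P ^ t != 0 by rewrite expfz_neq0.
have {}uj : vunit ((x ^+ j / x ^+ i0) / P ^ (e - e')).
  have -> : (x ^+ j / x ^+ i0) / P ^ (e - e') =
      T j / T i0 * (ratr q`_i0 / P ^ e) * (ratr q`_j / P ^ e')^-1.
    rewrite /T !coef_map /= expfzDr // -invr_expz.
    by field; rewrite !Pe !fmorph_eq0 qi0 qj !expf_neq0.
  by apply: vunitM; [exact: vunitM|exact: vunitV].
have [ij|ij|/val_inj ij] := ltngtP i0 j; last by rewrite ij eqxx in ji0.
  exists ((j - i0)%N, e - e'); rewrite subn_gt0; split=> //=.
  by rewrite expfB_cond // (negbTE x0) /= ltnW.
exists ((i0 - j)%N, e' - e); rewrite subn_gt0; split=> //=.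
have := vunitV uj; rewrite invf_div; congr vunit.
rewrite expfB_cond ?(negbTE x0) ?(ltnW ij) //.
have -> : P ^ (e' - e) = (P ^ (e - e'))^-1 by rewrite invr_expz opprB.
by field; rewrite Pe !expf_neq0.
Qed.

Local Notation Q := (p%:R : R).
Let Q1 : 1 < Q. Proof. by rewrite ltr1n prime_gt1. Qed.

(** If x^k is p^l times a unit, the value is forced to be p^(-l/k); by [padic_absE] it does not
    depend on the choice of k and l. *)
Definition padic_abs (x : L) : R :=
  if pselect (x != 0) is left x0
  then let kl := sval (cid (vunit_power x0)) in Q `^ (- (kl.2%:~R / kl.1%:R))
  else 0.

Lemma padic_abs0 : padic_abs 0 = 0.
Proof. by rewrite /padic_abs; case: pselect => // h; case: (negP h). Qed.

Let PXz (l : int) (k : nat) : P ^ (l * k) = (P ^ l) ^+ k.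
Proof. by rewrite exprnP exprz_exp. Qed.

Lemma padic_absE x k (l : int) : (0 < k)%N -> vunit (x ^+ k / P ^ l) ->
  padic_abs x = Q `^ (- (l%:~R / k%:R)).
Proof.
move=> k0 ux; rewrite /padic_abs; case: pselect => [x0|]; last first.
  by move=> /negP; rewrite negbK => /eqP x0; move: ux; rewrite x0 expr0n gtn_eqF // mul0r => -[]; rewrite eqxx.
case: cid => -[k' l'] /= [k'0 ux']; congr (_ `^ (- _)).
have Pe (t : int) : P ^ t != 0 by rewrite expfz_neq0.
have : vunit (P ^ (l * k' - l' * k)).
  have -> : P ^ (l * k' - l' * k) =
     (x ^+ k' / P ^ l') ^+ k * ((x ^+ k / P ^ l) ^+ k')^-1.
    rewrite expfzDr // -invr_expz !PXz !expr_div_n -!exprM (mulnC k').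
    by field; rewrite !expf_neq0.
  by apply: vunitM; [|apply: vunitV]; exact: vunitXn.
move=> /vunit_pX /eqP; rewrite subr_eq0 => /eqP e.
have k0' : k%:R != 0 :> R by rewrite pnatr_eq0 -lt0n.
have k'0' : k'%:R != 0 :> R by rewrite pnatr_eq0 -lt0n.
apply/eqP; rewrite eqr_div //; apply/eqP.
by have := congr1 (fun z : int => z%:~R : R) e; rewrite !rmorphM.
Qed.

Lemma padic_abs_le1 x : padic_abs x <= 1 <-> B x.
Proof.
have [->|x0] := eqVneq x 0; first by rewrite padic_abs0 ler01.
have [[k l] [/= k0 ux]] := vunit_power x0; rewrite (padic_absE k0 ux).
have kR : 0 < k%:R :> R by rewrite ltr0n.
have eq_x : x ^+ k = x ^+ k / P ^ l * P ^ l by rewrite divfK // expfz_neq0.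
have le1 : (Q `^ (- (l%:~R / k%:R)) <= 1) = (0 <= l).
  have [l0|l0] := leP 0 l.
    rewrite powRN invf_le1 ?powR_gt0 ?(lt_trans ltr01) // -[X in X <= _](powRr0 Q).
    by rewrite ler_powR ?ler1n ?prime_gt0 // divr_ge0 ?ler0z.
  apply/negbTE; rewrite -ltNge powR_gt1 // oppr_gt0 pmulr_llt0 ?invr_gt0 //.
  by rewrite ltrz0.
rewrite le1; split=> [l0|Bx].
  have Bxk : B (x ^+ k).
    rewrite eq_x; apply: BM; first by case: ux.
    by case: l l0 {ux eq_x le1} => // l _; apply: BX; exact: Bnat.
  have [//|Bx'] := maximal_valuation x0.
  (* If x^-1 lies in [B], this identity puts x in [B] as well. *)
  have -> : x = x ^+ k * x^-1 ^+ k.-1.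
    by rewrite -(prednK k0) exprS -mulrA -exprMn divff // expr1n mulr1.
  by apply: BM => //; exact: BX.
rewrite leNgt; apply/negP => l0.
have {l0} [n ln] : exists n, l = - (n.+1 : int) by case: l l0 {ux eq_x le1} => // n _; exists n; rewrite NegzE.
case: ux => _ _; rewrite invf_div => h; apply: BP.
have -> : P^-1 = P ^+ n * (P ^ l / x ^+ k) * x ^+ k.
  rewrite ln -exprnN exprS; field.
  by rewrite !expf_neq0.
by apply: BM; [apply: BM => //; apply: BX; exact: Bnat|exact: BX].
Qed.

Lemma padic_absM : {morph padic_abs : x y / x * y}.
Proof.
move=> x y; have [->|x0] := eqVneq x 0; first by rewrite mul0r padic_abs0 mul0r.
have [->|y0] := eqVneq y 0; first by rewrite mulr0 padic_abs0 mulr0.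
have [[k l] [/= k0 ux]] := vunit_power x0.
have [[k' l'] [/= k'0 uy]] := vunit_power y0.
rewrite (padic_absE k0 ux) (padic_absE k'0 uy).
have u : vunit ((x * y) ^+ (k * k') / P ^ (l * k' + l' * k)).
  have Pe (t : int) : P ^ t != 0 by rewrite expfz_neq0.
  have -> : (x * y) ^+ (k * k') / P ^ (l * k' + l' * k) =
     (x ^+ k / P ^ l) ^+ k' * (y ^+ k' / P ^ l') ^+ k.
    rewrite expfzDr // !PXz !expr_div_n exprMn -!exprM (mulnC k').
    by field; rewrite !expf_neq0.
  by apply: vunitM; exact: vunitXn.
have kk : (0 < k * k')%N by rewrite muln_gt0 k0.
rewrite (padic_absE kk u) -powRD; last first.
  by rewrite pnatr_eq0 -lt0n prime_gt0 // implybT.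
congr (_ `^ _); rewrite natrM intrD !intrM -!pmulrn; field.
by rewrite !pnatr_eq0 -!lt0n k0 k'0.
Qed.

Lemma padic_abs_eq0 x : (padic_abs x == 0) = (x == 0).
Proof.
have [->|x0] := eqVneq x 0; first by rewrite padic_abs0 eqxx.
have [[k l] [/= k0 ux]] := vunit_power x0.
by rewrite (padic_absE k0 ux) gt_eqF // powR_gt0 // (lt_trans ltr01).
Qed.

Lemma padic_absval : is_absval padic_abs.
Proof.
have ge0 x : 0 <= padic_abs x.
  by rewrite /padic_abs; case: pselect => // x0; exact: powR_ge0.
split=> [||| x y]; [exact: ge0|exact: padic_abs_eq0|exact: padic_absM|].
have key u v : v != 0 -> padic_abs u <= padic_abs v ->
    padic_abs (u + v) <= padic_abs v.
  move=> v0 uv; rewrite -(divfK v0 (u + v)) padic_absM ler_piMl //.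
  apply/padic_abs_le1; rewrite mulrDl divff //; apply: BD => //.
  apply/padic_abs_le1; have vp : 0 < padic_abs v by rewrite lt0r padic_abs_eq0 v0 ge0.
  by rewrite -(ler_pM2r vp) -padic_absM divfK // mul1r.
have [->|y0] := eqVneq y 0; first by rewrite addr0 padic_abs0 addr0.
have [->|x0] := eqVneq x 0; first by rewrite add0r padic_abs0 add0r.
have [xy|/ltW yx] := leP (padic_abs x) (padic_abs y).
  by apply: le_trans (key _ _ y0 xy) _; rewrite lerDr.
by rewrite (addrC x); apply: le_trans (key _ _ x0 yx) _; rewrite lerDl.
Qed.

Lemma padic_abs_rat (a : rat) : padic_abs (ratr a) = rat_abs R (PFin pp) a.
Proof.
have [->|a0] := eqVneq a 0; first by rewrite rmorph0 padic_abs0 /= ?eqxx.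
have [e ue ->] := vunit_rat a0.
rewrite (@padic_absE _ 1 e) // divr1 -rmorphN powR_intmul //.
Qed.

End MaximalSubring.

Lemma padic_abs_exists : exists w : L -> R, is_absval w /\
  forall a : rat, w (ratr a) = rat_abs R (PFin pp) a.
Proof.
have [B [hB maxB]] := subring_avoiding_maximal.
by exists (padic_abs hB maxB); split=> [|a]; [exact: padic_absval|exact: padic_abs_rat].
Qed.

End ChevalleyExtension.

(** From here on finite and infinite [P] are treated alike in the study of the places above [P]. *)
Lemma closed_absval_exists (R : realType) (P : ratplace) :
  exists (Om : numClosedFieldType) (w : Om -> R), is_absval w /\
    forall a : rat, w (ratr a) = rat_abs R P a.
Proof.
case: P => [|p pp]; last first.
  by have [w hw] := padic_abs_exists R pp; exists algC, w.
exists R[i], (fun z => complex.Re `|z|); split=> [|a]; last first.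
  by rewrite -ratr_norm -(fmorph_rat (real_complex R)).
have reE (z : R[i]) : real_complex R (complex.Re `|z|) = `|z|.
  by rewrite RRe_real // normr_real.
split=> [x|x|x y|x y].
- by have := normr_ge0 x; rewrite -reE lecR.
- by rewrite -(inj_eq (@complexI R)) reE normr_eq0.
- by apply: (@complexI R); rewrite rmorphM !reE normrM.
- by rewrite -lecR rmorphD !reE ler_normD.
Qed.

(** * Embeddings and places *)

Section Embeddings.
Variables (K : fieldExtType rat) (Om : numClosedFieldType).
Local Notation d := (\dim {:K}).

Lemma primitive_element : exists z : K, <<1; z>>%VS = fullv.
Proof.
have pchar0 : [pchar K] =i pred0 by move=> p; rewrite pchar_lalg pchar_num.
have gen (s : seq K) : exists z, forall x, x \in s -> x \in <<1; z>>%VS.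
  elim: s => [|y s [z hz]]; first by exists 0.
  have [t ht] := Primitive_Element_Theorem y (pcharf0_separable 1%AS pchar0 z).
  exists t => x; rewrite in_cons => /orP[/eqP ->|/hz xz]; rewrite -ht.
    exact: memv_adjoin.
  exact: subvP_adjoin.
have [z hz] := gen (vbasis {:K}); exists z; apply/eqP.
rewrite eqEsubv subvf /= -[X in (X <= _)%VS](span_basis (vbasisP fullv)).
apply/span_subvP => x.
exact: hz.
Qed.

Definition field_norm (x : K) : rat :=
  \det (\matrix_(k < d, l < d) coord (vbasis {:K}) l (x * (vbasis {:K})`_k)).

(** Each root of the minimal polynomial of a primitive element gives an embedding; the roots are
    distinct by separability, which also yields linear independence. *)
Lemma embeddings_exist : exists sigma : 'I_d -> {rmorphism K -> Om},
  forall a : 'I_d -> Om, (forall x, \sum_i a i * sigma i x = 0) -> forall i, a i = 0.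
Proof.
have [z hz] := primitive_element.
have pchar0 : [pchar K] =i pred0 by move=> p; rewrite pchar_lalg pchar_num.
have /polyOver1P[q mq] := minPolyOver 1%AS z.
have sz_q : size q = d.+1.
  have := size_minPoly 1%AS z; rewrite mq size_map_poly adjoin_degreeE.
  by rewrite dimv1 divn1 hz.
have sep_q : separable_poly q.
  have := pcharf0_separable 1%AS pchar0 z.
  by rewrite /separable_element mq separable_map.
have q0 : q != 0 by rewrite -size_poly_eq0 sz_q.
pose qO : {poly Om} := map_poly ratr q.
have [s sE] := closed_field_poly_normal qO.
have lc0 : lead_coef qO != 0 by rewrite lead_coef_eq0 map_poly_eq0.
have s_uniq : uniq s.
  rewrite -separable_prod_XsubC -(eqp_separable (p := qO)) ?separable_map //.
  by rewrite sE eqp_scale.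
have sz_s : size s = d.
  by apply/eqP; rewrite -eqSS -sz_q -(size_map_poly (ratr : rat -> Om)) -/qO sE
    size_scale // size_prod_XsubC.
have ev_ex x : exists g : {poly rat}, (map_poly (in_alg K) g).[z] = x.
  have /Fadjoin_polyP[g /polyOver1P[h ->] ->] : x \in <<1; z>>%VS.
    by rewrite hz memvf.
  by exists h.
pose root_ev (r : Om) (x : K) : Om := (map_poly ratr (sval (cid (ev_ex x)))).[r].
have root_evE r g x : root qO r -> (map_poly (in_alg K) g).[z] = x ->
    root_ev r x = (map_poly ratr g).[r].
  move=> qr gx; rewrite /root_ev; case: cid => h /= hx.
  apply/eqP; rewrite -subr_eq0 -hornerN -hornerD -rmorphB /=.
  have : minPoly 1%AS z %| map_poly (in_alg K) (h - g).
    apply: minPoly_dvdp; last by rewrite rootE rmorphB hornerD hornerN hx gx subrr.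
    by apply/polyOver1P; exists (h - g).
  rewrite mq dvdp_map => qhg; rewrite -rootE; apply: root_dvdp qr.
  by rewrite /qO dvdp_map.
have root_s r : r \in s -> root qO r.
  by move=> rs; rewrite sE rootZ // root_prod_XsubC.
have sub r : r \in s -> zmod_morphism (root_ev r).
  move=> /root_s qr x y; have [[g gx] [h hy]] := (ev_ex x, ev_ex y).
  rewrite (root_evE r g x) // (root_evE r h y) // (root_evE r (g - h)) //.
    by rewrite rmorphB hornerD hornerN.
  by rewrite rmorphB hornerD hornerN gx hy.
have mul r : r \in s -> monoid_morphism (root_ev r).
  move=> /root_s qr; split=> [|x y].
    rewrite (root_evE r 1) ?rmorph1 ?hornerC //.
  have [[g gx] [h hy]] := (ev_ex x, ev_ex y).
  rewrite (root_evE r g x) // (root_evE r h y) // (root_evE r (g * h)) //.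
    by rewrite rmorphM hornerM.
  by rewrite rmorphM hornerM gx hy.
have nth_s (i : 'I_d) : s`_i \in s by rewrite mem_nth // sz_s.
have morph r : r \in s -> {f : {rmorphism K -> Om} | forall x, f x = root_ev r x}.
  move=> rs.
  pose m1 := GRing.isZmodMorphism.Build K Om (root_ev r) (sub r rs).
  pose m2 := GRing.isMonoidMorphism.Build K Om (root_ev r) (mul r rs).
  by exists (HB.pack (root_ev r) m1 m2 : {rmorphism K -> Om}).
exists (fun i => sval (morph _ (nth_s i))) => a ha i.
have {}ha (g : {poly rat}) : \sum_j a j * (map_poly ratr g).[s`_j] = 0.
  rewrite -[RHS](ha (map_poly (in_alg K) g).[z]); apply: eq_bigr => j _.
  by rewrite (svalP (morph _ (nth_s j))) (root_evE _ g) // root_s.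
have pow k : \sum_j a j * s`_j ^+ k = 0.
  rewrite -[RHS](ha 'X^k); apply: eq_bigr => j _.
  by rewrite map_polyXn hornerXn.
have poly (g : {poly Om}) : \sum_j a j * g.[s`_j] = 0.
  under eq_bigr do rewrite horner_coef mulr_sumr.
  rewrite exchange_big big1 // => k _ /=.
  by under eq_bigr do rewrite mulrCA; rewrite -mulr_sumr pow mulr0.
(* The relation extends from powers to all polynomials over [Om]; this one vanishes at every root
   but the i-th and isolates [a i]. *)
pose L := \prod_(j < d | j != i) ('X - (s`_j)%:P).
have := poly L; rewrite (bigD1 i) //= big1 ?addr0; last first.
  move=> j ji; rewrite /L horner_prod (bigD1 j) //= hornerXsubC subrr.
  by rewrite mul0r mulr0.
move/eqP; rewrite mulf_eq0 => /orP[/eqP //|].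
rewrite horner_prod prodf_seq_eq0 => /hasP[j _ /andP[ji]].
rewrite hornerXsubC subr_eq0 nth_uniq ?sz_s //.
by move=> /eqP/val_inj ij; rewrite ij eqxx in ji.
Qed.

(** The matrix E of the conjugates of a basis, invertible by independence, conjugates multiplication
    by x into the diagonal matrix of the [sigma i x]. *)
Lemma norm_embeddings (sigma : 'I_d -> {rmorphism K -> Om}) :
  (forall a : 'I_d -> Om, (forall x, \sum_i a i * sigma i x = 0) ->
     forall i, a i = 0) ->
  forall x, ratr (field_norm x) = \prod_i sigma i x.
Proof.
move=> indep x; pose b := vbasis {:K}.
pose E : 'M[Om]_d := \matrix_(i, k) sigma i b`_k.
have detE : \det E != 0.
  apply/negP => /det0P[v v0 vE]; case/negP: v0; apply/eqP/rowP => i.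
  rewrite mxE; apply: (indep (fun i => v 0 i)) => y.
  rewrite (eq_bigr (fun j => \sum_k v 0 j * sigma j (coord b k y *: b`_k))); last first.
    by move=> j _; rewrite -mulr_sumr -rmorph_sum -coord_vbasis ?memvf.
  rewrite exchange_big big1 // => k _ /=.
  under eq_bigr do rewrite rmorphZ_num mulrCA.
  have /matrixP/(_ 0 k) := vE; rewrite !mxE => vEk.
  rewrite -mulr_sumr -[RHS](mulr0 (ratr (coord b k y))) -[in RHS]vEk.
  by congr (_ * _); apply: eq_bigr => j _; rewrite mxE.
pose M : 'M[rat]_d := \matrix_(k, l) coord b l (x * b`_k).
have : diag_mx (\row_i sigma i x) *m E = E *m (map_mx ratr M)^T.
  apply/matrixP => i k; rewrite mul_diag_mx !mxE -rmorphM.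
  rewrite [in LHS](coord_vbasis (memvf (x * b`_k))) rmorph_sum.
  by apply: eq_bigr => l _; rewrite !mxE rmorphZ_num mulrC.
move=> /(congr1 determinant); rewrite !det_mulmx det_diag det_tr mulrC.
move=> /(mulfI detE); rewrite det_map_mx => <-.
by apply: eq_bigr => i _; rewrite mxE.
Qed.

Lemma field_norm_eq0 x : (field_norm x == 0) = (x == 0).
Proof.
have [sigma indep] := embeddings_exist.
rewrite -(fmorph_eq0 (ratr : {rmorphism rat -> Om})) /= (norm_embeddings indep).
apply/prodf_eq0/eqP => [[i _]|->].
  by rewrite fmorph_eq0 => /eqP.
by exists (Ordinal (adim_gt0 {:K}%AS)) => //; rewrite rmorph0.
Qed.

End Embeddings.

Section PlacesOver.
Variables (R : realType) (K : fieldExtType rat).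
Local Notation d := (\dim {:K}).

(** The exponent s depends on the local degree, which in turn is measured in a completion. There is
    no circle: a completion of [f], with its absolute value raised to the power s, is a completion
    of f^s with the same closure of the rationals. *)
Lemma place_of_absval (f : K -> R) P : is_absval f ->
  (forall q : rat, f q%:A = rat_abs R P q) ->
  exists (v : place R K) m, lies_over v P m /\ forall x, v x = f x `^ (m%:R / d%:R).
Proof.
move=> hf fq; have [C0] := completion_exists hf.
have [m [m0 md dm]] := ext_degree_exists C0.
pose s := m%:R / d%:R : R.
have d0 : 0 < d%:R :> R by rewrite ltr0n dim_gt0.
have s0 : 0 < s by rewrite divr_gt0 // ltr0n.
have hs : 0 < s <= 1 by rewrite s0 ler_pdivrMr // mul1r ler_nat md.
have hC := cabs_absval C0.
pose g x := f x `^ s; have hg : is_absval g := absval_powR hf hs.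
have small (t e : R) : 0 <= t -> 0 < e -> t < e `^ s^-1 -> t `^ s < e.
  move=> t0 e0 te; have -> : e = (e `^ s^-1) `^ s.
    by rewrite -powRrM mulVf ?gt_eqF // powRr1 // ltW.
  by apply: gt0_ltr_powR; rewrite // ?nnegrE ?powR_ge0.
have small' (t e : R) : 0 <= t -> 0 < e -> t `^ s < e `^ s -> t < e.
  move=> t0 e0; rewrite !ltNge; apply: contraNN => et.
  by apply: (ge0_ler_powR (ltW s0)); rewrite ?nnegrE // ltW.
have e_pow (e : R) : 0 < e -> 0 < e `^ s^-1 by move=> e0; rewrite powR_gt0.
have dense : forall x (e : R), 0 < e -> exists y, cabs (x - cemb C0 y) `^ s < e.
  move=> x e e0; have [y hy] := cemb_dense x (e_pow e e0); exists y.
  by apply: small => //; exact: av_ge0.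
have complete : forall u : nat -> C0,
    (forall e : R, 0 < e -> exists N, forall i j,
       (N <= i)%N -> (N <= j)%N -> cabs (u i - u j) `^ s < e) ->
    exists l, forall e : R, 0 < e -> exists N, forall i,
       (N <= i)%N -> cabs (u i - l) `^ s < e.
  move=> u cu; have [e e0|l hl] := cabs_complete (c := C0) (u := u).
    have [N hN] := cu (e `^ s) (powR_gt0 _ e0); exists N => i j Ni Nj.
    by apply: small' (hN i j Ni Nj) => //; exact: av_ge0.
  exists l => e e0; have [N hN] := hl _ (e_pow e e0); exists N => i Ni.
  by apply: small (hN i Ni) => //; exact: av_ge0.
have ext x : cabs (cemb C0 x) `^ s = g x by rewrite cabs_ext.
pose C := @Completion R K g C0 (fun x => cabs x `^ s) (cemb C0)
  (absval_powR hC hs) ext dense complete.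
have closE : @rat_closure R K g C = @rat_closure R K f C0.
  apply/seteqP; split=> x hx e e0.
    have [q hq] := hx (e `^ s) (powR_gt0 _ e0); exists q.
    by apply: small' hq => //; exact: av_ge0.
  have [q hq] := hx _ (e_pow e e0); exists q.
  by apply: small hq => //; exact: av_ge0.
have dmC : ext_degree (@rat_closure R K g C) setT m by rewrite closE.
have gq q : g q%:A = rat_abs R P q `^ (m%:R / d%:R) by rewrite /g fq.
have nv : exists P, normalized_above g P by exists P, C, m.
exists (Place hg nv), m; split=> //; split=> //=.
exact: (ext_degree_local_basis hg dmC).
Qed.

Lemma nth_place_inj (V : seq (place R K)) v0 : uniq V ->
  injective (fun j : 'I_(size V) => nth v0 V j).
Proof. by move=> uV i j /eqP; rewrite nth_uniq // => /eqP/val_inj. Qed.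

Lemma sum_local_degrees_seq (V : seq (place R K)) P (m : place R K -> nat) :
  uniq V -> (forall v, v \in V -> lies_over v P (m v)) ->
  (\sum_(v <- V) m v <= d)%N.
Proof.
case: V => [|v0 V] uV ov; first by rewrite big_nil.
rewrite (big_nth v0) big_mkord.
apply: (sum_local_degrees_le (nth_place_inj (v0 := v0) uV)) => i.
by apply: ov; exact: mem_nth.
Qed.

(* The left-hand side counts the embeddings inducing [v], the right-hand side
   is the local degree: more embeddings than that would satisfy a linear
   relation on a set dense in [K]. *)
Lemma card_embeddings_le (Om : numClosedFieldType) (w : Om -> R)
    (sigma : 'I_d -> {rmorphism K -> Om}) v P m (A : {set 'I_d}) :
  is_absval w ->
  (forall a : 'I_d -> Om, (forall x, \sum_i a i * sigma i x = 0) ->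
     forall i, a i = 0) ->
  lies_over v P m ->
  (forall i, i \in A -> forall x, v x = w (sigma i x) `^ (m%:R / d%:R)) ->
  (#|A| <= m)%N.
Proof.
move=> hw indep ov hA; rewrite leqNgt; apply/negP => mA.
have [_ [e [_ dense]]] := ov; have s0 := over_exp_gt0 ov.
set s := m%:R / d%:R in s0 hA; have hv := absv_absval v.
have [|a [[i0 ai0] ha]] := @lin_dep _ 'I_#|A| m (fun i j => sigma (enum_val i) (e j)).
  by rewrite card_ord.
pose b (i : 'I_d) := \sum_(l < #|A| | enum_val l == i) a l.
have bE x : \sum_i b i * sigma i x = \sum_l a l * sigma (enum_val l) x.
  under eq_bigr do rewrite mulr_suml.
  rewrite (exchange_big_dep xpredT) //=; apply: eq_bigr => l _.
  by rewrite (big_pred1 (enum_val l)) // => i; rewrite eq_sym.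
have b0 : forall x, \sum_i b i * sigma i x = 0.
  move=> x; rewrite bE; apply: (av_small_eq0 hw) => t t0.
  pose B := \sum_l w (a l) + 1.
  have B0 : 0 < B by rewrite ltr_wpDl // sumr_ge0 // => l _; exact: av_ge0.
  have [q hq] := dense x ((t / B) `^ s) (powR_gt0 _ (divr_gt0 t0 B0)).
  set y := x - _ in hq.
  have -> : \sum_l a l * sigma (enum_val l) x = \sum_l a l * sigma (enum_val l) y.
    rewrite /y; under [RHS]eq_bigr do rewrite rmorphB mulrBr.
    rewrite sumrB -[LHS]subr0; congr (_ - _); apply/esym.
    under eq_bigr do rewrite rmorph_sum mulr_sumr.
    rewrite exchange_big big1 // => j _ /=.
    under eq_bigr do rewrite rmorphZ_num mulrCA.
    by rewrite -mulr_sumr ha mulr0.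
  have small (l : 'I_#|A|) : w (sigma (enum_val l) y) <= t / B.
    rewrite leNgt; apply/negP => h.
    have := hq; rewrite (hA _ (enum_valP l)) ltNge => /negP; apply.
    by apply: (ge0_ler_powR (ltW s0)); rewrite ?nnegrE ?(av_ge0 hw) ?divr_ge0 ?ltW.
  apply: le_lt_trans (av_le_sum hw _ _ _) _.
  apply: (@le_lt_trans _ _ (\sum_l w (a l) * (t / B))).
    by apply: ler_sum => l _; rewrite (avM hw) ler_wpM2l ?(av_ge0 hw).
  by rewrite -mulr_suml mulrA ltr_pdivrMr // mulrC ltr_pM2l // ltrDl.
have := indep b b0 (enum_val i0); rewrite /b (big_pred1 i0) => [/eqP|l].
  by rewrite (negbTE ai0).
by rewrite (inj_eq enum_val_inj).
Qed.

Theorem places_over P : exists (V : seq (place R K)) (m : place R K -> nat),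
  [/\ uniq V, forall v, v \in V -> lies_over v P (m v),
      forall v n, lies_over v P n -> v \in V, (\sum_(v <- V) m v = d)%N &
      forall x, (\prod_(v <- V) v x) ^+ d = rat_abs R P (field_norm x)].
Proof.
have [Om [w [hw wq]]] := closed_absval_exists R P.
have [sigma indep] := embeddings_exist K Om.
have hf i : is_absval (w \o sigma i).
  split=> [x|x|x y|x y] /=; first exact: av_ge0.
  - by rewrite (av_eq0 hw) fmorph_eq0.
  - by rewrite rmorphM (avM hw).
  - by rewrite rmorphD (av_le_add hw).
have fq i q : (w \o sigma i) q%:A = rat_abs R P q.
  by rewrite /= rmorphZ_num rmorph1 mulr1 wq.
have /choice[vi hvi] : forall i, exists v : place R K, exists m, lies_over v P m /\
    forall x, v x = w (sigma i x) `^ (m%:R / d%:R).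
  by move=> i; have [v [m h]] := place_of_absval (hf i) (fq i); exists v, m.
have /choice[m hm] : forall v : place R K, exists m,
    (exists n, lies_over v P n) -> lies_over v P m.
  move=> v; have [[n ov]|no] := pselect (exists n, lies_over v P n).
    by exists n.
  by exists 0%N.
pose V := undup [seq vi i | i <- enum 'I_d].
have inV i : vi i \in V by rewrite mem_undup map_f ?mem_enum.
have uV : uniq V := undup_uniq _.
have Vover v : v \in V -> lies_over v P (m v).
  rewrite mem_undup => /mapP[i _ ->]; apply: hm.
  by have [n [ov _]] := hvi i; exists n.
have viE i x : vi i x = w (sigma i x) `^ ((m (vi i))%:R / d%:R).
  have [n [ov ->]] := hvi i.
  by have [_ ->] := over_inj (Vover _ (inV i)) ov.
pose A v := finset (fun i => vi i == v); pose g v := #|A v|.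
have g_le v : v \in V -> (g v <= m v)%N.
  move=> vV; apply: (card_embeddings_le (A := A v) hw indep (Vover _ vV)) => i.
  by rewrite inE => /eqP <- x; rewrite viE.
have sum_g : (\sum_(v <- V) g v = d)%N.
  rewrite -[RHS]card_ord -sum1_card.
  under eq_bigr do rewrite /g -sum1_card.
  rewrite (exchange_big_dep xpredT) //=; apply: eq_bigr => i _.
  rewrite sum1_count (eq_count (a2 := pred1 (vi i))) ?count_uniq_mem ?inV // => v.
  by rewrite inE eq_sym.
have sum_m : (\sum_(v <- V) m v <= d)%N by exact: sum_local_degrees_seq uV Vover.
have sum_mg : (\sum_(v <- V) m v = d)%N.
  apply/eqP; rewrite eqn_leq sum_m -sum_g !big_seq.
  by apply: leq_sum => v; exact: g_le.
have m_g v : v \in V -> m v = g v.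
  move=> vV; apply/eqP; rewrite eqn_leq g_le // andbT leqNgt; apply/negP => gm.
  have : (\sum_(v <- V) g v < \sum_(v <- V) m v)%N.
    rewrite !(bigD1_seq v) //= -addSn leq_add // big_seq_cond [leqRHS]big_seq_cond.
    by apply: leq_sum => u /andP[uV' _]; exact: g_le.
  by rewrite sum_g sum_mg ltnn.
exists V, m; split=> // [v n ov|x].
  apply: contraT => vV.
  (* The local degrees in [V] already exhaust d, so a further place would have local degree 0. *)
  have : (\sum_(u <- v :: V) m u <= d)%N.
    apply: (@sum_local_degrees_seq _ P); first by rewrite /= vV.
    move=> u; rewrite in_cons => /orP[/eqP ->|]; last exact: Vover.
    by apply: hm; exists n.
  rewrite big_cons sum_mg -[leqRHS]add0n leq_add2r leqn0 => /eqP m0.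
  by have := over_gt0 (hm v (ex_intro _ n ov)); rewrite m0.
(* The norm of x is the product of its conjugates. Those inducing v have a common size u with v x =
   u^(m_v / d), and there are exactly m_v of them. *)
rewrite -wq (norm_embeddings indep) (av_prod hw) -prodrXl.
rewrite [in RHS](eq_bigr (fun i => \prod_(v <- V | vi i == v) w (sigma i x))); last first.
  move=> i _; rewrite big_const_seq (eq_count (a2 := pred1 (vi i))); last first.
    by move=> v; rewrite /= eq_sym.
  by rewrite count_uniq_mem // inV /= mulr1.
rewrite (exchange_big_dep xpredT) //= big_seq [RHS]big_seq; apply: eq_bigr => v vV.
have s0 := over_exp_gt0 (Vover v vV).
have [i1 i1v] : exists i, vi i = v.
  by move: vV; rewrite mem_undup => /mapP[i _ ->]; exists i.
pose u := w (sigma i1 x).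
have u0 : 0 <= u by exact: av_ge0.
have vu : v x = u `^ ((m v)%:R / d%:R) by rewrite -i1v viE.
rewrite (eq_bigr (fun=> u)) => [|i /eqP iv]; last first.
  apply: (powR_injective s0); rewrite ?nnegrE ?(av_ge0 hw) //.
  by rewrite -vu -iv viE.
rewrite prodr_const -/(g v) -[in RHS](eq_card (A := A v)); last first.
  by move=> i; rewrite inE.
rewrite -/(g v) -m_g // vu -!powR_mulrn ?powR_ge0 // -powRrM divfK //.
by rewrite pnatr_eq0 -lt0n dim_gt0.
Qed.

End PlacesOver.

(** * The product formula *)

(** Rational places are coded by integers so that products over them range over finite lists; 0
    stands for the infinite place. *)
Definition place_code (P : ratplace) : nat := if P is PFin p _ then p else 0.

Definition code_place (c : nat) : ratplace :=
  if @idP (prime c) is ReflectT pp then PFin pp else PInf.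

Lemma code_placeK P : code_place (place_code P) = P.
Proof.
case: P => [|p pp] /=; rewrite /code_place; case: {-}_ / idP => // pp'.
by congr PFin; exact: bool_irrelevance.
Qed.

Lemma rat_product_formula (R : realType) (q : rat) B : q != 0 ->
  (`|numq q| <= B)%N -> (`|denq q| <= B)%N ->
  \prod_(c <- [seq c <- iota 0 B.+1 | (c == 0) || prime c])
    rat_abs R (code_place c) q = 1.
Proof.
move=> q0 nB dB; rewrite big_filter /= big_cons /=.
have prod_logn n : (0 < n <= B)%N ->
    \prod_(c <- iota 1 B | (c == 0) || prime c) (c%:R ^+ logn c n : R) = n%:R.
  move=> /andP[n0 nB']; rewrite big_mkcond -[in RHS](partnT n0).
  rewrite (widen_partn _ nB') natr_prod big_ltn // lognE /= expn0 mul1r.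
  rewrite /index_iota subn1 /=; apply: eq_big_seq => c.
  rewrite mem_iota => /andP[c0 _]; rewrite natrX gtn_eqF //=.
  by case: ifP => // c_np; rewrite lognE c_np expr0.
rewrite big_seq_cond (eq_bigr (fun c => c%:R ^+ logn c `|denq q|%N / c%:R ^+ logn c `|numq q|%N)).
  rewrite -big_seq_cond.
  rewrite prodf_div !prod_logn ?absz_gt0 ?numq_eq0 ?denq_neq0 ?q0 //.
  rewrite {1}/code_place; case: {-}_ / idP => //= _.
  rewrite -[in ratr _](divq_num_den q) normrM normfV rmorphM fmorphV /= !ratr_norm !ratr_int.
  have natE (z : int) : (`|z|%N)%:R = `|z%:~R| :> R by rewrite natr_absz intr_norm.
  rewrite !natE; field.
  by rewrite !normr_eq0 !intr_eq0 numq_eq0 q0 denq_neq0.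
move=> c /andP[]; rewrite mem_iota => /andP[c0 _] /orP[/eqP c0'|pc].
  by rewrite c0' in c0.
rewrite /code_place; case: {-}_ / idP => // pc'.
rewrite /= (negbTE q0) expfzDr ?pnatr_eq0 -?lt0n ?prime_gt0 //.
by rewrite -exprnN -exprnP.
Qed.

Section ProductFormula.
Variables (R : realType) (K : fieldExtType rat).
Local Notation d := (\dim {:K}).
Implicit Types v : place R K.

Lemma infinite_placeP v : infinite_place v <-> exists m, lies_over v PInf m.
Proof.
split=> [[C [m [dm hv]]]|[m ov]].
  by exists m; split=> //; exact: (ext_degree_local_basis (absv_absval v) dm).
have [P [C [m' [dm hv]]]] := absv_normalized v.
have ov' : lies_over v P m'.
  by split=> //; exact: (ext_degree_local_basis (absv_absval v) dm).
have [PE _] := over_inj ov ov'.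
by rewrite /infinite_place PE; exists C, m'.
Qed.

(* [s(v)] of the paper without the classification of archimedean
   completions: the exponent with which [|.|_v] scales on the integers *)
Definition weight v : R :=
  if `[< infinite_place v >] then ln (v 2%:A) / ln 2 else 0.

Lemma weight_inf v m : lies_over v PInf m -> weight v = m%:R / d%:R.
Proof.
move=> ov; rewrite /weight asboolT; last by apply/infinite_placeP; exists m.
case: (ov) => -> _; rewrite /= ger0_norm // ratr_nat ln_powR mulfK //.
by rewrite gt_eqF // ln_gt0 // ltr1n.
Qed.

Lemma weight_fin v p (pp : prime p) m : lies_over v (PFin pp) m -> weight v = 0.
Proof.
move=> ov; rewrite /weight asboolF // => /infinite_placeP[n ov'].
by have [] := over_inj ov ov'.
Qed.

Lemma weight_ge0 v : 0 <= weight v.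
Proof.
have [[|p pp] [m ov]] := over_exists v.
  by rewrite (weight_inf ov) divr_ge0.
by rewrite (weight_fin ov).
Qed.

Lemma place_nat_le v n : v n%:R <= n%:R `^ weight v.
Proof.
have e : (n%:R : K) = (n%:R : rat)%:A by rewrite scaler_nat.
have [->|n0] := posnP n; first by rewrite (av0 (absv_absval v)) powR_ge0.
have [[|p pp] [m ov]] := over_exists v; rewrite e; case: (ov) => -> _.
  by rewrite (weight_inf ov) /= ger0_norm // ratr_nat.
rewrite (weight_fin ov) powRr0.
have h := rat_abs_nat_le1 R pp n.
have := ge0_ler_powR (ltW (over_exp_gt0 ov)) _ _ h.
by rewrite !nnegrE rat_abs_ge0 powR1 => /(_ isT ler01).
Qed.

Lemma place_nat_inf v n : infinite_place v -> v n%:R = n%:R `^ weight v.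
Proof.
have e : (n%:R : K) = (n%:R : rat)%:A by rewrite scaler_nat.
move=> /infinite_placeP[m ov]; rewrite e (weight_inf ov); case: (ov) => -> _.
by rewrite /= ger0_norm // ratr_nat.
Qed.

Section FinitelyManyPlaces.
Variables (S : seq (place R K)) (uS : uniq S).
Hypothesis hS : forall v, infinite_place v -> v \in S.

(** The infinite places all belong to [S] and have weight m / d, and the local degrees above
    infinity add up to d. *)
Lemma sum_weight : \sum_(v <- S) weight v = 1.
Proof.
have [V [m [uV Vover allV sumV _]]] := places_over R K PInf.
have [d0 VS] : d%:R != 0 :> R /\ {subset V <= S}.
  split=> [|v vV]; first by rewrite pnatr_eq0 -lt0n dim_gt0.
  by apply/hS/infinite_placeP; exists (m v); exact: Vover.
transitivity (\sum_(v <- S | v \in V) weight v).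
  rewrite [RHS]big_mkcond; apply: eq_bigr => v _; case: ifPn => // vV.
  rewrite /weight asboolF // => /infinite_placeP[n /allV].
  by rewrite (negbTE vV).
have pVS : perm_eq [seq v <- S | v \in V] V.
  apply: uniq_perm; rewrite ?filter_uniq // => v; rewrite mem_filter.
  by have [/VS ->|] := boolP (v \in V).
rewrite -big_filter (perm_big _ pVS) /= big_seq.
rewrite (eq_bigr (fun v => (m v)%:R / d%:R)) => [|v /Vover/weight_inf //].
by rewrite -big_seq -mulr_suml -natr_sum sumV divff.
Qed.

(** The places of [S] are grouped by the rational place below. Completing a group to all places
    above that rational place adds factors at most 1, and the d-th power of the completed product is
    the absolute value of the norm, to which the rational product formula applies. *)
Theorem product_formula_ge x : x != 0 -> (forall v, v \notin S -> v x <= 1) ->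
  1 <= \prod_(v <- S) v x.
Proof.
move=> x0 hx; pose N := field_norm x.
have N0 : N != 0 by rewrite (field_norm_eq0 algC).
have /choice[pl hpl] : forall v, exists P, exists m, lies_over v P m.
  by move=> v; have [P [m]] := over_exists v; exists P, m.
have /choice[V hV] : forall P, exists V : seq (place R K), [/\ uniq V,
    forall v, v \in V -> pl v = P, forall v, pl v = P -> v \in V &
    (\prod_(v <- V) v x) ^+ d = rat_abs R P N].
  move=> P; have [V [m [uV Vover allV _ prodV]]] := places_over R K P.
  exists V; split=> // [v /Vover ov|v vP]; have [n ov'] := hpl v.
    by have [] := over_inj ov' ov.
  by apply: (allV v n); rewrite -vP.
pose code v := place_code (pl v).
(* Large enough for the primes dividing the norm and for those below a place of [S]. *)
pose B := (`|numq N| + `|denq N| + \sum_(v <- S) code v)%N.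
pose cs := [seq c <- iota 0 B.+1 | (c == 0) || prime c].
have ucs : uniq cs by rewrite filter_uniq ?iota_uniq.
have codeS v : v \in S -> code v \in cs.
  move=> vS; rewrite mem_filter mem_iota add0n ltnS /=; apply/andP; split.
    by rewrite /code; case: (pl v) => // p pp /=; rewrite pp orbT.
  by rewrite /B (bigD1_seq v) //= addnCA leq_addr.
have -> : \prod_(v <- S) v x = \prod_(c <- cs) \prod_(v <- S | code v == c) v x.
  rewrite (exchange_big_dep xpredT) //= !big_seq; apply: eq_bigr => v vS.
  rewrite big_const_seq (eq_count (a2 := pred1 (code v))) => [|c]; last first.
    by rewrite /= eq_sym.
  by rewrite count_uniq_mem // codeS //= mulr1.
have d0 : (0 < d)%N := dim_gt0 K.
have ge0 (P : pred (place R K)) W : 0 <= \prod_(v <- W | P v) v x.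
  by apply: prodr_ge0 => v _; exact: av_ge0 (absv_absval v) _.
have := @rat_product_formula R N B N0.
rewrite -/cs => /(_ (leq_trans (leq_addr _ _) (leq_addr _ _))).
have -> : (`|denq N| <= B)%N by rewrite /B -addnA addnCA leq_addr.
move=> /(_ isT) prod1.
rewrite -(ler_pXn2r d0) ?nnegrE ?prodr_ge0 // expr1n -[X in X <= _]prod1 -prodrXl.
rewrite big_seq [leRHS]big_seq; apply: ler_prod => c.
rewrite mem_filter => /andP[c_ok _]; rewrite rat_abs_ge0 /=.
have [uV Vpl plV <-] := hV (code_place c).
have codeK : place_code (code_place c) = c.
  case/orP: c_ok => [/eqP ->|pc]; first by rewrite /code_place; case: {-}_ / idP.
  by rewrite /code_place; case: {-}_ / idP.
rewrite ler_pXn2r ?nnegrE // (bigID (mem S)) /=.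
have perm_cS : perm_eq [seq v <- V (code_place c) | v \in S] [seq v <- S | code v == c].
  apply: uniq_perm; rewrite ?filter_uniq // => v; rewrite !mem_filter andbC.
  congr (_ && _); apply/idP/eqP => [/Vpl|vc]; first by rewrite /code => ->.
  by apply: plV; rewrite -vc code_placeK.
rewrite -big_filter (perm_big _ perm_cS) big_filter ler_piMr //.
rewrite prodr_ile1 // => v vS; rewrite hx // andbT.
exact: av_ge0 (absv_absval v) x.
Qed.

End FinitelyManyPlaces.

(** For a complex place the point is that the local degree m is not 1. If it were, the completion
    would contain a square root j of -1 and rationals t arbitrarily close to it, although |j - t| |j
    + t| = |1 + t^2| >= 1. *)
Lemma splace_le v (Kv : completion v) : splace Kv <= weight v.
Proof.
rewrite /splace; case: asboolP => [[inf _]|_].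
  have [m ov] := (infinite_placeP v).1 inf; rewrite (weight_inf ov).
  by rewrite ler_pM2r ?invr_gt0 ?ltr0n ?dim_gt0 // ler1n (over_gt0 ov).
case: asboolP => [[inf [phi phi_bij]]|_]; last exact: weight_ge0.
have [m ov] := (infinite_placeP v).1 inf; rewrite (weight_inf ov).
rewrite ler_pM2r ?invr_gt0 ?ltr0n ?dim_gt0 // ler_nat.
have m0 := over_gt0 ov; rewrite ltn_neqAle m0 andbT; apply/eqP => m1.
case: _ / m1 in ov; have hv := absv_absval v; have hK := cabs_absval Kv.
have [vq [e [_ dense]]] := ov.
have [j phij] : exists j, j ^+ 2 = -1 :> Kv.
  have [psi _ phiK] := phi_bij; exists (psi 'i).
  by apply: (fmorph_inj phi); rewrite rmorphXn rmorphN1 phiK sqrCi.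
have absj : cabs j = 1.
  apply/eqP; rewrite -(@eqrXn2 _ 2) ?av_ge0 // -(avX hK) phij (avN hK) (av1 hK).
  by rewrite expr1n.
have approx x t : 0 < t -> exists q : rat, v (x - q *: e ord0) < t.
  by move=> t0; have [q] := dense x t t0; rewrite big_ord1; exists (q ord0).
have [p16 p64] : (0 < 16^-1 :> R) /\ (0 < 64^-1 :> R) by rewrite !invr_gt0.
have [y hy] := cemb_dense j p16.
(* The local basis has a single element e. As r e is close to 1 and q e to y, the rational q / r is
   close to y. The tolerances give |j - t| < 1/4 and |j + t| <= 9/4, whose product is less than
   1. *)
have [r hr] := approx 1 _ p64; have [q hq] := approx y _ p16.
have vr : 2^-1 <= v (r *: e ord0).
  have := av_ge_sub hv 1 (r *: e ord0); rewrite (av1 hv); lra.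
have r0 : r != 0.
  by apply: contraTneq vr => ->; rewrite scale0r (av0 hv) -ltNge invr_gt0.
have vy : v y <= 1 + 16^-1.
  have := av_ge_sub hK (cemb Kv y) j; rewrite cabs_ext absj (av_distC hK).
  by rewrite lerBlDl => /le_trans; apply; rewrite lerD2l ltW.
have vqe : v (q *: e ord0) <= v y + 16^-1.
  have := av_ge_sub hv (q *: e ord0) y; rewrite (av_distC hv); lra.
have vqr : v (q / r)%:A <= 2 * (1 + 16^-1 + 16^-1).
  have : v (q *: e ord0) = v (q / r)%:A * v (r *: e ord0).
    by rewrite -(avM hv) mulr_algl scalerA divfK.
  move=> vqeE; rewrite vqeE in vqe.
  have := ler_wpM2l (av_ge0 hv (q / r)%:A) vr; lra.
have yqr : v (y - (q / r)%:A) <= 16^-1 + 2 * (1 + 16^-1 + 16^-1) / 64.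
  have -> : y - (q / r)%:A = (y - q *: e ord0) - (q / r)%:A * (1 - r *: e ord0).
    by rewrite mulrBr mulr1 mulr_algl scalerA divfK // opprB addrA subrK.
  apply: le_trans (av_le_sub hv _ _) _; rewrite (avM hv).
  by apply: lerD; [exact: ltW|apply: ler_pM; rewrite ?(av_ge0 hv) // ltW].
set t := q / r in yqr.
have a_lt : cabs (j - cemb Kv t%:A) < 4^-1.
  have := av_tri hK j (cemb Kv y) (cemb Kv t%:A).
  rewrite -rmorphB cabs_ext; lra.
have : cabs (j - cemb Kv t%:A) * cabs (j + cemb Kv t%:A) = v (1 + t ^+ 2)%:A.
  rewrite -(avM hK) -subr_sqr phij -(cabs_ext Kv) -(avN hK) opprB opprK addrC.
  congr cabs; rewrite -[(1 + t ^+ 2)%:A]/(in_alg K (1 + t ^+ 2)).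
  by rewrite rmorphD rmorph1 rmorphXn /= rmorphD rmorph1 rmorphXn.
have b_le : cabs (j + cemb Kv t%:A) <= 2 + 4^-1.
  have -> : j + cemb Kv t%:A = j + j - (j - cemb Kv t%:A) by ring.
  apply: le_trans (av_le_sub hK _ _) _; have := av_le_add hK j j.
  rewrite absj; lra.
have ge1 : 1 <= v (1 + t ^+ 2)%:A.
  rewrite vq; apply: (@le_trans _ _ (1 `^ (1 / d%:R))); first by rewrite powR1.
  have le1 : 1 <= rat_abs R PInf (1 + t ^+ 2).
    rewrite /= ger0_norm ?addr_ge0 ?sqr_ge0 // rmorphD rmorph1 rmorphXn lerDl.
    exact: sqr_ge0.
  by apply: ge0_ler_powR; rewrite ?nnegrE ?(le_trans ler01 le1) ?divr_ge0.
move=> e1; move: ge1; rewrite -e1 leNgt => /negP; apply.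
have := ler_pM (av_ge0 hK _) (av_ge0 hK _) (ltW a_lt) b_le.
lra.
Qed.

End ProductFormula.

(** * Sums and determinants under a normalized absolute value *)

Section SumBound.
Variables (R : realType) (F : fieldType) (f : F -> R) (hf : is_absval f).
Variables (s : R) (s0 : 0 <= s) (f_nat : forall n, f n%:R <= n%:R `^ s).

Lemma expr_linear_le1 (t c : R) : 0 <= t ->
  (forall n, t ^+ n <= c * n.+1%:R) -> t <= 1.
Proof.
move=> t0 ht; rewrite leNgt; apply/negP => t1.
have u0 : 0 < t - 1 by rewrite subr_gt0.
pose n := (Num.truncn (3 * `|c| / (t - 1) ^+ 2)).+1.
have hn : 3 * `|c| < n%:R * (t - 1) ^+ 2.
  by rewrite -ltr_pdivrMr ?exprn_gt0 // truncnS_gt.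
have n1 : 1 <= n%:R :> R by rewrite ler1n.
have b : (n%:R * (t - 1)) ^+ 2 <= t ^+ (n * 2).
  rewrite exprM lerXn2r ?nnegrE ?exprn_ge0 ?mulr_ge0 ?(ltW u0) //.
  have := bernoulli n (ltW u0); rewrite subrKC; lra.
have := le_trans b (ht (n * 2)%N); apply/negP; rewrite -ltNge.
apply: (@le_lt_trans _ _ (`|c| * (3 * n%:R))).
  apply: le_trans (ler_norm _) _; rewrite normrM normr_nat ler_wpM2l //.
  rewrite -natr1 natrM; lra.
have n0 : 0 < n%:R :> R by rewrite ltr0n.
by have := hn; rewrite -(ltr_pM2l n0); lra.
Qed.

Lemma bin_le_exp2 n i : ('C(n, i) <= 2 ^ n)%N.
Proof.
elim: n i => [|n IH] [|i]; rewrite ?bin0 ?expn_gt0 ?bin0n //.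
by rewrite binS expnS mul2n -addnn leq_add.
Qed.

(** The binomial expansion of (x + y)^n has n + 1 terms of size at most (2^s M)^n; the factor n + 1
    disappears on taking n-th roots. For s = 0 this is the ultrametric inequality. *)
Lemma av_le_add2 x y M : f x <= M -> f y <= M -> f (x + y) <= 2 `^ s * M.
Proof.
move=> fx fy; have M0 : 0 <= M by apply: le_trans fx; exact: av_ge0.
have [M_eq|Mn0] := eqVneq M 0.
  have zero z : f z <= M -> z = 0.
    by rewrite M_eq => fz; apply/eqP; rewrite -(av_eq0 hf) eq_le fz av_ge0.
  by rewrite (zero x fx) (zero y fy) addr0 (av0 hf) mulr_ge0 ?powR_ge0.
have Mp : 0 < M by rewrite lt0r Mn0.
have C0 : 0 < 2 `^ s * M by rewrite mulr_gt0 ?powR_gt0.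
rewrite -[leRHS]mul1r -ler_pdivrMr //; apply: (@expr_linear_le1 _ 1) => [|n].
  by rewrite divr_ge0 ?(av_ge0 hf) // ltW.
rewrite mul1r expr_div_n ler_pdivrMr ?exprn_gt0 // -(avX hf) exprDn.
apply: le_trans (av_le_sum hf _ _ _) _.
rewrite mulr_natl -[n.+1 in leRHS]card_ord -sumr_const; apply: ler_sum => i _.
rewrite -mulr_natl (avM hf) exprMn ler_pM ?av_ge0 //.
  apply: le_trans (f_nat _) _; rewrite -powR_mulrn ?powR_ge0 // -powRAC powR_mulrn //.
  by apply: ge0_ler_powR; rewrite ?nnegrE ?exprn_ge0 // -natrX ler_nat bin_le_exp2.
have -> : M ^+ n = M ^+ (n - i) * M ^+ i by rewrite -exprD subnK // -ltnS.
by rewrite (avM hf) !(avX hf) ler_pM ?exprn_ge0 ?av_ge0 // lerXn2r ?nnegrE ?av_ge0.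
Qed.

Lemma av_le_sum_pow2 k (a : seq F) M : 0 <= M -> (size a <= 2 ^ k)%N ->
  (forall x, x \in a -> f x <= M) -> f (\sum_(x <- a) x) <= (2 `^ s) ^+ k * M.
Proof.
move=> M0; elim: k a => [|k IH] a sz hM.
  case: a sz hM => [|x [|//]] _ hM; rewrite expr0 mul1r.
    by rewrite big_nil (av0 hf).
  by rewrite big_seq1 hM // mem_head.
rewrite -(cat_take_drop (2 ^ k) a) big_cat /= exprS -mulrA; apply: av_le_add2.
  apply: IH => [|x /mem_take]; [by rewrite size_take_min geq_minl|exact: hM].
apply: IH => [|x /mem_drop]; last exact: hM.
by rewrite size_drop leq_subLR addnn -mul2n -expnS.
Qed.

(** Adding in pairs costs 2^s at each level of a binary tree. The extra factor 2 pays for rounding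
    the number of terms up to a power of two. *)
Lemma av_le_sum_card (I : finType) (g : I -> F) M : 0 <= M ->
  (forall i, f (g i) <= M) -> f (\sum_i g i) <= (2 * #|I|%:R) `^ s * M.
Proof.
move=> M0 hM; have [I0|Ip] := posnP #|I|.
  rewrite big1 ?(av0 hf) ?mulr_ge0 ?powR_ge0 // => i _.
  by have := card0_eq I0 i; rewrite inE.
have /andP[t1 t2] := trunc_log_bounds (isT : 1 < 2)%N Ip.
set k := (trunc_log 2 #|I|).+1 in t2.
have -> : \sum_i g i = \sum_(x <- [seq g i | i <- enum I]) x by rewrite big_map big_enum.
apply: le_trans (av_le_sum_pow2 (k := k) M0 _ _) _.
- by rewrite size_map -cardE ltnW.
- by move=> x /mapP[i _ ->].
rewrite ler_wpM2r // -powR_mulrn ?powR_ge0 // -powRAC powR_mulrn //.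
apply: ge0_ler_powR; rewrite ?nnegrE ?exprn_ge0 ?mulr_ge0 //.
by rewrite -natrX -natrM ler_nat /k expnS leq_mul2l.
Qed.

Lemma av_det_le n (A : 'M[F]_n) (Y : 'I_n -> R) :
  (forall i j, f (A i j) <= Y i) ->
  f (\det A) <= (2 * n`!%:R) `^ s * \prod_i Y i.
Proof.
move=> hA; have Y0 i : 0 <= Y i by apply: le_trans (hA i i); exact: av_ge0.
rewrite -card_Sn; apply: av_le_sum_card => [|sg]; first exact: prodr_ge0.
have fsign : f ((-1) ^+ sg) = 1 by rewrite (avX hf) (avN hf) (av1 hf) expr1n.
by rewrite (avM hf) fsign mul1r (av_prod hf) ler_prod // => i _; rewrite av_ge0 // hA.
Qed.

End SumBound.

(** * Lattices and determinants *)

Lemma det_replace_row (F : comNzRingType) n (A : 'M[F]_n) (x : 'rV[F]_n) j :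
  \det (\matrix_(i, k) (if i == j then x 0 k else A i k)) = (x *m \adj A) 0 j.
Proof.
rewrite (expand_det_row _ j) mxE; apply: eq_bigr => k _.
rewrite !mxE eqxx; congr (_ * _); rewrite /cofactor; congr (_ * \det _).
by apply/matrixP => a b; rewrite !mxE eq_sym (negbTE (neq_lift _ _)).
Qed.

Lemma fiber_pigeonhole (T C : finType) (f : T -> C) N : (#|C| * N < #|T|)%N ->
  exists c, (N < #|finset (fun x => f x == c)|)%N.
Proof.
move=> h; apply: contrapT => /forallNP no; move: h; rewrite ltnNge => /negP; apply.
rewrite -sum1_card (partition_big f xpredT) //= -sum_nat_const.
apply: leq_sum => c _; rewrite leqNgt; apply/negP => h; apply: (no c).
by rewrite -sum1_card (eq_bigl (fun x => f x == c)) // => x; rewrite inE.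
Qed.

Lemma common_denominator k N (W : 'M[rat]_(k, N)) :
  exists2 D : int, D != 0 & exists W' : 'M[int]_(k, N), map_mx intr W' = D%:~R *: W.
Proof.
pose D : int := \prod_i \prod_j denq (W i j).
have D0 : D != 0.
  by apply/prodf_neq0 => i _; apply/prodf_neq0 => j _; exact: denq_neq0.
exists D => //.
exists (\matrix_(i, j) (numq (W i j) * \prod_(l | l != i) \prod_c denq (W l c)
   * \prod_(c | c != j) denq (W i c))).
apply/matrixP => i j; rewrite !mxE /D [in RHS](bigD1 i) //= [in RHS](bigD1 j) //= !rmorphM /=.
rewrite [(numq _)%:~R]numqE; ring.
Qed.

Lemma residue_eq (m a b : int) : m != 0 ->
  (`|(a %% m)%Z| %% `|m| = `|(b %% m)%Z| %% `|m|)%N -> (m %| a - b)%Z.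
Proof.
move=> m0; have lt z : (`|(z %% m)%Z| < `|m|)%N.
  by rewrite -ltz_nat gez0_abs ?modz_ge0 // ltz_mod.
rewrite !modn_small ?lt // => e; rewrite -eqz_mod_dvd; apply/eqP.
by rewrite -[LHS]gez0_abs ?modz_ge0 // e gez0_abs ?modz_ge0.
Qed.

(* In Smith coordinates the rows of [W] have at most [m ^ N] residues modulo [m]. *)
Lemma congruent_pair (m k N : nat) (W : 'M[rat]_(k, N)) :
  (0 < m)%N -> (m ^ N < k)%N ->
  exists i j, i != j /\ exists c : 'rV[int]_k,
    row i W - row j W = m%:R *: (map_mx intr c *m W).
Proof.
move=> m0 mk; have [D D0 [W' hW']] := common_denominator W.
have [L uL [Q _ [s _ W'E]]] := int_Smith_normal_form W'.
pose cl (i : 'I_k) : {ffun 'I_N -> 'I_m} :=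
  [ffun a : 'I_N => Ordinal (ltn_pmod (`|(L i (insubd i (a : nat)) %% m)%Z|) m0)].
have [i [j [ij clij]]] : exists i j, i != j /\ cl i = cl j.
  have /injectivePn[i [j ij e]] : ~~ injectiveb cl; last by exists i, j.
  apply/injectiveP => /leq_card.
  by rewrite card_ffun !card_ord leqNgt mk.
exists i, j; split=> //.
pose S : 'M[int]_(k, N) := \matrix_(a, b) (s`_a *+ (a == b :> nat)).
pose t : 'rV[int]_k := \row_a ((L i a - L j a) %/ m)%Z.
have tS : (row i L - row j L) *m S = m%:Z *: (t *m S).
  apply/rowP => b; rewrite !mxE mulr_sumr; apply: eq_bigr => a _.
  rewrite !mxE; have [ab|_] := eqVneq (a : nat) b; last by rewrite !mulr0n !mulr0.
  rewrite mulr1n mulrA; congr (_ * _); rewrite mulrC divzK //.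
  have /ffunP/(_ b) := clij; rewrite !ffunE => /(congr1 val) /=.
  have -> : insubd i (b : nat) = a by apply: val_inj; rewrite val_insubd -ab ltn_ord.
  have -> : insubd j (b : nat) = a by apply: val_inj; rewrite val_insubd -ab ltn_ord.
  by apply: residue_eq; rewrite eqz_nat -lt0n.
exists (t *m invmx L).
have key : row i W' - row j W' = m%:Z *: (t *m invmx L *m W').
  rewrite W'E -/S !row_mul -!mulmxBl tS.
  by rewrite -scalemxAl -!mulmxA (mulmxA (invmx L)) mulVmx // mul1mx !mulmxA.
have D0' : D%:~R != 0 :> rat by rewrite intr_eq0.
have rE a : D%:~R *: row a W = map_mx intr (row a W').
  by rewrite map_row hW' linearZ.
apply: (scalerI D0'); rewrite scalerBr !rE -map_mxB key.
rewrite /= map_mxZ /= -pmulrn scalerA mulrC -scalerA; congr (_ *: _).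
by rewrite map_mxM hW' -scalemxAr.
Qed.

(** In [integer_cover], a box of (20 n)^n points falls into at most 2 n! 2^n classes, and some class
    must contain more points than the at most 40 n^2 values of a form. For n = 2 the inequality
    fails: 2560 against 1600. *)
Lemma numeric_box n : (2 < n)%N ->
  (2 * n`! * 2 ^ n * (40 * n ^ 2) < (20 * n) ^ n)%N.
Proof.
move=> n2; have fact_le : (n`! <= n ^ n)%N.
  rewrite fact_prod -[X in (_ <= _ ^ X)%N](card_ord n) -prod_nat_const.
  rewrite big_add1 /= big_mkord; apply: leq_prod => i _; exact: ltn_ord.
have h : (80 * n ^ 2 < 10 ^ n)%N.
  elim: n n2 {fact_le} => // n IH; rewrite ltnS leq_eqVlt => /orP[/eqP <- //|n2].
  have {}IH := IH n2; have e : (n.+1 ^ 2 <= 4 * n ^ 2)%N by nia.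
  rewrite [X in (_ < X)%N]expnS; lia.
rewrite expnMn [(20 ^ n)%N](_ : _ = 10 ^ n * 2 ^ n)%N; last by rewrite -expnMn.
have p2 : (0 < 2 ^ n)%N by rewrite expn_gt0.
have pn : (0 < n ^ n)%N by rewrite expn_gt0 (leq_trans _ n2).
have : (80 * n ^ 2 * (2 ^ n * n ^ n) < 10 ^ n * 2 ^ n * n ^ n)%N.
  by rewrite -[(10 ^ n * _ * _)%N]mulnA ltn_pmul2r // muln_gt0 p2.
apply: leq_ltn_trans.
have : (2 ^ n * (40 * n ^ 2) * (2 * n`!) <= 2 ^ n * (40 * n ^ 2) * (2 * n ^ n))%N.
  by rewrite leq_mul2l leq_mul2l fact_le !orbT.
lia.
Qed.

(** The forms in [integer_cover] are differences of at most 40 n^2 vectors; this is where 200^n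
    appears. *)
Lemma numeric_pairs n : (2 < n)%N -> ((40 * n ^ 2) ^ 2 <= 200 ^ n)%N.
Proof.
elim: n => // n IH; rewrite ltnS leq_eqVlt => /orP[/eqP <- //|n2].
have {}IH := IH n2; have e : (40 * n.+1 ^ 2 <= 4 * (40 * n ^ 2))%N by nia.
rewrite [X in (_ <= X)%N]expnS; apply: leq_trans (leq_mul (leqnn 200) IH).
by apply: leq_trans (leq_mul e e) _; rewrite mulnACA mulnn leq_mul2r orbT.
Qed.

(* Pigeonhole in the dual lattice: among more linear forms [y] than the values
   [x *m y] can take on a given [x], two agree at [x]. *)
Lemma integer_cover n (X : set 'rV[int]_n) : (2 < n)%N ->
  (forall A : 'M[int]_n, (forall i, X (row i A)) ->
     (`|\det A|%N <= 2 * n`! * 2 ^ n)%N) ->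
  (forall A : 'M[int]_n, (forall i, X (row i A)) -> \det A = 0) \/
  exists Y : seq 'cV[int]_n, [/\ (size Y <= 200 ^ n)%N,
    forall y, y \in Y -> y != 0 &
    forall x, X x -> exists2 y, y \in Y & x *m y = 0].
Proof.
move=> n2 hX.
have [h|/existsNP[A1 /not_implyP[XA1 dA1]]] :=
  pselect (forall A : 'M[int]_n, (forall i, X (row i A)) -> \det A = 0); [by left|right].
have ex : exists k, `[< exists A : 'M[int]_n, (forall i, X (row i A)) /\ `|\det A|%N = k >].
  by exists `|\det A1|%N; apply/asboolP; exists A1.
have ub k : `[< exists A : 'M[int]_n, (forall i, X (row i A)) /\ `|\det A|%N = k >] ->
    (k <= 2 * n`! * 2 ^ n)%N.
  by move=> /asboolP[A [XA <-]]; exact: hX.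
(* Maximality of I = |det A| bounds the Cramer coordinates of every x in [X] with respect to [A]. *)
case: (ex_maxnP ex ub) => I /asboolP[A [XA AI]] maxI.
have I0 : (0 < I)%N.
  apply: leq_trans (maxI `|\det A1|%N _); last by apply/asboolP; exists A1.
  by rewrite absz_gt0; apply/eqP.
have detA : \det A != 0 by rewrite -absz_gt0 AI.
have cramer x : X x -> forall j, (`|(x *m \adj A) ord0 j|%N <= I)%N.
  move=> Xx j; rewrite -det_replace_row; apply: maxI; apply/asboolP.
  eexists; split; last reflexivity; move=> i.
  have [->|ij] := eqVneq i j.
    rewrite (_ : row j _ = x) //; apply/rowP => k; by rewrite !mxE eqxx.
  rewrite (_ : row i _ = row i A) //; apply/rowP => k; by rewrite !mxE (negbTE ij).
have [L uL [Q uQ [s _ AE]]] := int_Smith_normal_form A.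
pose S : 'M[int]_n := \matrix_(a, b) (s`_a *+ (a == b :> nat)).
have S_diag : S = diag_mx (\row_i s`_i).
  by apply/matrixP => a b; rewrite !mxE.
have abs_unit (M : 'M[int]_n) : M \in unitmx -> `|\det M|%N = 1%N.
  move=> /mulmxV/(congr1 (absz \o determinant)); rewrite /= det_mulmx det1 abszM.
  by move=> /eqP; rewrite muln_eq1 => /andP[/eqP].
have prodI : (\prod_(i < n) `|(s`_i)%R|)%N = I.
  rewrite -AI AE -/S !det_mulmx !abszM (abs_unit _ uL) (abs_unit _ uQ) mul1n muln1 S_diag det_diag.
  by rewrite (big_morph absz abszM absz1); apply: eq_bigr => i _; rewrite mxE.
have s0 i : (i < n)%N -> (0 < `|(s`_i)%R|)%N.
  move=> i_n; rewrite lt0n; apply: contraTneq I0 => si.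
  by rewrite -prodI (bigD1 (Ordinal i_n)) //= si mul0n.
(* The box [0, M)^n is sorted by classes modulo A Z^n, which number I; N counts the integers of
   absolute value at most n (M - 1), the possible values of the forms to be constructed. *)
pose M := (20 * n)%N; have M0 : (0 < M)%N by rewrite muln_gt0 (leq_trans _ n2).
pose N := (2 * n * M.-1).+1.
pose vec (u : {ffun 'I_n -> 'I_M}) : 'cV[int]_n := \col_i (u i : nat)%:Z.
(* In terms of the Smith form A = L S Q, the class of u modulo A Z^n is L^-1 u modulo the diagonal
   entries of S. *)
pose cl u : {dffun forall i : 'I_n, 'I_(`|(s`_i)%R|)} := [ffun i : 'I_n =>
  Ordinal (ltn_pmod `|((invmx L *m vec u) i ord0 %% (s`_i)%R)%Z| (s0 i (ltn_ord i)))].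
have n0 : (0 < n)%N := leq_trans (isT : 0 < 3)%N n2.
have [|c] := @fiber_pigeonhole _ _ cl N.
  have -> : #|{dffun forall i : 'I_n, 'I_(`|(s`_i)%R|)}| = I.
    rewrite card_dep_ffun -prodI foldrE big_map big_enum /=.
    by apply: eq_bigr => i _; rewrite card_ord.
  rewrite card_ffun !card_ord; apply: leq_ltn_trans (numeric_box n2).
  apply: leq_mul; first by rewrite -AI; exact: hX.
  by rewrite /N /M; nia.
set E := finset _ => cardE'.
have memE u : (u \in E) = (cl u == c) by rewrite inE.
have [u0 u0E] : exists u0, u0 \in E.
  by apply/set0Pn; rewrite -card_gt0 (leq_trans _ cardE').
have /choice[yy hyy] : forall u, exists y : 'cV[int]_n, u \in E -> vec u - vec u0 = A *m y.
  move=> u; have [uE|uE] := boolP (u \in E); last by exists 0.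
  pose w := invmx L *m (vec u - vec u0).
  exists (invmx Q *m (\col_i (w i ord0 %/ (s`_i)%R)%Z)) => _.
  rewrite AE -/S -!mulmxA (mulmxA Q) mulmxV // mul1mx.
  rewrite -[LHS]mul1mx -(mulmxV uL) -mulmxA; congr (_ *m _).
  rewrite S_diag mul_diag_mx; apply/colP => i; rewrite [RHS]mxE [X in X * _]mxE [X in _ * X]mxE.
  suff si : (s`_i %| w i ord0)%Z by rewrite mulrC divzK // ord1.
  have -> : w i ord0 = (invmx L *m vec u) i ord0 - (invmx L *m vec u0) i ord0.
    by rewrite /w mulmxBr [LHS]mxE; congr (_ + _); rewrite [LHS]mxE.
  have clE : cl u = cl u0 by move: uE u0E; rewrite !memE => /eqP -> /eqP ->.
  have /ffunP/(_ i) := clE; rewrite !ffunE => /(congr1 val) /=.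
  by apply: residue_eq; rewrite -absz_gt0 s0.
pose es := take N.+1 (enum E).
have es_size : size es = N.+1.
  by rewrite size_takel // -cardE.
have es_uniq : uniq es by rewrite take_uniq ?enum_uniq.
have esE u : u \in es -> u \in E by move=> /mem_take; rewrite mem_enum.
pose Y := [seq y <- [seq yy u - yy u' | u <- es, u' <- es] | y != 0].
exists Y; split.
- apply: leq_trans (numeric_pairs n2).
  rewrite size_filter (leq_trans (count_size _ _)) // size_allpairs es_size mulnn.
  by rewrite leq_sqr /N /M; nia.
- by move=> y; rewrite mem_filter => /andP[].
move=> x Xx; pose B := (n * M.-1)%N.
pose g u : int := (x *m yy u) ord0 ord0.
(* Here det A times g(u) is the product of x adj(A) with u - u0. The entries of the first are at
   most I = |det A|, those of the second at most M - 1. *)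
have g_le u : u \in E -> (`|g u| <= B)%N.
  move=> uE; rewrite -(leq_pmul2l I0) -{1}AI -abszM.
  have -> : \det A * g u = \sum_j (x *m \adj A) ord0 j * (vec u - vec u0) j ord0.
    transitivity ((x *m \adj A *m (A *m yy u)) ord0 ord0).
      by rewrite mulmxA -(mulmxA x) mul_adj_mx mul_mx_scalar -scalemxAl [RHS]mxE.
    by rewrite -hyy // mxE.
  rewrite -lez_nat abszE; apply: le_trans (ler_norm_sum _ _ _) _.
  apply: (@le_trans _ _ (\sum_(j < n) (I * M.-1)%N%:Z)); last first.
    by rewrite sumr_const card_ord /B -mulr_natr natz -PoszM lez_nat (mulnC n) mulnA.
  apply: ler_sum => j _; rewrite normrM -!abszE -PoszM lez_nat leq_mul ?cramer //.
  have le_M (a b : nat) : (a < M)%N -> (b < M)%N -> (`|a%:Z - b%:Z| <= M.-1)%N by lia.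
  by rewrite !mxE; apply: le_M.
have [i [j [ij gij]]] : exists i j : 'I_N.+1, i != j /\ g (nth u0 es i) = g (nth u0 es j).
  pose h (i : 'I_N.+1) : 'I_N := inord `|(g (nth u0 es i) + B%:Z)%R|.
  have /injectivePn[i [j ij hij]] : ~~ injectiveb h.
    by apply/injectiveP => /leq_card; rewrite !card_ord ltnn.
  exists i, j; split=> //.
  have gB k : (k < N.+1)%N -> (`|g (nth u0 es k)| <= B)%N.
    by move=> kN; apply/g_le/esE/mem_nth; rewrite es_size.
  have gi := gB i (ltn_ord i); have gj := gB j (ltn_ord j).
  have BN : (2 * n * M.-1 = B + B)%N by rewrite /B; lia.
  have lt_N (z : int) : (`|z| <= B)%N -> (`|(z + B%:Z)%R| < N)%N by rewrite /N BN; lia.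
  have inj_N (z w : int) : (`|z| <= B)%N -> (`|w| <= B)%N ->
    `|(z + B%:Z)%R|%N = `|(w + B%:Z)%R|%N -> z = w by lia.
  by apply: inj_N => //; have /= := congr1 (@nat_of_ord N) hij; rewrite /h !inordK ?lt_N.
have enth k : (k < N.+1)%N -> nth u0 es k \in E.
  by move=> kN; apply/esE/mem_nth; rewrite es_size.
exists (yy (nth u0 es i) - yy (nth u0 es j)).
  rewrite mem_filter; apply/andP; split; last first.
    by apply/allpairsP; exists (nth u0 es i, nth u0 es j); rewrite !mem_nth ?es_size.
  rewrite subr_eq0; apply/eqP => yE; case/negP: ij.
  suff /eqP : nth u0 es i = nth u0 es j by rewrite nth_uniq ?es_size.
  apply/ffunP => k.
  have : vec (nth u0 es i) - vec u0 = vec (nth u0 es j) - vec u0.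
    by rewrite !hyy ?enth // yE.
  by move=> /addIr/colP/(_ k); rewrite !mxE => -[] /val_inj.
apply/eqP; rewrite mulmxBr subr_eq0; apply/eqP/matrixP => a b.
by rewrite !ord1; exact: gij.
Qed.

(** A maximal free family in [X] spans all of [X]; with n members it would form a matrix of nonzero
    determinant. *)
Lemma proper_span (K : fieldType) n (X : set 'rV[K]_n) :
  (forall A : 'M[K]_n, (forall i, X (row i A)) -> \det A = 0) ->
  exists2 U : {vspace 'cV[K]_n}, U != fullv & forall x, X x^T -> x \in U.
Proof.
move=> hX.
pose P k := `[< exists s : seq 'cV[K]_n, [/\ free s, forall x, x \in s -> X x^T & size s = k] >].
have P0 : exists k, P k.
  by exists 0; apply/asboolP; exists [::]; split=> //; exact: nil_free.
have Ple k : P k -> (k <= \dim (fullv : {vspace 'cV[K]_n}))%N.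
  by move=> /asboolP[s [fs _ <-]]; rewrite -(eqP fs) dimvS ?subvf.
case: (ex_maxnP P0 Ple) => k /asboolP[s [fs sX sk]] maxk.
exists <<s>>%VS; last first.
  move=> x Xx; apply: contrapT => /negP xs.
  have /maxk : P k.+1; last by rewrite ltnn.
  apply/asboolP; exists (x :: s); rewrite free_cons xs /= sk; split=> // y.
  by rewrite inE => /predU1P[->|/sX].
apply/negP => /eqP sfull.
have sn : size s = n.
  by move: fs; rewrite /free sfull dimvf => /eqP <-; rewrite /dim /= muln1.
pose A : 'M[K]_n := \matrix_(i, j) s`_i j 0.
have rA i : row i A = (s`_i)^T by apply/rowP => j; rewrite !mxE.
have /eqP/det0P[v v0 vA] : \det A = 0.
  by apply: hX => i; rewrite rA; apply/sX/mem_nth; rewrite sn.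
have /freeP fr : free (in_tuple s) by [].
case/negP: v0; apply/eqP/rowP => i; rewrite [RHS]mxE.
have -> : i = cast_ord sn (cast_ord (esym sn) i) by apply: val_inj.
apply: (fr (fun a => v 0 (cast_ord sn a))); apply/colP => j.
have /rowP/(_ j) := vA; rewrite !mxE => vAj; rewrite summxE -[RHS]vAj.
rewrite (reindex (cast_ord sn)) /=; last first.
  by exists (cast_ord (esym sn)) => a _; apply: val_inj.
by apply: eq_bigr => a _; rewrite !mxE.
Qed.

(* A basis whose determinant is minimal up to a factor 2 is a lattice basis:
   otherwise rounding coordinates halves the determinant. *)
Lemma lattice_basis (R : realType) (K : fieldType) (f : K -> R) n (La : set 'rV[K]_n)
    (kappa : R) (Z0 : 'M[K]_n) :
  (forall x, 0 <= f x) -> (forall x y, f (x * y) = f x * f y) ->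
  (forall x, exists a : int, f (x - a%:~R) <= 2^-1) ->
  (forall x y, La x -> La y -> La (x - y)) ->
  0 < kappa -> (forall Z : 'M[K]_n, (forall i, La (row i Z)) -> \det Z != 0 ->
     kappa <= f (\det Z)) ->
  (forall i, La (row i Z0)) -> \det Z0 != 0 ->
  exists Z : 'M[K]_n, [/\ forall i, La (row i Z), \det Z != 0 &
    forall x, La x -> exists a : 'rV[int]_n, x = map_mx intr a *m Z].
Proof.
move=> f0 fM round subL k0 hk LZ0 dZ0.
pose good (Z : 'M[K]_n) := (forall i, La (row i Z)) /\ \det Z != 0.
have [Z [[LZ dZ] minZ]] : exists Z, good Z /\
    forall Z', good Z' -> f (\det Z) < 2 * f (\det Z').
  apply: contrapT => /forallNP no.
  have halve Z : good Z -> exists Z', good Z' /\ 2 * f (\det Z') <= f (\det Z).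
    move=> gZ; have /not_andP[//|/existsNP[Z' /not_implyP[gZ' h]]] := no Z.
    by exists Z'; split=> //; rewrite leNgt; exact/negP.
  have iter k : exists Z, good Z /\ 2 ^+ k * f (\det Z) <= f (\det Z0).
    elim: k => [|k [Z [gZ IH]]]; first by exists Z0; rewrite expr0 mul1r.
    have [Z' [gZ' h]] := halve Z gZ; exists Z'; split=> //; apply: le_trans IH.
    by rewrite exprSr -mulrA ler_pM2l // exprn_gt0.
  pose k := Num.truncn (f (\det Z0) / kappa).
  have [Z [[LZ dZ] h]] := iter k.+1.
  have : f (\det Z0) < 2 ^+ k.+1 * kappa.
    rewrite -ltr_pdivrMr //; apply: lt_trans (truncnS_gt _) _.
    by rewrite -natrX ltr_nat ltn_expl.
  apply/negP; rewrite -leNgt; apply: le_trans h.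
  by rewrite ler_pM2l ?exprn_gt0 //; apply: hk.
exists Z; split=> // x Lx.
have uZ : Z \in unitmx by rewrite unitmxE unitfE.
have /choice[a ha] := fun j => round ((x *m invmx Z) 0 j).
pose av : 'rV[int]_n := \row_j a j; exists av; apply/eqP; rewrite -subr_eq0.
have La0 : La 0 by rewrite -(subrr x); exact: subL.
have LaD u w : La u -> La w -> La (u + w).
  by move=> Lu Lw; rewrite -[w]opprK -[- w]sub0r; apply: (subL _ _ Lu); exact: subL.
have Lint u (b : int) : La u -> La (b%:~R *: u).
  move=> Lu; have Lnat m : La (m%:R *: u).
    elim: m => [|m IH]; first by rewrite scale0r.
    by rewrite -natr1 scalerDl scale1r; exact: LaD.
  case: b => m; first by rewrite -pmulrn.
  by rewrite NegzE mulrNz -pmulrn scaleNr -sub0r; exact: subL.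
set y := x - _.
have Ly : La y.
  apply: (subL _ _ Lx); rewrite mulmx_sum_row; apply: big_ind => // j _.
  by rewrite mxE; apply/Lint/LZ.
have yE : y = (x *m invmx Z - map_mx intr av) *m Z.
  by rewrite mulmxBl mulmxKV.
rewrite yE; apply: contraT => nz.
have [j wj] : exists j, (x *m invmx Z - map_mx intr av) 0 j != 0.
  apply: contrapT => /forallNP no; case/negP: nz.
  rewrite (_ : _ - _ = 0) ?mul0mx //; apply/rowP => j; rewrite [RHS]mxE.
  by apply/eqP/negPn/negP/no.
set w := x *m invmx Z - _ in yE wj.
pose Z' : 'M[K]_n := \matrix_(i, k) (if i == j then y 0 k else Z i k).
have dZ' : \det Z' = \det Z * w 0 j.
  by rewrite det_replace_row yE -mulmxA mul_mx_adj mul_mx_scalar mxE.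
have gZ' : good Z'.
  split; last by rewrite dZ' mulf_neq0.
  move=> i; have [->|ij] := eqVneq i j.
    by rewrite (_ : row j Z' = y) //; apply/rowP => k; rewrite !mxE eqxx.
  rewrite (_ : row i Z' = row i Z) //; apply/rowP => k; by rewrite !mxE (negbTE ij).
have := minZ Z' gZ'; rewrite dZ' fM.
have : f (w 0 j) <= 2^-1 by rewrite !mxE; have := ha j; rewrite mxE.
have := f0 (\det Z); nra.
Qed.

(** * Covering the solutions *)

Lemma prod_powR (R : realType) (I : Type) (r : seq I) (a : R) (F : I -> R) :
  0 < a -> \prod_(i <- r) a `^ F i = a `^ (\sum_(i <- r) F i).
Proof.
move=> a0; elim: r => [|i r IH]; first by rewrite !big_nil powRr0.
by rewrite !big_cons IH powRD ?(gt_eqF a0) ?implybT.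
Qed.

Lemma mxBE (V : zmodType) m n (M N : 'M[V]_(m, n)) i j : (M - N) i j = M i j - N i j.
Proof. by rewrite !mxE. Qed.

Section LocalDeterminant.
Variables (R : realType) (K : fieldExtType rat) (v : place R K).
Variables (Kv : completion v) (A : alg_closure Kv).

Lemma det_base_emb n (M : 'M[K]_n) :
  \det (map_mx (base_emb A) M) = base_emb A (\det M).
Proof. exact: (det_map_mx (aemb A \o cemb Kv)). Qed.

Lemma aabs_base_emb x : aabs (base_emb A x) = v x.
Proof. by rewrite /base_emb aabs_ext cabs_ext. Qed.

Lemma aabs_nat_le n : aabs (n%:R : A) <= n%:R `^ weight v.
Proof.
apply: le_trans (place_nat_le v n); rewrite -(aabs_base_emb n%:R).
by rewrite /base_emb !rmorph_nat.
Qed.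

Lemma local_det_le n (al : 'M[A]_n) (b : 'I_n -> R) (Z : 'M[K]_n) :
  (forall j i, aabs ((al *m map_mx (base_emb A) (row j Z)^T) i 0) <= b i) ->
  aabs (\det al) * v (\det Z) <= (2 * n`!%:R) `^ weight v * \prod_i b i.
Proof.
move=> hb; have hA := aabs_absval A.
have -> : aabs (\det al) * v (\det Z) = aabs (\det (al *m map_mx (base_emb A) Z^T)).
  by rewrite det_mulmx det_base_emb det_tr (avM hA) aabs_base_emb.
apply: (av_det_le hA (weight_ge0 v) aabs_nat_le) => i j.
rewrite (_ : _ i j = (al *m map_mx (base_emb A) (row j Z)^T) i 0) //.
by rewrite !mxE; apply: eq_bigr => k _; rewrite !mxE.
Qed.

Lemma weight_fin_eq0 : ~ infinite_place v -> weight v = 0.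
Proof. by move=> fin; rewrite /weight asboolF. Qed.

Lemma place_ultra x y M : ~ infinite_place v -> v x <= M -> v y <= M -> v (x - y) <= M.
Proof.
move=> fin vx vy; have hv := absv_absval v.
have := av_le_add2 hv (weight_ge0 v) (place_nat_le v) vx.
by rewrite weight_fin_eq0 // powRr0 mul1r => h; apply: h; rewrite (avN hv).
Qed.

Lemma aabs_ultra x y M : ~ infinite_place v ->
  aabs (x : A) <= M -> aabs y <= M -> aabs (x - y) <= M.
Proof.
move=> fin vx vy; have hA := aabs_absval A.
have := av_le_add2 hA (weight_ge0 v) aabs_nat_le vx.
by rewrite weight_fin_eq0 // powRr0 mul1r => h; apply: h; rewrite (avN hA).
Qed.

End LocalDeterminant.

Section Lattice.
Variables (R : realType) (n : nat) (K : fieldExtType rat).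
Variables (Kv : forall v : place R K, completion v).
Variables (A : forall v : place R K, alg_closure (Kv v)).
Variables (S : seq (place R K)) (uS : uniq S).
Hypothesis hS : forall v, infinite_place v -> v \in S.
Variables (al : forall v, 'M[A v]_n) (b : place R K -> 'I_n -> R).
Hypothesis al0 : forall v, v \in S -> 0 < aabs (\det (al v)).
Hypothesis b0 : forall v i, 0 <= b v i.
Hypothesis budget : \prod_(v <- S) \prod_i b v i <=
  2 ^+ n * \prod_(v <- S) aabs (\det (al v)).
Local Notation d := (\dim {:K}).
Implicit Types (x y z : 'rV[K]_n) (X Z : 'M[K]_n).

Definition local_bound v x :=
  forall i, aabs ((al v *m map_mx (base_emb (A v)) x^T) i 0) <= b v i.

(* the lattice cut out by the conditions at the finite places *)
Definition fin_lattice : set 'rV[K]_n := [set x : 'rV[K]_n |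
  (forall v, v \notin S -> forall i, v (x 0 i) <= 1) /\
  (forall v, v \in S -> ~ infinite_place v -> local_bound v x)].

Definition local_sols : set 'rV[K]_n := [set x : 'rV[K]_n |
  (forall v, v \notin S -> forall i, v (x 0 i) <= 1) /\
  (forall v, v \in S -> local_bound v x)].

Lemma local_sols_lattice x : local_sols x -> fin_lattice x.
Proof. by case=> h1 h2; split=> // v vS _; exact: h2. Qed.

Lemma fin_latticeB x y : fin_lattice x -> fin_lattice y -> fin_lattice (x - y).
Proof.
move=> [x1 x2] [y1 y2]; split=> [v vS i|v vS fin i].
  rewrite !mxE; apply: place_ultra; [|exact: x1|exact: y1].
  by move=> /hS; rewrite (negbTE vS).
have -> : map_mx (base_emb (A v)) (x - y)^T =
    map_mx (base_emb (A v)) x^T - map_mx (base_emb (A v)) y^T.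
  by apply/matrixP => a c; rewrite !mxE /base_emb !rmorphB.
by rewrite mulmxBr mxBE; apply: aabs_ultra; [|exact: x2|exact: y2].
Qed.

Lemma lattice_det_integral Z : (forall i, fin_lattice (row i Z)) ->
  forall v, v \notin S -> v (\det Z) <= 1.
Proof.
move=> LZ v vS; have fin : ~ infinite_place v by move=> /hS; rewrite (negbTE vS).
have := @av_det_le _ _ _ (absv_absval v) _ (weight_ge0 v) (place_nat_le v) n Z (fun=> 1).
rewrite weight_fin_eq0 // powRr0 mul1r big1 //; apply=> i j.
by have [/(_ v vS j)] := LZ i; rewrite mxE.
Qed.

(** At an infinite place the rows of [X] are bounded and det X = c det Z brings in |c| to the power
    [weight v]; at a finite place the rows of [Z] are bounded and the weight is 0. As the weights
    sum to 1, the product over [S] contains exactly |c|. *)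
Lemma lattice_index_le X Z (c : int) : (forall i, local_sols (row i X)) ->
  (forall i, fin_lattice (row i Z)) -> \det Z != 0 -> \det X = c%:~R * \det Z ->
  (`|c| <= 2 * n`! * 2 ^ n)%N.
Proof.
move=> sX LZ dZ XZ; have [->//|c0] := eqVneq c 0.
have c0' : 0 < `|c|%N%:R :> R by rewrite ltr0n absz_gt0.
have P := product_formula_ge uS dZ (lattice_det_integral LZ).
have D0 : 0 < \prod_(v <- S) aabs (\det (al v)).
  by rewrite big_seq prodr_gt0.
have loc v : v \in S -> aabs (\det (al v)) * v (\det Z) * `|c|%N%:R `^ weight v <=
    (2 * n`!%:R) `^ weight v * \prod_i b v i.
  move=> vS; have [inf|fin] := pselect (infinite_place v).
    rewrite -(place_nat_inf _ inf) -mulrA -(avM (absv_absval v)).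
    have -> : v (\det Z * `|c|%N%:R) = v (\det X).
      rewrite XZ mulrC !(avM (absv_absval v)); congr (_ * _).
      by case: (c) => // k; rewrite NegzE mulrNz (avN (absv_absval v)) -pmulrn.
    by apply: local_det_le => j i; have [_ /(_ v vS i)] := sX j.
  rewrite {1}(weight_fin_eq0 fin) powRr0 mulr1.
  by apply: local_det_le => j i; have [_ /(_ v vS fin i)] := LZ j.
have : \prod_(v <- S) (aabs (\det (al v)) * v (\det Z) * `|c|%N%:R `^ weight v) <=
    \prod_(v <- S) ((2 * n`!%:R) `^ weight v * \prod_i b v i).
  rewrite big_seq [leRHS]big_seq; apply: ler_prod => v vS; rewrite loc // andbT.
  by rewrite !mulr_ge0 ?powR_ge0 ?(av_ge0 (aabs_absval _)) ?(av_ge0 (absv_absval _)).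
have f0 : 0 < 2 * n`!%:R :> R by rewrite mulr_gt0 // ltr0n fact_gt0.
rewrite !big_split /= !prod_powR // sum_weight // !powRr1 ?(ltW f0) ?(ltW c0') //.
move=> /le_trans/(_ (ler_wpM2l (ltW f0) budget)) h.
rewrite -(ler_nat R) !natrM natrX -(ler_pM2r D0).
apply: le_trans; last by rewrite -mulrA; exact: h.
rewrite mulrC -mulrA ler_pM2l // ler_peMl // ltW.
Qed.

(** The classes are represented by a maximal family of pairwise incongruent solutions. If it were
    too large, [congruent_pair], applied to the n d rational coordinates of its members, would give
    two whose difference is m times an integral combination of members, hence m times an element of
    the lattice. *)
Lemma congruent_cover m : (0 < m)%N ->
  exists ys : seq 'rV[K]_n, (size ys <= m ^ (n * d))%N /\
    forall x, local_sols x -> exists2 y, y \in ys &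
      exists2 z, fin_lattice z & x - y = m%:R *: z.
Proof.
move=> m0; pose cong x y := exists2 z, fin_lattice z & x - y = m%:R *: z.
have L0 x : fin_lattice x -> fin_lattice 0 by move=> Lx; rewrite -(subrr x); exact: fin_latticeB.
have LN x : fin_lattice x -> fin_lattice (- x).
  by move=> Lx; rewrite -sub0r; apply: fin_latticeB => //; exact: L0 Lx.
have cong_sym x y : cong x y -> cong y x.
  by move=> [z Lz e]; exists (- z); [exact: LN|rewrite scalerN -e opprB].
pose ncong x y := ~~ `[< cong x y >].
pose P k := `[< exists s : seq 'rV[K]_n, [/\ pairwise ncong s,
  forall x, x \in s -> local_sols x & size s = k] >].
have P0 : exists k, P k by exists 0; apply/asboolP; exists [::].
have Ple k : P k -> (k <= m ^ (n * d))%N.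
  move=> /asboolP[s [ps sX sk]]; rewrite leqNgt; apply/negP => k_gt.
  pose e := vbasis {:K}.
  pose W : 'M[rat]_(k, n * d) :=
    \matrix_(i < k) mxvec (\matrix_(a < n, j < d) coord e j (s`_i 0 a)).
  have [i [j [ij [c hc]]]] := congruent_pair W m0 k_gt.
  pose z := \sum_l (c 0 l)%:~R *: s`_l.
  have sL (l : 'I_k) : fin_lattice s`_l.
    by apply/local_sols_lattice/sX/mem_nth; rewrite sk.
  have LD x y : fin_lattice x -> fin_lattice y -> fin_lattice (x + y).
    by move=> Lx Ly; rewrite -[y]opprK; apply: fin_latticeB => //; exact: LN.
  have Lz : fin_lattice z.
    apply: big_ind => [|//|l _]; first exact: L0 (sL i).
    have Lnat k' : fin_lattice (k'%:R *: s`_l).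
      elim: k' => [|k' IH]; first by rewrite scale0r; exact: L0 (sL i).
      by rewrite -natr1 scalerDl scale1r; exact: LD.
    case: (c 0 l) => k'; first by rewrite -pmulrn.
    by rewrite NegzE mulrNz -pmulrn scaleNr; exact: LN.
  have cij : cong s`_i s`_j.
    exists z => //; apply/rowP => a; apply/eqP; rewrite -subr_eq0; apply/eqP.
    set y := _ - _; rewrite (coord_vbasis (memvf y)) big1 // => q _.
    suff -> : coord e q y = 0 by rewrite scale0r.
    have /rowP/(_ (mxvec_index a q)) := hc.
    rewrite !mxE !mxvecE !mxE /y !mxE => hq.
    rewrite !raddfB /=.
    suff -> : coord e q (m%:R * z 0 a) =
        m%:R * \sum_l map_mx intr c 0 l * W l (mxvec_index a q).
      by rewrite hq subrr.
    rewrite [m%:R * z 0 a]mulr_natl raddfMn -[LHS]mulr_natl /=; congr (_ * _).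
    rewrite /z summxE raddf_sum /=; apply: eq_bigr => l _.
    by rewrite !mxE mxvecE mxE mulrzl raddfMz -mulrzl.
  have : ncong s`_i s`_j.
    have/(pairwiseP 0) ps' := ps.
    have [lt|gt|/val_inj eq_ij] := ltngtP i j; last by rewrite eq_ij eqxx in ij.
      by apply: ps'; rewrite // inE sk.
    have : ncong s`_j s`_i by apply: ps'; rewrite // inE sk.
    by rewrite /ncong; apply: contra => /asboolP/cong_sym/asboolP.
  by rewrite /ncong; move/asboolP.
case: (ex_maxnP P0 Ple) => k /asboolP[s [ps sX sk]] maxk.
exists s; split; first by rewrite sk; apply: Ple; apply/asboolP; exists s.
move=> x sx; apply: contrapT => no.
have /maxk : P k.+1; last by rewrite ltnn.
apply/asboolP; exists (x :: s); rewrite /= ps sk andbT; split=> //.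
  apply/allP => y ys; apply/asboolPn => -[z Lz e]; apply: no.
  by exists y => //; exists z.
by move=> y; rewrite inE => /predU1P[->|/sX].
Qed.

Definition sols_covered_by (N : nat) := exists T : seq {vspace 'cV[K]_n},
  [/\ (size T <= N)%N, forall U, U \in T -> U != fullv &
      forall w : 'cV[K]_n, local_sols w^T -> exists2 U, U \in T & w \in U].

Lemma family_cover (I : eqType) (s : seq I) (P : I -> set 'rV[K]_n) :
  (forall i, i \in s -> forall X, (forall j, P i (row j X)) -> \det X = 0) ->
  (forall x, local_sols x -> exists2 i, i \in s & P i x) ->
  sols_covered_by (size s).
Proof.
move=> hP cov.
have /choice[U hU] : forall i, exists U : {vspace 'cV[K]_n}, i \in s ->
    U != fullv /\ forall w : 'cV[K]_n, P i w^T -> w \in U.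
  move=> i; have [si|_] := boolP (i \in s); last by exists 0%VS.
  by have [U] := proper_span (hP i si); exists U.
exists (map U s); rewrite size_map; split=> //.
  by move=> _ /mapP[i /hU[h _] ->].
move=> x /cov[i si Px]; exists (U i); first exact: map_f.
by have [_] := hU i si; apply.
Qed.

Lemma congruent_det_eq0 m y X : (0 < n)%N -> (2 * n`! * 2 ^ n < m ^ n.-1)%N ->
  (forall i, local_sols (row i X) /\
     exists2 z, fin_lattice z & row i X - y = m%:R *: z) ->
  \det X = 0.
Proof.
move=> n0 hm hX; pose o := Ordinal n0.
have /choice[z hz] : forall i, exists z,
    fin_lattice z /\ row i X - row o X = m%:R *: z.
  move=> i; have [_ [z Lz ez]] := hX i; have [_ [z0 Lz0 ez0]] := hX o.
  exists (z - z0); split; first exact: fin_latticeB.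
  by rewrite scalerBr -ez -ez0 opprB addrA subrK.
pose Z : 'M[K]_n := \matrix_i (if i == o then row o X else z i).
(* It encodes x_i = x_o + m z_i. Since o is the first index, T is lower triangular with diagonal 1,
   m, ..., m. *)
pose T : 'M[K]_n := \matrix_(i, k)
  (if k == o then 1 else if i == k then m%:R else 0).
have XE : X = T *m Z.
  apply/row_matrixP => i; rewrite row_mul mulmx_sum_row (bigD1 o) //= rowK eqxx.
  rewrite !mxE eqxx scale1r.
  have [->|io] := eqVneq i o.
    rewrite big1 ?addr0 // => k ko.
    by rewrite !mxE (negbTE ko) eq_sym (negbTE ko) scale0r.
  rewrite (bigD1 i) //= big1 => [|k /andP[ko ki]].
    by rewrite addr0 rowK !mxE (negbTE io) eqxx -(hz i).2 addrC subrK.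
  by rewrite !mxE (negbTE ko) eq_sym (negbTE ki) scale0r.
have dT : \det T = (m ^ n.-1)%N%:R.
  rewrite det_trig; last first.
    apply/is_trig_mxP => i k ik; rewrite !mxE.
    have -> : (k == o) = false by apply/negbTE; rewrite -val_eqE /= -lt0n (leq_ltn_trans _ ik).
    by rewrite -val_eqE /= ltn_eqF.
  rewrite (bigD1 o) //= !mxE eqxx mul1r natrX.
  rewrite (eq_bigr (fun=> m%:R)) => [|i io]; last by rewrite !mxE (negbTE io) eqxx.
  by rewrite prodr_const cardC1 card_ord.
apply/eqP; apply: contraT => dX.
have dXE : \det X = (m ^ n.-1)%N%:Z%:~R * \det Z by rewrite {1}XE det_mulmx dT -pmulrn.
have dZ : \det Z != 0 by apply: contraNneq dX; rewrite dXE => ->; rewrite mulr0.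
have LZ i : fin_lattice (row i Z).
  rewrite rowK; case: ifP => _; last exact: (hz i).1.
  exact/local_sols_lattice/(hX o).1.
have : (m ^ n.-1 <= _)%N := lattice_index_le (fun i => (hX i).1) LZ dZ dXE.
by rewrite leqNgt hm.
Qed.

(** With n = k + 1 it follows from n! <= n^k and 4 * 2^k < 90^k. *)
Lemma numeric_index : (1 < n)%N -> (2 * n`! * 2 ^ n < (90 * n) ^ n.-1)%N.
Proof.
case: n => // k; rewrite ltnS /= => k0.
have hf : (k.+1`! <= k.+1 ^ k)%N.
  elim: k k0 => // k IH _; have [->//|/IH h] := posnP k.
  rewrite factS expnS leq_mul2l /=; apply: leq_trans h _.
  by case: (k) => // k'; rewrite leq_exp2r.
have h2 : (4 * 2 ^ k < 90 ^ k)%N.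
  elim: k k0 {hf} => // k IH _; have [->//|/IH h] := posnP k.
  by rewrite !expnS; lia.
rewrite expnMn expnS; apply: (@leq_ltn_trans (4 * 2 ^ k * k.+1 ^ k)).
  have := leq_mul (leqnn (4 * 2 ^ k)) hf; lia.
by rewrite ltn_pmul2r // expn_gt0.
Qed.

Theorem general_cover : (1 < n)%N -> sols_covered_by ((90 * n) ^ (n * d)).
Proof.
move=> n1; have n0 := ltnW n1; have m0 : (0 < 90 * n)%N by rewrite muln_gt0.
have [ys [ys_size ys_cov]] := congruent_cover m0.
pose P y := [set x : 'rV[K]_n | local_sols x /\
  exists2 z, fin_lattice z & x - y = (90 * n)%:R *: z].
have [y _ X hX|x sx|T [sT T1 T2]] := @family_cover _ ys P.
- exact: congruent_det_eq0 n0 (numeric_index n1) hX.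
- by have [y yys e] := ys_cov x sx; exists y.
by exists T; split=> //; exact: leq_trans sT ys_size.
Qed.

(** The product over the infinite places acts as the ordinary absolute value, its exponents being
    weights with sum 1. *)
Lemma rational_round : {:K}%VS = 1%VS -> forall x : K, exists a : int,
  \prod_(v <- S | `[< infinite_place v >]) v (x - a%:~R) <= 2^-1.
Proof.
move=> K1 x; have : x \in 1%VS by rewrite -K1 memvf.
move=> /vlineP[q ->]; pose a := Num.floor (q + 2^-1); exists a.
have d1 : d = 1 by rewrite K1 dimv1.
have -> : q *: 1 - a%:~R = (q - a%:~R)%:A :> K.
  by rewrite scalerBl -[a%:~R *: 1]mulr_algl; congr (_ - _); rewrite mulr1 -[RHS]/(in_alg K _) rmorph_int.
set t := q - a%:~R.
have t_le : `|t| <= 2^-1.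
  have /andP[] := floor_itv (q + 2^-1); rewrite -/a intrD ler_norml /t; lra.
rewrite (eq_bigr (fun v => ratr `|t| `^ weight v)); last first.
  by move=> v /asboolP/infinite_placeP[m ov]; rewrite (weight_inf ov); case: ov => ->.
apply: (@le_trans _ _ (\prod_(v <- S | `[< infinite_place v >]) 2^-1 `^ weight v)).
  apply: ler_prod => v _; rewrite powR_ge0 ge0_ler_powR ?nnegrE ?weight_ge0 ?ler0q ?invr_ge0 //.
  have -> : 2^-1 = ratr 2^-1 :> R by rewrite fmorphV rmorph_nat.
  by rewrite ler_rat.
rewrite big_mkcond (eq_bigr (fun v => 2^-1 `^ weight v)) => [|v _]; last first.
  by case: asboolP => // fin; rewrite weight_fin_eq0 // powRr0.
by rewrite prod_powR ?invr_gt0 // sum_weight // powRr1 ?invr_ge0.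
Qed.

Theorem rational_cover : {:K}%VS = 1%VS -> (2 < n)%N -> sols_covered_by (200 ^ n).
Proof.
move=> K1 n2.
have one_cover : (forall X, (forall i, local_sols (row i X)) -> \det X = 0) ->
    sols_covered_by (200 ^ n).
  move=> h; have [_ _|x sx|T [sT T1 T2]] := @family_cover unit [:: tt] (fun=> local_sols).
  - exact: h.
  - by exists tt.
  by exists T; split=> //; apply: leq_trans sT _; rewrite expn_gt0.
have [h|/existsNP[Z0 /not_implyP[LZ0 /eqP dZ0]]] :=
    pselect (forall Z, (forall i, fin_lattice (row i Z)) -> \det Z = 0).
  by apply: one_cover => X sX; apply: h => i; exact: local_sols_lattice.
pose f (x : K) := \prod_(v <- S | `[< infinite_place v >]) v x.
have f_ge0 (x : K) : 0 <= f x by apply: prodr_ge0 => v _; exact: av_ge0 (absv_absval v) _.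
have fM (x y : K) : f (x * y) = f x * f y.
  by rewrite /f -big_split; apply: eq_bigr => v _; exact: avM (absv_absval v) _ _.
(* [T] bounds the finite part of a lattice determinant, so the product formula bounds the infinite
   part from below; adding 1 makes the bound invertible even when T = 0. *)
pose T := \prod_(v <- S | ~~ `[< infinite_place v >])
  (\prod_i b v i / aabs (\det (al v))).
have T0 : 0 <= T.
  by apply: prodr_ge0 => v _; rewrite divr_ge0 ?prodr_ge0 // (av_ge0 (aabs_absval _)).
have hk Z : (forall i, fin_lattice (row i Z)) -> \det Z != 0 ->
    (T + 1)^-1 <= f (\det Z).
  move=> LZ dZ; have := product_formula_ge uS dZ (lattice_det_integral LZ).
  rewrite (bigID (fun v => `[< infinite_place v >])) /= -/(f _) => P1.
  have h : \prod_(v <- S | ~~ `[< infinite_place v >]) v (\det Z) <= T.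
    rewrite big_seq_cond /T [leRHS]big_seq_cond; apply: ler_prod.
    move=> v /andP[vS /asboolPn fin]; rewrite (av_ge0 (absv_absval v)) /=.
    rewrite ler_pdivlMr ?al0 // mulrC.
    apply: le_trans (local_det_le (b := b v) _) _.
      by move=> j i; have [_ /(_ v vS fin i)] := LZ j.
    by rewrite weight_fin_eq0 // powRr0 mul1r.
  rewrite -[leLHS]mul1r ler_pdivrMr ?ltr_wpDl //.
  have := ler_wpM2l (f_ge0 (\det Z)) h; have := f_ge0 (\det Z); lra.
have Tp : 0 < (T + 1)^-1 by rewrite invr_gt0 ltr_wpDl.
have [Z [LZ dZ hZ]] := lattice_basis f_ge0 fM (rational_round K1) fin_latticeB Tp
  hk LZ0 dZ0.
have uZ : Z \in unitmx by rewrite unitmxE unitfE.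
pose X : set 'rV[int]_n := [set a | local_sols (map_mx intr a *m Z)].
have rowX (C : 'M[int]_n) : (forall i, X (row i C)) ->
    forall i, local_sols (row i (map_mx intr C *m Z)).
  by move=> XC i; rewrite row_mul -map_row; exact: XC.
have detX (C : 'M[int]_n) : \det (map_mx intr C *m Z) = (\det C)%:~R * \det Z.
  by rewrite det_mulmx det_map_mx.
have [|h|[Y [sY Y0 covY]]] := @integer_cover n X n2.
- by move=> C /rowX sC; exact: lattice_index_le sC LZ dZ (detX C).
- apply: one_cover => V sV.
  have /choice[a ha] := fun i => hZ (row i V) (local_sols_lattice (sV i)).
  have VE : V = map_mx intr (\matrix_i a i) *m Z.
    by apply/row_matrixP => i; rewrite row_mul -map_row rowK.
  rewrite VE detX h ?mul0r // => i; rewrite rowK /X /= -ha; exact: sV.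
(* The integer form y in the coordinates of the basis [Z] is the form x Z^-1 y on K^n, nonzero since
   [Z] is invertible. *)
pose P (y : 'cV[int]_n) := [set x : 'rV[K]_n | x *m (invmx Z *m map_mx intr y) = 0].
have [y yY V hV|x sx|T' [sT T1 T2]] := @family_cover _ Y P.
- apply/eqP; rewrite -det_tr; apply/det0P.
  exists (invmx Z *m map_mx intr y)^T.
    rewrite trmx_eq0; apply: contraNneq (Y0 y yY) => /(congr1 (mulmx Z)).
    rewrite mulKVmx // mulmx0 => /colP y0; apply/eqP/colP => i.
    have := y0 i; rewrite !mxE -(rmorph_int (in_alg K)) => /eqP.
    by rewrite fmorph_eq0 intr_eq0 => /eqP.
  rewrite -trmx_mul; apply/eqP; rewrite trmx_eq0; apply/eqP/row_matrixP => i.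
  by rewrite row_mul hV row0.
- have [a ha] := hZ x (local_sols_lattice sx).
  have [y yY ay] : exists2 y, y \in Y & a *m y = 0.
    by apply: covY; rewrite /X /= -ha.
  by exists y => //; rewrite /P /= ha mulmxA mulmxK // -map_mxM ay map_mx0.
by exists T'; split=> //; exact: leq_trans sT sY.
Qed.

End Lattice.

(* [c <= w] lets the height be traded for [Q] at the cost of [2 ^ w] only. *)
Lemma height_powR_le (R : realType) (Q h e c w : R) :
  1 <= Q -> Q <= h -> h <= 2 * Q `^ (1 + e) -> c <= w -> 0 <= w ->
  h `^ c <= 2 `^ w * Q `^ (c + w * e).
Proof.
move=> Q1 Qh h_le cw w0; have Q0 : 0 < Q := lt_le_trans ltr01 Q1.
have h0 : 0 < h := lt_le_trans Q0 Qh.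
have powD (a x y : R) : 0 < a -> a `^ (x + y) = a `^ x * a `^ y.
  by move=> a0; rewrite powRD // (gt_eqF a0) implybT.
have -> : h `^ c = h `^ (c - w) * h `^ w by rewrite -powD // subrK.
have -> : 2 `^ w * Q `^ (c + w * e) = Q `^ (c - w) * (2 * Q `^ (1 + e)) `^ w.
  rewrite powRM ?powR_ge0 // -powRrM mulrCA -powD //; congr (_ * Q `^ _); lra.
apply: ler_pM; rewrite ?powR_ge0 //; last first.
  by apply: ge0_ler_powR; rewrite ?nnegrE ?(ltW h0) ?mulr_ge0 ?powR_ge0.
rewrite -(opprB w c) !powRN lef_pV2 ?posrE ?powR_gt0 //.
by apply: ge0_ler_powR; rewrite ?nnegrE ?(ltW h0) ?(ltW Q0) // subr_ge0.
Qed.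

(** * From inequalities in the height to inequalities in Q *)

Local Open Scope fset_scope.
Local Open Scope ring_scope.

Theorem proposition4p2
  (R : realType) (n : nat) (hn : (2 <= n)%N)
  (K : fieldExtType rat)
  (* K_v, its algebraic closure, and compatible embeddings of K in Qbar and of
     Qbar in the algebraic closure of K_v *)
  (Kv : forall v : place R K, completion v)
  (Kvbar : forall v : place R K, alg_closure (Kv v))
  (kappa : {rmorphism K -> algC})
  (iota : forall v : place R K, {rmorphism algC -> afield (Kvbar v)})
  (hiota : forall (v : place R K) (x : K), iota v (kappa x) = base_emb (Kvbar v) x)
  (S : {fset place R K})
  (hS : forall v : place R K, infinite_place v -> v \in S)
  (* row i of [alpha v] is the coefficient vector of L_i^(v) *)
  (alpha : forall v : place R K, 'M[afield (Kvbar v)]_n)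
  (halg : forall v : place R K, v \in S ->
     forall i j, algebraicOver (base_emb (Kvbar v)) (alpha v i j))
  (hindep : forall v : place R K, v \in S -> row_free (alpha v))
  (C : place R K -> R) (hC : forall v : place R K, v \in S -> 0 < C v)
  (c : place R K -> 'I_n -> R)
  (H D Rb delta : R)
  (h1H : forall v : place R K, v \in S ->
     forall i j, abs_height R (alpha v i j) <= H)
  (h1D : forall v : place R K, v \in S -> forall i j,
     exists m : nat,
       ext_degree (range (base_emb (Kvbar v)))
                  (adjoin1 (base_emb (Kvbar v)) (alpha v i j)) m /\
       m%:R <= D)
  (h2 : (#|` fset_set [set l : 'rV[algC]_n |
               exists2 v : place R K, v \in S &
               exists i, map_mx (iota v) l = row i (alpha v)] |)%:R <= Rb)
  (h3 : 0 < \prod_(v <- S) C v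
          <= \prod_(v <- S) (aabs (\det (alpha v))) `^ (n%:R^-1))
  (h4 : \sum_(v <- S) \sum_(i < n) c v i <= - delta)
  (hdelta : 0 < delta <= 1)
  (h5 : forall v : place R K, v \in S ->
     (forall i, c v i <= splace (Kv v)) /\ (exists i, c v i = splace (Kv v)))
  (Q : R) (hQ : 1 <= Q) :
  let sols : set 'cV[K]_n :=
    [set x : 'cV[K]_n | [/\ forall i, S_integers S (x i 0),
                 forall v : place R K, v \in S -> forall i,
                   aabs ((alpha v *m map_mx (base_emb (Kvbar v)) x) i 0)
                     <= C v * height R x `^ c v i &
                 Q <= height R x < 2 * Q `^ (1 + delta / (2 * n%:R))]] in
  let covered_by (N : nat) :=
    exists T : seq {vspace 'cV[K]_n},
      [/\ (size T <= N)%N,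
          forall U, U \in T -> U != fullv &
          forall x, sols x -> exists2 U, U \in T & x \in U] in
  covered_by ((90 * n) ^ (n * \dim {:K}))%N /\
  ({:K}%VS = 1%VS -> covered_by (200 ^ n)%N).
Proof.
move=> sols covered_by.
have [delta0 delta1] := andP hdelta; have [C0 CD] := andP h3.
have n0 : (0 < n)%N := ltnW hn; have nR : n%:R != 0 :> R by rewrite pnatr_eq0 -lt0n.
have Q0 : 0 < Q := lt_le_trans ltr01 hQ.
pose e := delta / (2 * n%:R).
(* The right-hand side of the inequality after [height_powR_le] has traded the height for Q; the
   value 1 outside [S] keeps [b] nonnegative everywhere. *)
pose b (v : place R K) i :=
  (if v \in S then C v else 1) * (2 `^ weight v * Q `^ (c v i + weight v * e)).
have uS := fset_uniq S.
have al0 v : v \in S -> 0 < aabs (\det (alpha v)).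
  move=> vS; rewrite lt0r (av_ge0 (aabs_absval _)) (av_eq0 (aabs_absval _)) andbT.
  by have := hindep v vS; rewrite row_free_unit unitmxE unitfE.
have b0 v i : 0 <= b v i.
  by rewrite !mulr_ge0 ?powR_ge0 //; case: ifP => // vS; rewrite ltW ?hC.
have budget : \prod_(v <- S) \prod_i b v i <=
    2 ^+ n * \prod_(v <- S) aabs (\det (alpha v)).
  have CSn : (\prod_(v <- S) C v) ^+ n <= \prod_(v <- S) aabs (\det (alpha v)).
    have -> : \prod_(v <- S) aabs (\det (alpha v)) =
        (\prod_(v <- S) aabs (\det (alpha v)) `^ n%:R^-1) ^+ n.
      rewrite -prodrXl; apply: eq_bigr => v _.
      by rewrite -powR_mulrn ?powR_ge0 // -powRrM mulVf // powRr1 // (av_ge0 (aabs_absval _)).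
    by rewrite lerXn2r ?nnegrE ?(ltW C0) // (le_trans (ltW C0)).
  have -> : \prod_(v <- S) \prod_i b v i = (\prod_(v <- S) C v) ^+ n *
      (2 ^+ n * Q `^ (\sum_(v <- S) \sum_(i < n) c v i + n%:R * e)).
    transitivity (\prod_(v <- S) (C v ^+ n * ((2 `^ weight v) ^+ n *
        Q `^ (\sum_(i < n) c v i + weight v * (n%:R * e))))).
      rewrite big_seq [RHS]big_seq; apply: eq_bigr => v vS.
      rewrite /b vS !big_split /= !prodr_const card_ord prod_powR //; congr (_ * (_ * _ `^ _)).
      by rewrite big_split /= sumr_const card_ord -[_ *+ n]mulr_natl mulrCA.
    rewrite !big_split /= !prodrXl !prod_powR // sum_weight // powRr1 //.
    by rewrite big_split /= -mulr_suml sum_weight // mul1r.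
  rewrite mulrC -mulrA ler_pM2l ?exprn_gt0 //; apply: le_trans CSn.
  rewrite -[leRHS]mul1r ler_pM2r ?exprn_gt0 //.
  apply: (@le_trans _ _ (Q `^ 0)); last by rewrite powRr0.
  apply: ler_powR => //.
  (* The width of the height window uses up delta / 2 of the available delta, so the exponent of Q
     is at most - delta / 2. *)
  have -> : n%:R * e = delta / 2 by rewrite /e; field.
  lra.
have sol_bound x : sols x -> local_sols (enum_fset S) alpha b x^T.
  move=> [xO xL xH]; split=> [v vS i|v vS i].
    by rewrite mxE; exact: xO.
  rewrite trmxK; apply: le_trans (xL v vS i) _; rewrite /b vS ler_pM2l ?hC //.
  have [Qx xQ] := andP xH; apply: height_powR_le => //; rewrite ?weight_ge0 //.
    exact: ltW.
  by apply: le_trans (splace_le (Kv v)); have [] := h5 v vS.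
have cover N N' : (N <= N')%N -> sols_covered_by (enum_fset S) alpha b N -> covered_by N'.
  move=> NN [T [sT T1 T2]]; exists T; split=> // [|x /sol_bound/T2 //].
  exact: leq_trans sT NN.
have gen := general_cover uS hS al0 budget hn.
split=> [|K1]; first exact: cover gen.
have [n3|n2] := ltnP 2 n.
  exact: cover (rational_cover uS hS al0 b0 budget K1 n3).
(* For n = 2 and d = 1 the general bound already suffices: 180^2 <= 200^2. *)
apply: cover gen; have -> : n = 2 by apply/eqP; rewrite eqn_leq n2.
by rewrite K1 dimv1 muln1.
Qed.
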